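(* Let $(Z,d,\mu)$, $Q$, $X$, $(\psi_x)$ and $T_n$ be as in the context. (i) Let $0<s<1$, $Q/(Q+s)<p\le\infty$, $0<q\le\infty$. Then there is a constant $C'$ such that $\|T_n(Pf)\|_{\dot{\mathcal B}^s_{p,q}(Z)} \le C'\|f\|_{\dot{\mathcal B}^s_{p,q}(Z)}$ for all $f\in\dot{\mathcal B}^s_{p,q}(Z)$ and all $n\in\mathbb Z$. (ii) Let $0<s<1$, $Q/(Q+s)<p\le\infty$, $0<q<\infty$. Then for every $f\in\dot{\mathcal B}^s_{p,q}(Z)$, $T_n(Pf)\to f$ in $\dot{\mathcal B}^s_{p,q}(Z)$ as $n\to\infty$.
   Context: $(Z,d,\mu)$ is a metric measure space, $\mu$ Borel regular, every ball has positive finite measure, and $\mu$ is doubling. Fix constants $C\ge1$, $Q>0$ with $\mu(B(\xi,\lambda r)) \le C\lambda^Q\mu(B(\xi,r))$ for all $\xi\in Z$, $r>0$, $\lambda\ge1$. Hyperbolic filling: for each $n\in\mathbb Z$ let $(\xi_x)_{x\in X_n}$ be a maximal set of points of $Z$ with pairwise distances at least $2^{-n-1}$; $X=\bigsqcup_n X_n$, $|x|:=n$ for $x\in X_n$, $B(x):=B(\xi_x,2^{-n})$. Distinct $x,x'\in X$ are neighbors, $x\sim x'$, iff $B(x)\cap B(x')\ne\emptyset$ and $||x|-|x'||\le1$. For $u:X\to\mathbb C$, $|du(x)| := \big(\sum_{x'\sim x}|u(x')-u(x)|^2\big)^{1/2}$. $\mathcal I^s_{p,q}(X)$: sequences $u:X\to\mathbb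 C$ with $\|u\|_{\mathcal I^s_{p,q}(X)} := \big(\sum_{k\in\mathbb Z}2^{ksq}\|\sum_{x\in X_k}|u(x)|\chi_{B(x)}\|_{L^p(Z)}^q\big)^{1/q}<\infty$ (usual modification for $p$ or $q=\infty$). $Pf(x):=\frac{1}{\mu(B(x))}\int_{B(x)}f\,d\mu$ for $f\in L^1_{\rm loc}(Z)$. $\dot{\mathcal B}^s_{p,q}(Z)$ (for $p>Q/(Q+s)$): $f\in L^1_{\rm loc}(Z)$ with $\|f\|_{\dot{\mathcal B}^s_{p,q}(Z)}:=\|\,|d(Pf)|\,\|_{\mathcal I^s_{p,q}(X)}<\infty$, modulo a.e. constants. $(\psi_x)_{x\in X}$ is a fixed family of non-negative Lipschitz functions on $Z$ with $\psi_x$ supported in $B(x)$, $(\psi_x)_{x\in X_n}$ a partition of unity on $Z$ for each $n$, and ${\rm Lip}\,\psi_x\le C''2^{|x|}$ for a constant $C''$. For $u:X\to\mathbb C$, $T_nu:=\sum_{x\in X_n}u(x)\psi_x$. *)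

(* Defs.v *)
From HB Require Import structures.
From mathcomp Require Import all_boot all_order all_algebra.
From mathcomp Require Import all_classical all_reals all_analysis.
From mathcomp Require Import complex.
Set Implicit Arguments.
Unset Strict Implicit.
Unset Printing Implicit Defensive.
Import Order.TTheory GRing.Theory Num.Theory.
Import numFieldNormedType.Exports.
Local Open Scope classical_set_scope.
Local Open Scope ring_scope.

Section HyperbolicFilling.
Context {R : realType} {dsp : measure_display} {Z : measurableType dsp}.
Variable dist : Z -> Z -> R.

Definition is_metric : Prop :=
  [/\ forall x y, 0 <= dist x y,
      forall x y, dist x y = 0 <-> x = y,
      forall x y, dist x y = dist y x &
      forall x y z, dist x z <= dist x y + dist y z].

Definition dball (c : Z) (r : R) : set Z := [set z | dist c z < r].

Definition dopen (A : set Z) : Prop :=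
  forall x, A x -> exists2 r : R, 0 < r & dball x r `<=` A.

Definition borel_measurable_structure : Prop :=
  @measurable dsp Z = <<s dopen >>.

Variable mu : {measure set Z -> \bar R}.

Definition balls_pos_finite : Prop :=
  forall c r, 0 < r -> (0 < mu (dball c r))%E /\ (mu (dball c r) < +oo)%E.

Definition doubling_with (C Q : R) : Prop :=
  forall xi r lam, 0 < r -> 1 <= lam ->
    (mu (dball xi (lam * r)) <= (C * lam `^ Q)%:E * mu (dball xi r))%E.

Definition separated (n : int) (A : set Z) : Prop :=
  forall xi eta, A xi -> A eta -> xi <> eta -> (2 : R) ^ (- n - 1) <= dist xi eta.

Definition maximal_separated (n : int) (A : set Z) : Prop :=
  separated n A /\ forall B, A `<=` B -> separated n B -> B = A.

(** A hyperbolic filling: [S n] is the set of centers xi_x, x in X_n.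
    A vertex x in X_n is identified with the pair (n, xi_x). *)
Variable S : int -> set Z.

Definition vert : set (int * Z) := [set x | S x.1 x.2].

Definition Bx (x : int * Z) : set Z := dball x.2 ((2 : R) ^ (- x.1)).

Definition nbr (x y : int * Z) : Prop :=
  [/\ vert x, vert y, x <> y, Bx x `&` Bx y !=set0 & `|x.1 - y.1| <= 1].

Definition du (u : int * Z -> R[i]) (x : int * Z) : \bar R :=
  ((\esum_(y in nbr x) ((ComplexField.Normc.normc (u y - u x)) ^+ 2)%:E) `^ (2^-1))%E.

Definition levelfun (u : int * Z -> \bar R) (k : int) (z : Z) : \bar R :=
  (\esum_(xi in S k) (`|u (k, xi)| * (\1_(Bx (k, xi)) z)%:E))%E.

Definition Inorm (s : R) (p q : \bar R) (u : int * Z -> \bar R) : \bar R :=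
  let a k := ((2 `^ (k%:~R * s))%:E * Lnorm mu p (levelfun u k))%E in
  match q with
  | q'%:E => ((\esum_(k in [set: int]) (a k `^ q')) `^ q'^-1)%E
  | +oo%E => ereal_sup (range a)
  | -oo%E => 0%E
  end.

Definition L1loc (f : Z -> R[i]) : Prop :=
  [/\ measurable_fun setT (fun z => real_closed.complex.Re (f z)),
      measurable_fun setT (fun z => real_closed.complex.Im (f z)),
      forall c r, mu.-integrable (dball c r) (fun z => (real_closed.complex.Re (f z))%:E) &
      forall c r, mu.-integrable (dball c r) (fun z => (real_closed.complex.Im (f z))%:E)].

Definition avgR (g : Z -> R) (x : int * Z) : R :=
  (fine (mu (Bx x)))^-1 * Rintegral mu (Bx x) g.

Definition Pav (f : Z -> R[i]) (x : int * Z) : R[i] :=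
  (avgR (fun z => real_closed.complex.Re (f z)) x +i* avgR (fun z => real_closed.complex.Im (f z)) x)%C.

Definition Bnorm (s : R) (p q : \bar R) (f : Z -> R[i]) : \bar R :=
  Inorm s p q (du (Pav f)).

Definition inBesov (s : R) (p q : \bar R) (f : Z -> R[i]) : Prop :=
  L1loc f /\ (Bnorm s p q f < +oo)%E.

(** the family psi : psi n xi is psi_x for x = (n, xi) *)
Variable psi : int -> Z -> Z -> R.

Definition psi_family (C2 : R) : Prop :=
  [/\ forall n xi z, 0 <= psi n xi z,
      forall n xi z, S n xi -> ~ Bx (n, xi) z -> psi n xi z = 0,
      forall n z, \sum_(xi \in S n) psi n xi z = 1 &
      forall n xi z w, S n xi ->
        `|psi n xi z - psi n xi w| <= C2 * (2 : R) ^ n * dist z w].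

Definition Tn (n : int) (u : int * Z -> R[i]) (z : Z) : R[i] :=
  \sum_(xi \in S n) u (n, xi) * ((psi n xi z)%:C)%C.

End HyperbolicFilling.

(* Main.v *)
Require Import Defs.
From HB Require Import structures.
From mathcomp Require Import all_boot all_order all_algebra.
From mathcomp Require Import finmap.
From mathcomp Require Import all_classical all_reals all_analysis.
From mathcomp Require Import measurable_realfun ess_sup_inf.
From mathcomp Require Import complex.
From mathcomp Require Import zify ring lra.
Set Implicit Arguments.
Unset Strict Implicit.
Unset Printing Implicit Defensive.
Import Order.TTheory GRing.Theory Num.Theory.
Import numFieldNormedType.Exports HBSimple.
Local Open Scope classical_set_scope.
Local Open Scope ring_scope.

(** Write [W = |d(Pf)|] and [f_n = T_n(Pf)]. Comparing consecutive levels gives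
    [|f_(j+1) - f_j| <= sum_x psi_x W(x)], the sum over the vertices [x] of level [j], and
    [f_j] tends to [f] in L^1 of every ball. Hence at a vertex of level [k <= n + 3] the quantity
    [|d(P(f_n - f))|] is controlled by averages of [W] over the levels [j >= n], while at a level
    [k >= n + 4] the Lipschitz bound on the [psi_x] gives
    [|d(P f_n)| <= C 2^(n - k) W(y)] for a vertex [y] of level [n] nearby.
    Since [p > Q / (Q + s)], averaging from level [j] down to level [k] costs in l^p a factor
    [2^(e (j - k))] with [e < s], so the level-[k] part of the Besov norm of [f_n - f] is at most
    the supremum over [j >= n] of [2^(- d |j - k|)] times the level-[j] part for [f], for some
    [d > 0]. A Schur test in l^q bounds the norm of [f_n - f] by the tail [j >= n] of the norm
    of [f], which proves (ii); adding [f] back proves (i). *)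

(** For p < 1 or q < 1 there is no triangle inequality to sum over infinitely many levels, and this
    dictates two choices. Every L^p norm of a level function is traded, by bounded overlap, for an
    l^p norm over the net weighted by volumes. The contributions of the levels j >= n are gathered
    in a supremum, encoded as an arbitrary upper bound M: this costs one geometric factor, and an
    l^r sum dominates the supremum for every r > 0, so that small and large exponents are treated
    alike.

    For p <= 1 the exponent is e = Q (1/p - 1): a ball of level k has at most C 2^(Q (j - k)) times
    the volume of a nearby ball of level j, up to a constant, and this ratio enters to the power 1/p
    - 1. The inequality e < s is exactly p > Q / (Q + s). For p > 1 Jensen's inequality gives e = 0.

    The convergence of f_j to f in L^1 of balls rests on density of the bounded uniformly continuous
    functions and on L^1 bounds uniform in j, not on pointwise differentiation. The split at k = n +
    4 leaves a factor 16 between the radii, enough for the balls of a vertex of level k and of its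
    neighbors to lie in a single ball of level n. *)

(** * Inequalities for finite sums *)

Lemma ler_fsum (R : realDomainType) (T : choiceType) (A : set T) (F G : T -> R) :
  finite_set A -> (forall x, A x -> F x <= G x) ->
  \sum_(x \in A) F x <= \sum_(x \in A) G x.
Proof.
move=> fA le; rewrite !fsbig_finite// big_seq [leRHS]big_seq.
by apply: ler_sum => x; rewrite in_fset_set// inE; exact: le.
Qed.

Lemma ler_fsum_subset (R : realDomainType) (T : choiceType) (A B : set T) (F : T -> R) :
  finite_set B -> A `<=` B -> (forall x, B x -> 0 <= F x) ->
  \sum_(x \in A) F x <= \sum_(x \in B) F x.
Proof.
move=> fB AB F0; rewrite [leRHS](fsbigID A)// (setIidr AB).
by rewrite lerDl; apply: fsumr_ge0 => x [/F0].
Qed.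

Lemma ler_norm_fsum (R : realDomainType) (T : choiceType) (A : set T) (F : T -> R) :
  finite_set A -> `|\sum_(x \in A) F x| <= \sum_(x \in A) `|F x|.
Proof. by move=> fA; rewrite !fsbig_finite//; exact: ler_norm_sum. Qed.

Lemma ler_fsum1 (R : realDomainType) (T : choiceType) (A : set T) (F : T -> R) x :
  finite_set A -> A x -> (forall x, A x -> 0 <= F x) -> F x <= \sum_(x \in A) F x.
Proof.
move=> fA Ax F0; rewrite (fsbigD1 x)//= lerDl; apply: fsumr_ge0 => y [Ay _]; exact: F0.
Qed.

(** * Unordered sums in the extended reals *)

Section Esum.
Context {R : realType}.

Lemma esum_le_ub (T : choiceType) (A : set T) (a : T -> \bar R) (b : \bar R) :
  (forall X, finite_set X -> X `<=` A -> (\sum_(x \in X) a x <= b)%E) ->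
  (\esum_(x in A) a x <= b)%E.
Proof. by move=> h; apply: ge_ereal_sup => _ [X [fX XA] <-]; exact: h. Qed.

Lemma le_fsum_esum (T : choiceType) (A X : set T) (a : T -> \bar R) :
  finite_set X -> X `<=` A -> (\sum_(x \in X) a x <= \esum_(x in A) a x)%E.
Proof. by move=> fX XA; apply: esum_ge; exists X. Qed.

Lemma le_esum1 (T : choiceType) (A : set T) (a : T -> \bar R) x : A x ->
  (a x <= \esum_(x in A) a x)%E.
Proof.
move=> Ax; have := @le_fsum_esum _ A [set x] a (finite_set1 x); rewrite fsbig_set1; apply.
by move=> _ ->.
Qed.

Lemma le_esum_subset (T : choiceType) (A B : set T) (a : T -> \bar R) : A `<=` B ->
  (\esum_(x in A) a x <= \esum_(x in B) a x)%E.
Proof.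
move=> AB; apply: esum_le_ub => X fX XA; apply: le_fsum_esum => //.
exact: subset_trans AB.
Qed.

Lemma esumZ_le (T : choiceType) (A : set T) (a : T -> \bar R) (c : R) : 0 <= c ->
  (forall x, 0 <= a x)%E -> (\esum_(x in A) (c%:E * a x) <= c%:E * \esum_(x in A) a x)%E.
Proof.
move=> c0 a0; apply: esum_le_ub => X fX XA; rewrite -ge0_mule_fsumr//.
by apply: lee_wpmul2l => //; exact: le_fsum_esum.
Qed.

Lemma exchange_esum (I J : choiceType) (A : set I) (B : set J) (a : I -> J -> \bar R) :
  (forall i j, 0 <= a i j)%E ->
  \esum_(i in A) \esum_(j in B) a i j = \esum_(j in B) \esum_(i in A) a i j.
Proof.
move=> a0; rewrite !esum_esum//.
rewrite (reindex_esum (A `*`` (fun=> B)) (B `*`` (fun=> A)) (fun p => (p.2, p.1)))//.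
split=> [[i j] [/= Ai Bj]|[i j] [i' j'] _ _ [-> ->]|[j i] [/= Bj Ai]]//.
by exists (i, j).
Qed.

(** After the two sums are exchanged, each [F j] is counted with total weight at most [N]. This
    serves both for averaging between nets ([lvl_average]) and for the Schur test over levels
    ([schur_lq]). *)
Lemma lee_double_esum (I J : choiceType) (A : set I) (B : set J) (g : I -> \bar R)
    (F : J -> R) (w : I -> J -> R) (N : R) : 0 <= N ->
  (forall i j, 0 <= w i j) -> (forall j, 0 <= F j) ->
  (forall i, A i -> (g i <= \esum_(j in B) (w i j * F j)%:E)%E) ->
  (forall j, B j -> (\esum_(i in A) (w i j)%:E <= N%:E)%E) ->
  (\esum_(i in A) g i <= N%:E * \esum_(j in B) (F j)%:E)%E.
Proof.
move=> N0 w0 F0 gF wN.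
apply: le_trans (le_esum gF) _; rewrite exchange_esum; last first.
  by move=> i j; rewrite lee_fin mulr_ge0.
apply: le_trans _ (esumZ_le _ N0 _); last by move=> j; rewrite lee_fin.
apply: le_esum => j Bj; under eq_esum do rewrite mulrC EFinM.
apply: le_trans (esumZ_le _ (F0 j) _) _; first by move=> i; rewrite lee_fin.
by rewrite muleC; apply: lee_wpmul2r; [rewrite lee_fin|exact: wN].
Qed.

End Esum.

(** * Powers of sums, for exponents below and above 1 *)

Section Powers.
Context {R : realType}.

(** The shares a / (a + b) and b / (a + b) lie in [0, 1], so each is at most its r-th power;
    multiply by (a + b)^r and add. *)
Lemma powRD_le (a b r : R) : 0 <= a -> 0 <= b -> 0 < r -> r <= 1 ->
  (a + b) `^ r <= a `^ r + b `^ r.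
Proof.
move=> a0 b0 r0 r1; have [ab|ab] := eqVneq (a + b) 0.
  by rewrite ab powR0 ?gt_eqF// addr_ge0// powR_ge0.
have ab0 : 0 < a + b by rewrite lt0r ab addr_ge0.
have key c : 0 <= c -> c <= a + b -> c / (a + b) * (a + b) `^ r <= c `^ r.
  move=> c0 cab; have [->|cn0] := eqVneq c 0; first by rewrite !mul0r powR_ge0.
  have c0' : 0 < c by rewrite lt0r cn0.
  rewrite -[in leRHS](divfK ab c) powRM ?divr_ge0 ?(ltW ab0)//.
  apply: ler_wpM2r; first exact: powR_ge0.
  rewrite -[leLHS]powRr1 ?divr_ge0// ?(ltW ab0)//; apply: ger_powR => //.
  by rewrite divr_gt0//= ler_pdivrMr// mul1r.
apply: le_trans (lerD (key _ a0 _) (key _ b0 _)); rewrite ?lerDl ?lerDr//.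
by rewrite -!mulrDl divff// mul1r.
Qed.

Lemma powR_fsum_le (T : choiceType) (A : set T) (a : T -> R) r : finite_set A ->
  (forall x, A x -> 0 <= a x) -> 0 < r -> r <= 1 ->
  (\sum_(x \in A) a x) `^ r <= \sum_(x \in A) a x `^ r.
Proof.
move=> fA a0 r0 r1; rewrite !fsbig_finite//.
have : forall x, x \in (fset_set A : seq T) -> 0 <= a x.
  by move=> x; rewrite in_fset_set// inE; exact: a0.
elim: (fset_set A : seq T) => [_|x s IH h]; first by rewrite !big_nil powR0// gt_eqF.
rewrite !big_cons; apply: le_trans (powRD_le _ _ r0 r1) _.
- exact/h/mem_head.
- by rewrite big_seq sumr_ge0// => y ys; apply: h; rewrite inE ys orbT.
- by rewrite lerD2l; apply: IH => y ys; apply: h; rewrite inE ys orbT.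
Qed.

(* Jensen's inequality up to a constant: sum [a x <= l + a x `^ r / l `^ (r - 1)] against the
   weights [w] and optimise in [l]. *)
Lemma powR_fsum_ge1_le (T : choiceType) (A : set T) (w a : T -> R) r c : finite_set A ->
  (forall x, A x -> 0 <= w x) -> (forall x, A x -> 0 <= a x) -> 1 <= r ->
  \sum_(x \in A) w x <= c ->
  (\sum_(x \in A) w x * a x) `^ r <= (c + 1) `^ r * \sum_(x \in A) w x * a x `^ r.
Proof.
move=> fA w0 a0 r1 wc; set B := \sum_(x \in A) w x * a x `^ r.
have r0 : 0 < r by exact: lt_le_trans r1.
have c0 : 0 <= c by apply: le_trans wc; exact: fsumr_ge0.
have t0 x : A x -> 0 <= w x * a x `^ r by move=> Ax; rewrite mulr_ge0 ?w0// powR_ge0.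
have B0 : 0 <= B by exact: fsumr_ge0.
have [BZ|Bn0] := eqVneq B 0.
  rewrite (_ : \sum_(x \in A) _ = 0) ?powR0 ?gt_eqF ?mulr_ge0 ?powR_ge0//.
  apply: fsbig1 => x Ax; have /eqP := pfsumr_eq0 fA t0 BZ Ax.
  rewrite mulf_eq0 powR_eq0 => /orP[/eqP ->|/andP[/eqP -> _]]; by rewrite ?mul0r ?mulr0.
have Bp : 0 < B by rewrite lt0r Bn0.
(* With l^r = B the two terms balance: the constant term sums to at most c l, the other one to B /
   l^(r - 1) = l. Hence the factor c + 1. *)
pose l := B `^ r^-1; have l0 : 0 < l by exact: powR_gt0.
have lr : l `^ r = B by rewrite /l -powRrM mulVf ?gt_eqF// powRr1.
have key t : 0 <= t -> t <= l + t `^ r * (l / B).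
  move=> t0'; have [tl|lt] := leP t l.
    by rewrite ler_wpDr// mulr_ge0 ?powR_ge0// divr_ge0// ltW.
  have tp : 0 < t by exact: lt_trans lt.
  rewrite ler_wpDl// ?(ltW l0)//.
  have E s : 0 < s -> s `^ r = s * s `^ (r - 1).
    by move=> s0; rewrite mulr_powRB1// ltW.
  have -> : l / B = (l `^ (r - 1))^-1.
    by rewrite -lr E// invfM mulrA divff ?gt_eqF// mul1r.
  rewrite E// -mulrA ler_peMr ?(ltW tp)// ler_pdivlMr ?powR_gt0// mul1r.
  by apply: ge0_ler_powR; rewrite ?nnegrE ?subr_ge0// ltW.
have le1 : \sum_(x \in A) w x * a x <= (c + 1) * l.
  apply: (@le_trans _ _ (\sum_(x \in A) (w x * l + w x * a x `^ r * (l / B)))).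
    apply: ler_fsum => // x Ax; rewrite -mulrA -mulrDr.
    by apply: ler_wpM2l; [exact: w0|exact/key/a0].
  rewrite fsbig_split// -mulr_fsuml -mulr_fsuml -/B mulrCA divff// mulr1 mulrDl mul1r lerD2r.
  by apply: ler_wpM2r => //; exact: ltW.
rewrite -[in leRHS]lr -powRM ?(ltW l0)//; last by rewrite addr_ge0.
apply: ge0_ler_powR; rewrite ?nnegrE ?(ltW r0)//.
- by apply: fsumr_ge0 => x Ax; rewrite mulr_ge0 ?w0 ?a0.
- by rewrite mulr_ge0 ?addr_ge0// ltW.
Qed.

End Powers.

(** * Dyadic radii *)

Section Radius.
Context {R : realType}.

(** By definition [Bx (k, x)] unfolds to the ball of radius [rad k] about [x], so facts on balls
    apply to vertices by conversion. *)
Definition rad (k : int) : R := 2 ^ (- k).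

Lemma rad_gt0 k : 0 < rad k.
Proof. by rewrite /rad exprz_gt0. Qed.

Lemma rad_ge0 k : 0 <= rad k.
Proof. exact/ltW/rad_gt0. Qed.

Lemma radD j k : rad (j + k) = rad j * rad k.
Proof. by rewrite /rad opprD expfzDr. Qed.

Lemma radN k : rad (- k) = (rad k)^-1.
Proof. by rewrite /rad opprK invr_expz opprK. Qed.

Lemma radS k : rad (k + 1) = rad k / 2.
Proof. by rewrite radD /rad. Qed.

Lemma le_rad j k : j <= k -> rad k <= rad j.
Proof. by move=> jk; rewrite /rad ler_eXz2l ?lerN2// ltr1n. Qed.

Lemma radB j k : rad (j - k) = rad j / rad k.
Proof. by rewrite radD radN. Qed.

Lemma radBn k (n : nat) : rad (k - n%:Z) = 2 ^+ n * rad k.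
Proof. by rewrite radB /rad -exprnN invrK mulrC. Qed.

End Radius.

(** * Term by term integration of unordered sums *)

Section IntegralEsum.
Context {R : realType} {d : measure_display} {T : measurableType d}.
Variable mu : {measure set T -> \bar R}.

Lemma fiber_set01 (I : choiceType) (A : set I) (f : I -> nat) n : {in A &, injective f} ->
  A `&` [set i | f i = n] = set0 \/ exists i, A `&` [set i | f i = n] = [set i].
Proof.
move=> finj; have [->|/set0P[i [Ai fi]]] := eqVneq (A `&` [set i | f i = n]) set0; [by left|right].
exists i; apply/seteqP; split => [k [Ak fk]|_ ->]//=.
by apply: finj; rewrite ?inE// fi fk.
Qed.

(** Turns an unordered sum into a series over the naturals, the form to which monotone convergence
    applies. For [f] injective on [A] each inner sum has at most one term, by [fiber_set01]. *)
Lemma esum_fibers (I : choiceType) (A : set I) (f : I -> nat) (a : I -> \bar R) :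
  (forall i, 0 <= a i)%E ->
  \esum_(i in A) a i =
  \big[+%E/0%E]_(0 <= n <oo) \esum_(i in A `&` [set i | f i = n]) a i.
Proof.
move=> a0; rewrite nneseries_esumT; last by move=> n; apply: esum_ge0.
rewrite -esum_bigcupT//.
  congr esum; apply/seteqP; split => [i Ai|i [n _ []]]//.
  by exists (f i).
apply/trivIsetP => m n _ _ mn; apply/seteqP; split => // i [[_ /= fm] [_ /= fn]].
by move: mn; rewrite -fm -fn eqxx.
Qed.

Variable (I : choiceType) (A : set I) (a : I -> T -> \bar R).
Hypothesis cA : countable A.
Hypothesis ma : forall i, measurable_fun setT (a i).
Hypothesis a0 : forall i x, (0 <= a i x)%E.

Let mfiber (f : I -> nat) n : {in A &, injective f} ->
  measurable_fun setT (fun x => \esum_(i in A `&` [set i | f i = n]) a i x).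
Proof.
move=> finj; have [->|[i ->]] := fiber_set01 n finj.
  by under eq_fun do rewrite esum_set0; exact: measurable_cst.
by under eq_fun do rewrite esum_set1//; exact: ma.
Qed.

Lemma emeasurable_esum : measurable_fun setT (fun x => \esum_(i in A) a i x).
Proof.
have [f finj] := countable_injP _ cA.
under eq_fun do rewrite (esum_fibers A f)//.
apply: (ge0_emeasurable_sum (P := xpredT)) => [n x _ _|n _]; first exact: esum_ge0.
exact: mfiber.
Qed.

Lemma integral_esum :
  (\int[mu]_x (\esum_(i in A) a i x) = \esum_(i in A) (\int[mu]_x a i x))%E.
Proof.
have [f finj] := countable_injP _ cA.
under eq_integral do rewrite (esum_fibers A f)//.
rewrite integral_nneseries//; last 2 first.
- by move=> n; exact: mfiber.
- by move=> n x _; apply: esum_ge0.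
rewrite [RHS](esum_fibers A f); last by move=> i; exact: integral_ge0.
apply: eq_eseriesr => n _; have [->|[i ->]] := fiber_set01 n finj.
  by under eq_integral do rewrite esum_set0; rewrite integral0 esum_set0.
rewrite esum_set1; last exact: integral_ge0.
by apply: eq_integral => x _; rewrite esum_set1.
Qed.

End IntegralEsum.

(** * Bounded uniformly continuous functions and their closure in L^1 *)

Section UniformlyContinuous.
Context {R : realType} {dsp : measure_display} {Z : measurableType dsp}.
Variable dist : Z -> Z -> R.
Variable mu : {measure set Z -> \bar R}.

(** The dense class for the convergence argument: on such functions, averages over balls with radius
    tending to 0 converge uniformly. *)
Definition bounded_unif_cont (f : Z -> R) : Prop :=
  [/\ measurable_fun setT f, exists M : R, forall z, `|f z| <= M &
      forall e : R, 0 < e -> exists2 d : R, 0 < d & forall z w, dist z w < d -> `|f z - f w| <= e].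

Lemma bounded_unif_cont_cst c : bounded_unif_cont (cst c).
Proof.
split=> //; first by exists `|c|.
by move=> e e0; exists 1 => // z w _; rewrite /cst subrr normr0 ltW.
Qed.

Lemma bounded_unif_contD f g : bounded_unif_cont f -> bounded_unif_cont g ->
  bounded_unif_cont (fun z => f z + g z).
Proof.
move=> [mf [M fM] cf] [mg [N gN] cg]; split.
- exact: measurable_funD.
- by exists (M + N) => z; rewrite (le_trans (ler_normD _ _))// lerD.
- move=> e e0; have e2 : 0 < e / 2 by rewrite divr_gt0.
  have [d d0 fd] := cf _ e2; have [d' d0' gd] := cg _ e2.
  exists (Num.min d d'); first by rewrite lt_min d0.
  move=> z w; rewrite lt_min => /andP[/fd h1 /gd h2].
  rewrite (_ : _ - _ = (f z - f w) + (g z - g w)); last ring.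
  by rewrite (le_trans (ler_normD _ _))// [leRHS]splitr lerD.
Qed.

Lemma bounded_unif_contZ a f : bounded_unif_cont f -> bounded_unif_cont (fun z => a * f z).
Proof.
move=> [mf [M fM] cf]; split.
- exact: measurable_funM.
- by exists (`|a| * M) => z; rewrite normrM ler_wpM2l.
- move=> e e0; have a1 : 0 < `|a| + 1 by rewrite ltr_wpDl.
  have [d d0 fd] := cf _ (divr_gt0 e0 a1).
  exists d => // z w /fd h; rewrite -mulrBr normrM.
  have := ler_wpM2l (normr_ge0 a) h; move/le_trans; apply.
  rewrite mulrCA ler_piMr ?(ltW e0)// ler_pdivrMr// mul1r.
  by rewrite lerDl.
Qed.

Lemma ler_dist_max (a b c d : R) : `|Num.max a b - Num.max c d| <= `|a - c| + `|b - d|.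
Proof.
have [? ? ? ?] : [/\ a - c <= `|a - c|, c - a <= `|a - c|, b - d <= `|b - d| & d - b <= `|b - d|].
  by split; rewrite ?ler_norm// distrC ler_norm.
by rewrite ler_norml; case: (ltP a b); case: (ltP c d) => *; apply/andP; split; lra.
Qed.

Lemma bounded_unif_cont_max f g : bounded_unif_cont f -> bounded_unif_cont g ->
  bounded_unif_cont (fun z => Num.max (f z) (g z)).
Proof.
move=> [mf [M fM] cf] [mg [N gN] cg]; split.
- exact: measurable_maxr.
- exists (M + N) => z; have := fM z; have := gN z.
  have := normr_ge0 (f z); have := normr_ge0 (g z).
  by case: (ltP (f z) (g z)) => *; lra.
- move=> e e0; have e2 : 0 < e / 2 by rewrite divr_gt0.
  have [d d0 fd] := cf _ e2; have [d' d0' gd] := cg _ e2.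
  exists (Num.min d d'); first by rewrite lt_min d0.
  move=> z w; rewrite lt_min => /andP[/fd h1 /gd h2].
  by rewrite (le_trans (ler_dist_max _ _ _ _))// [leRHS]splitr lerD.
Qed.

Definition L1dist (D : set Z) (f g : Z -> R) : \bar R :=
  (\int[mu]_(z in D) (`|f z - g z|)%:E)%E.

Section Approx.
Variable D : set Z.
Hypothesis mD : measurable D.

Lemma measurable_dist_fun (f g : Z -> R) : measurable_fun D f -> measurable_fun D g ->
  measurable_fun D (fun z => (`|f z - g z|)%:E).
Proof.
move=> mf mg; apply/measurable_EFinP; apply: measurableT_comp => //.
exact: measurable_funB.
Qed.

Lemma le_L1dist2 (f g f1 g1 f2 g2 : Z -> R) :
  measurable_fun D f -> measurable_fun D g ->
  measurable_fun D f1 -> measurable_fun D g1 ->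
  measurable_fun D f2 -> measurable_fun D g2 ->
  (forall z, D z -> `|f z - g z| <= `|f1 z - g1 z| + `|f2 z - g2 z|) ->
  (L1dist D f g <= L1dist D f1 g1 + L1dist D f2 g2)%E.
Proof.
move=> mf mg mf1 mg1 mf2 mg2 le; rewrite /L1dist -ge0_integralD//; last 2 first.
- exact: measurable_dist_fun.
- exact: measurable_dist_fun.
apply: ge0_le_integral => //.
- exact: measurable_dist_fun.
- by apply: emeasurable_funD; exact: measurable_dist_fun.
Qed.

Lemma L1dist_triangle (f g h : Z -> R) a b :
  measurable_fun D f -> measurable_fun D g -> measurable_fun D h ->
  (L1dist D f g <= a -> L1dist D g h <= b -> L1dist D f h <= a + b)%E.
Proof.
move=> mf mg mh fa gb; apply: (@le_trans _ _ (L1dist D f g + L1dist D g h)%E); last exact: leeD.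
by apply: le_L1dist2 => // z _; exact: ler_distD.
Qed.

Definition approximable (f : Z -> R) : Prop :=
  measurable_fun D f /\ forall e : R, 0 < e ->
    exists2 g, bounded_unif_cont g & (L1dist D f g <= e%:E)%E.

Lemma measurable_bounded_unif_cont f : bounded_unif_cont f -> measurable_fun D f.
Proof. by case=> mf _ _; exact: measurable_funTS. Qed.

Lemma approximable_cst c : approximable (cst c).
Proof.
split=> // e e0; exists (cst c); first exact: bounded_unif_cont_cst.
rewrite /L1dist integral0_eq ?lee_fin ?ltW// => z _.
by rewrite subrr normr0.
Qed.

(** An operation that is 1-Lipschitz for the l^1 distance of the plane passes to L^1 limits; the
    cases in use are the sum and the maximum. *)
Lemma approximable2 f g (op : R -> R -> R) : approximable f -> approximable g ->
  measurable_fun D (fun z => op (f z) (g z)) ->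
  (forall f g, bounded_unif_cont f -> bounded_unif_cont g ->
    bounded_unif_cont (fun z => op (f z) (g z))) ->
  (forall a b c d, `|op a b - op c d| <= `|a - c| + `|b - d|) ->
  approximable (fun z => op (f z) (g z)).
Proof.
move=> [mf af] [mg ag] mop cop lop; split => // e e0.
have e2 : 0 < e / 2 by rewrite divr_gt0.
have [f' cf' ff'] := af _ e2; have [g' cg' gg'] := ag _ e2.
exists (fun z => op (f' z) (g' z)); first exact: cop.
apply: (@le_trans _ _ (L1dist D f f' + L1dist D g g')%E).
  by apply: le_L1dist2 => //; do ?[exact: measurable_bounded_unif_cont];
    apply: measurable_bounded_unif_cont; exact: cop.
by rewrite [e]splitr EFinD leeD.
Qed.

Lemma approximableD f g : approximable f -> approximable g ->
  approximable (fun z => f z + g z).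
Proof.
move=> af ag; apply: (@approximable2 _ _ (fun a b => a + b)) => //.
- by case: af ag => ? _ [? _]; exact: measurable_funD.
- exact: bounded_unif_contD.
- by move=> a b c d; rewrite opprD addrACA ler_normD.
Qed.

Lemma approximable_max f g : approximable f -> approximable g ->
  approximable (fun z => Num.max (f z) (g z)).
Proof.
move=> af ag; apply: (@approximable2 _ _ (fun a b => Num.max a b)) => //.
- by case: af ag => ? _ [? _]; exact: measurable_maxr.
- exact: bounded_unif_cont_max.
- exact: ler_dist_max.
Qed.

Lemma approximableZ a f : approximable f -> approximable (fun z => a * f z).
Proof.
move=> [mf af]; split; first exact: measurable_funM.
move=> e e0; have a1 : 0 < `|a| + 1 by rewrite ltr_wpDl.
have [g cg fg] := af _ (divr_gt0 e0 a1).
exists (fun z => a * g z); first exact: bounded_unif_contZ.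
rewrite /L1dist; under eq_integral do rewrite -mulrBr normrM EFinM.
rewrite ge0_integralZl//; last first.
  by apply: measurable_dist_fun => //; exact: measurable_bounded_unif_cont.
apply: (@le_trans _ _ (`|a|%:E * (e / (`|a| + 1))%:E)%E).
  by rewrite lee_wpmul2l.
rewrite -EFinM lee_fin mulrCA ler_piMr ?(ltW e0)// ler_pdivrMr// mul1r.
by rewrite lerDl.
Qed.

Lemma approximable_limit f : measurable_fun D f ->
  (forall e : R, 0 < e -> exists2 g, approximable g & (L1dist D f g <= e%:E)%E) ->
  approximable f.
Proof.
move=> mf af; split => // e e0; have e2 : 0 < e / 2 by rewrite divr_gt0.
have [g [mg ag] fg] := af _ e2; have [h ch gh] := ag _ e2.
exists h => //; rewrite [e]splitr EFinD; apply: L1dist_triangle fg gh => //.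
exact: measurable_bounded_unif_cont.
Qed.

Lemma approximable_sum (I : choiceType) (A : set I) (f : I -> Z -> R) : finite_set A ->
  (forall i, A i -> approximable (f i)) -> approximable (fun z => \sum_(i \in A) f i z).
Proof.
move=> fA af; under eq_fun do rewrite fsbig_finite//.
have : forall i, i \in (fset_set A : seq I) -> approximable (f i).
  by move=> i; rewrite in_fset_set// inE; exact: af.
elim: (fset_set A : seq I) => [_|i s IH h].
  by under eq_fun do rewrite big_nil; exact: approximable_cst.
under eq_fun do rewrite big_cons; apply: approximableD; first exact/h/mem_head.
by apply: IH => k ks; apply: h; rewrite inE ks orbT.
Qed.

End Approx.

End UniformlyContinuous.

(** * Volumes of balls and doubling *)

Section Geometry.
Context {R : realType} {dsp : measure_display} {Z : measurableType dsp}.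
Variable dist : Z -> Z -> R.
Variable mu : {measure set Z -> \bar R}.
Variables C Q : R.
Hypothesis metric_dist : is_metric dist.
Hypothesis borelZ : borel_measurable_structure dist.
Hypothesis balls : balls_pos_finite dist mu.
Hypothesis C_ge1 : 1 <= C.
Hypothesis Q_gt0 : 0 < Q.
Hypothesis doubling : doubling_with dist mu C Q.

Local Notation ball := (dball dist).

Lemma dist_ge0 x y : 0 <= dist x y.
Proof. by case: metric_dist. Qed.

Lemma distxx x : dist x x = 0.
Proof. by case: metric_dist => _ /(_ x x)[_ ->]. Qed.

Lemma distC x y : dist x y = dist y x.
Proof. by case: metric_dist. Qed.

Lemma dist_tri x y z : dist x z <= dist x y + dist y z.
Proof. by case: metric_dist. Qed.

Lemma measurable_dball c r : measurable (ball c r).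
Proof.
rewrite borelZ; apply: sub_sigma_algebra => x cx.
exists (r - dist c x); first by rewrite subr_gt0.
by move=> y /= xy; apply: le_lt_trans (dist_tri c x y) _; rewrite addrC -ltrBrDr.
Qed.

Lemma subset_dball c r c' r' : dist c c' + r <= r' -> ball c r `<=` ball c' r'.
Proof.
move=> h z /= cz; have := dist_tri c' c z; rewrite (distC c' c); move: h cz; rewrite /dball/=.
by move=> *; lra.
Qed.

Definition vol c r : R := fine (mu (ball c r)).

Lemma volE c r : 0 < r -> mu (ball c r) = (vol c r)%:E.
Proof.
by move=> r0; rewrite /vol fineK// ge0_fin_numE//; case: (balls c r0).
Qed.

Lemma vol_gt0 c r : 0 < r -> 0 < vol c r.
Proof. by move=> r0; case: (balls c r0) => + _; rewrite volE// lte_fin. Qed.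

Lemma vol_ge0 c r : 0 <= vol c r.
Proof. by rewrite /vol fine_ge0. Qed.

Lemma le_vol c r c' r' : 0 < r -> dist c c' + r <= r' -> vol c r <= vol c' r'.
Proof.
move=> r0 h; rewrite -lee_fin -!volE//; last by have := dist_ge0 c c'; lra.
by apply: le_measure; rewrite ?inE; [exact: measurable_dball..|exact: subset_dball].
Qed.

Lemma vol_doubling c r lam : 0 < r -> 1 <= lam ->
  vol c (lam * r) <= C * lam `^ Q * vol c r.
Proof.
move=> r0 l1; have := doubling c r0 l1.
by rewrite !volE ?mulr_gt0//; lra.
Qed.

Lemma vol_compare c r c' r' lam : 0 < r -> 0 < r' -> 1 <= lam ->
  dist c c' + r <= lam * r' -> vol c r <= C * lam `^ Q * vol c' r'.
Proof.
by move=> r0 r0' l1 h; apply: le_trans (vol_doubling c' r0' l1); exact: le_vol.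
Qed.

(** The constant lost when a ball contained in the [lam]-fold dilate of another ball is compared
    with it in volume. *)
Definition dbl (lam : R) := C * lam `^ Q.

Lemma dbl_ge1 lam : 1 <= lam -> 1 <= dbl lam.
Proof.
move=> l1; rewrite /dbl -[1]mulr1 ler_pM//.
by rewrite -(powRr0 lam) ler_powR// ltW.
Qed.

Lemma dbl_gt0 lam : 1 <= lam -> 0 < dbl lam.
Proof. by move=> /dbl_ge1; apply: lt_le_trans. Qed.

(** * Counting points of separated nets *)

Section Net.
Variables (j : int) (A : set Z).
Hypothesis sepA : Defs.separated dist j A.

(** The separation 2^(-j-1) is half of [rad j], so balls of a quarter of [rad j] about distinct
    points cannot meet. *)
Lemma net_disjoint : trivIset A (fun x => ball x (rad j / 4)).
Proof.
move=> x y Ax Ay [z [/= xz yz]]; apply: contrapT => xy.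
have := sepA Ax Ay xy; have -> : (2 : R) ^ (- j - 1) = rad j / 2.
  by rewrite -radS /rad opprD.
have := dist_tri x z y; rewrite (distC z y); move: xz yz (@rad_gt0 R j); rewrite /dball/=.
by clear xy; move=> *; lra.
Qed.

(** Doubling reduces each ball to its quarter at the cost of [dbl 4]; the quarters are disjoint and
    contained in the ball of radius [r + rad j]. *)
Lemma sum_vol_net (B : set Z) c r : finite_set B -> B `<=` A `&` ball c r -> 0 < r ->
  \sum_(y \in B) vol y (rad j) <= dbl 4 * vol c (r + rad j).
Proof.
move=> fB BA r0; have rj := @rad_gt0 R j.
have d4 : 0 < rad j / 4 :> R by rewrite divr_gt0.
apply: (@le_trans _ _ (\sum_(y \in B) dbl 4 * vol y (rad j / 4))).
  apply: ler_fsum => // y _; apply: vol_compare => //; first lra.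
  by rewrite distxx; lra.
rewrite -mulr_fsumr ler_pM2l; last by apply: dbl_gt0; lra.
rewrite -lee_fin -volE ?addr_gt0// -fsumEFin//.
under eq_fsbigr do rewrite -volE//.
rewrite -measure_fin_bigcup//; last 2 first.
- by move=> x y Bx By; apply: net_disjoint; [case: (BA _ Bx)|case: (BA _ By)].
- by move=> i _; exact: measurable_dball.
apply: le_measure; rewrite ?inE.
- by apply: fin_bigcup_measurable => // i _; exact: measurable_dball.
- exact: measurable_dball.
- move=> z [y By /=]; apply: subset_dball; case: (BA _ By) => _; rewrite /dball/= distC.
  by move=> h; lra.
Qed.

(** Each ball counted has at least the fraction 1 / [dbl lam] of the measure of the ball of radius
    [r + rad j] about [c], while [sum_vol_net] bounds their total measure. *)
Lemma card_net (B : set Z) c r lam : finite_set B -> B `<=` A `&` ball c r -> 0 < r ->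
  1 <= lam -> 2 * r + rad j <= lam * rad j ->
  \sum_(y \in B) (1 : R) <= dbl 4 * dbl lam.
Proof.
move=> fB BA r0 l1 h; have rj := @rad_gt0 R j.
have V := @vol_gt0 c (r + rad j) (addr_gt0 r0 rj).
rewrite -(ler_pM2r V) mulr_fsuml mulrAC.
apply: (@le_trans _ _ (\sum_(y \in B) (dbl lam * vol y (rad j)))); last first.
  rewrite -mulr_fsumr mulrC ler_pM2r; last exact: dbl_gt0.
  exact: sum_vol_net.
apply: ler_fsum => // y /BA [_ /= cy]; rewrite mul1r; apply: vol_compare => //.
  exact: addr_gt0.
by move: cy; rewrite /dball/= => cy; lra.
Qed.

(** An infinite set would have finite subsets of every cardinality, against the uniform bound of
    [card_net]. *)
Lemma finite_net_ball c r : finite_set (A `&` ball c r).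
Proof.
have [r0|r0] := leP r 0.
  rewrite (_ : _ `&` _ = set0)//; apply/seteqP; split => // x [_]; rewrite /dball/=.
  by have := dist_ge0 c x; move=> *; lra.
apply: contrapT => inf; have rj := @rad_gt0 R j.
pose lam := (2 * r + rad j) / rad j.
have l1 : 1 <= lam by rewrite /lam ler_pdivlMr// mul1r; lra.
have [n Hn] : exists n : nat, dbl 4 * dbl lam < n%:R.
  exists (Num.bound (dbl 4 * dbl lam)); apply/archi_boundP/ltW/mulr_gt0; apply: dbl_gt0 => //.
  lra.
have [B BA sB] := infinite_set_fset n inf.
have : \sum_(y \in [set` B]) (1 : R) <= dbl 4 * dbl lam.
  by apply: card_net BA r0 l1 _ => //; rewrite /lam divfK// gt_eqF.
apply/negP; rewrite -ltNge; apply: lt_le_trans Hn _.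
rewrite -fsbig_seq ?fset_uniq// big_const_seq count_predT iter_addr_0.
by rewrite ler_nat.
Qed.

Lemma countable_net : countable A.
Proof.
have [->|/set0P[c _]] := eqVneq A set0; first exact: countable0.
rewrite (_ : A = \bigcup_(n : nat) (A `&` ball c n%:R)).
  by apply: bigcup_countable => // n _; apply/finite_set_countable/finite_net_ball.
apply/seteqP; split => [x Ax|x [n _ []]//].
exists (Num.bound (dist c x)) => //; split => //=; rewrite /dball/=.
exact/archi_boundP/dist_ge0.
Qed.

End Net.

(** * Maximal nets, Lipschitz functions and cutoffs *)

(** A point at distance at least half of [rad j] from all of [A] could be added to [A]. That the
    covering radius is only half of [rad j] gives the room needed in [avg_fine]. *)
Lemma maximal_net_cover j (A : set Z) z : maximal_separated dist j A ->
  exists2 x, A x & dist z x < rad j / 2.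
Proof.
move=> [sepA maxA]; apply: contrapT => nx.
have far x : A x -> rad j / 2 <= dist z x.
  by move=> Ax; rewrite leNgt; apply/negP => h; apply: nx; exists x.
suff zA : A z by have := far z zA; rewrite distxx; have := @rad_gt0 R j; lra.
rewrite -(maxA (z |` A)); [by left|by move=> x; right|].
have E : (2 : R) ^ (- j - 1) = rad j / 2 by rewrite -radS /rad opprD.
move=> x y [->|Ax] [->|Ay] xy; rewrite ?E //.
- exact: far.
- by rewrite distC; exact: far.
- by rewrite -E; exact: sepA.
Qed.

Lemma rad_lt_exists (e : R) : 0 < e -> exists n : nat, forall m : nat, (n <= m)%N -> rad m%:Z < e.
Proof.
move=> e0; exists (Num.bound e^-1) => m nm.
have ei : 0 <= e^-1 by rewrite invr_ge0 ltW.
rewrite /rad -exprnN -[e]invrK ltf_pV2 ?posrE ?exprn_gt0 ?invr_gt0//.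
apply: lt_le_trans (archi_boundP ei) _; apply: (@le_trans _ _ m%:R); first by rewrite ler_nat.
by rewrite -natrX ler_nat ltnW// ltn_expl.
Qed.

Lemma measurable_lipschitz (f : Z -> R) L :
  (forall z w, `|f z - f w| <= L * dist z w) -> measurable_fun setT f.
Proof.
move=> lf; apply: (measurability _ (RGenOInfty.measurableE R)).
move=> _ [_ [a ->] <-]; rewrite setTI borelZ; apply: sub_sigma_algebra => z /=.
(* [|L| + 1] is a positive Lipschitz constant whatever the sign of [L]. *)
rewrite in_itv/= andbT => az; have L1 : 0 < `|L| + 1 by rewrite ltr_wpDl.
exists ((f z - a) / (`|L| + 1)); first by rewrite divr_gt0// subr_gt0.
move=> w; rewrite /dball/= in_itv/= andbT ltr_pdivlMr// => h.
have := lf z w; rewrite ler_norml => /andP[_ h2].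
have h3 : L * dist z w <= dist z w * (`|L| + 1).
  by rewrite mulrC ler_wpM2l ?dist_ge0// (le_trans (ler_norm L))// lerDl.
lra.
Qed.

Lemma ler_distB c z w : `|dist c z - dist c w| <= dist z w.
Proof.
have := dist_tri c w z; have := dist_tri c z w; rewrite (distC w z) ler_norml.
by move=> *; apply/andP; split; lra.
Qed.

Lemma bounded_unif_cont_lipschitz (f : Z -> R) L M : (forall z, `|f z| <= M) ->
  (forall z w, `|f z - f w| <= L * dist z w) -> bounded_unif_cont dist f.
Proof.
move=> fM lf; split; [exact: measurable_lipschitz lf|by exists M|move=> e e0].
have L1 : 0 < `|L| + 1 by rewrite ltr_wpDl.
exists (e / (`|L| + 1)); first by rewrite divr_gt0.
move=> z w; rewrite ltr_pdivlMr// => h; apply: le_trans (lf z w) _.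
apply: le_trans (ltW h); rewrite mulrC ler_wpM2l ?dist_ge0//.
by rewrite (le_trans (ler_norm L))// lerDl.
Qed.

(** Lipschitz cutoff that tends to the indicator of the ball of radius [r] as [d] tends to 0. *)
Definition ramp c (r d : R) (z : Z) : R := Num.min 1 (Num.max 0 ((r - dist c z) / d)).

Lemma ramp_itv c r d z : 0 <= ramp c r d z <= 1.
Proof. by rewrite /ramp le_min ge_min le_max lexx ler01 lexx. Qed.

Lemma ramp1 c r d z : 0 < d -> dist c z <= r - d -> ramp c r d z = 1.
Proof.
move=> d0 h; apply/min_idPl; rewrite le_max ler_pdivlMr// mul1r.
by apply/orP; right; lra.
Qed.

Lemma ramp0 c r d z : 0 < d -> r <= dist c z -> ramp c r d z = 0.
Proof.
move=> d0 h; rewrite /ramp; have -> : Num.max 0 ((r - dist c z) / d) = 0.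
  by apply/max_idPl; rewrite ler_pdivrMr// mul0r; lra.
exact/min_idPr.
Qed.

Lemma ler_dist_clamp (a b : R) :
  `|Num.min 1 (Num.max 0 a) - Num.min 1 (Num.max 0 b)| <= `|a - b|.
Proof.
have h1 : a - b <= `|a - b| by rewrite ler_norm.
have h2 : b - a <= `|a - b| by rewrite distrC ler_norm.
have h3 := normr_ge0 (a - b).
rewrite ler_norml; case: (ltP 0 a) => ha; case: (ltP 0 b) => hb; rewrite ?(min_r ler01);
  try (case: (ltP 1 a) => ha1); try (case: (ltP 1 b) => hb1); apply/andP; split; lra.
Qed.

Lemma bounded_unif_cont_ramp c r d : 0 < d -> bounded_unif_cont dist (ramp c r d).
Proof.
move=> d0; apply: (@bounded_unif_cont_lipschitz _ d^-1 1) => [z|z w].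
  by have /andP[? ?] := ramp_itv c r d z; rewrite ger0_norm.
apply: (@le_trans _ _ (`|(r - dist c z) / d - (r - dist c w) / d|)).
  exact: ler_dist_clamp.
rewrite -mulrBl normrM mulrC gtr0_norm ?invr_gt0// ler_pM2l ?invr_gt0//.
by rewrite (_ : _ - _ = - (dist c z - dist c w)) ?normrN ?ler_distB//; ring.
Qed.

(** ** Density of bounded uniformly continuous functions in L^1 of a ball *)

Section Density.
Variable D : set Z.
Hypothesis mD : measurable D.
Hypothesis finD : (mu D < +oo)%E.
Local Notation approx := (approximable dist mu D).

Lemma L1dist_le_mu (f g : Z -> R) N : measurable N ->
  measurable_fun D f -> measurable_fun D g ->
  (forall z, D z -> `|f z - g z| <= \1_N z) -> (L1dist mu D f g <= mu (N `&` D))%E.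
Proof.
move=> mN mf mg le; rewrite -integral_indic//; apply: ge0_le_integral => //.
- exact: measurable_dist_fun.
- by apply/measurable_EFinP; exact: measurable_indic.
Qed.

(** Continuity of the measure from above, available because [D] has finite measure. *)
Lemma mu_shrink (F : nat -> set Z) (e : R) : (forall n, measurable (F n)) ->
  (forall n, F n.+1 `<=` F n) -> \bigcap_n F n = set0 -> 0 < e ->
  exists n, (mu (F n `&` D) <= e%:E)%E.
Proof.
move=> mF dF F0 e0; pose G n := F n `&` D.
have mG n : measurable (G n) by exact: measurableI.
have GD : (mu (G 0%N) < +oo)%E.
  by apply: le_lt_trans finD; apply: le_measure; rewrite ?inE//; exact: subIsetr.
have G0 : \bigcap_n G n = set0.
  by rewrite -subset0 -F0 => z h n _; case: (h n I).
have nG : {homo G : n m / (n <= m)%N >-> (m <= n)%O}.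
  apply/nonincreasing_seqP => n; apply/subsetPset.
  exact: setSI.
have := nonincreasing_cvg_mu GD mG; rewrite G0 => /(_ measurable0 nG); rewrite measure0.
move=> /fine_cvgP[fin /cvgrPdist_lt/(_ _ e0)[n _ hn]].
case: fin => m _ fin; exists (maxn n m).
have := hn (maxn n m) (leq_maxl _ _); rewrite sub0r normrN /= => h.
rewrite -[leLHS]fineK ?lee_fin; last exact: (fin _ (leq_maxr _ _)).
exact: le_trans (ler_norm _) (ltW h).
Qed.

(** The ramp of width 1 / (n + 1) differs from the indicator only in the shell [F n]. Balls being
    open, a point of the ball leaves the shells eventually, so they decrease to the empty set. *)
Lemma approximable_indic_dball c r : approx \1_(dball dist c r).
Proof.
have mi := measurable_dball c r.
split; first exact: measurable_indic.
move=> e e0; pose F n := ball c r `\` ball c (r - n.+1%:R^-1).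
have [|||n hn] := @mu_shrink F e _ _ _ e0.
- by move=> n; apply: measurableD; exact: measurable_dball.
- move=> n z [h1 h2]; split => // h3; apply: h2; move: h3; rewrite /dball/= => h3.
  apply: lt_le_trans h3 _; rewrite lerB// lef_pV2 ?posrE// ler_nat//.
- rewrite -subset0 => z h; have [h0 _] := h 0%N I.
  have rz : 0 < r - dist c z by rewrite subr_gt0.
  have [n _ /(_ n (leqnn n))/= hn] := near_infty_natSinv_lt (PosNum rz).
  by case: (h n I) => _; apply; rewrite /dball/= ltrBrDr addrC -ltrBrDr.
exists (ramp c r n.+1%:R^-1); first by apply: bounded_unif_cont_ramp; rewrite invr_gt0.
apply: le_trans hn; apply: L1dist_le_mu.
- by apply: measurableD; exact: measurable_dball.
- exact: measurable_indic.
- by apply: (measurable_bounded_unif_cont (dist := dist)); apply: bounded_unif_cont_ramp; rewrite invr_gt0.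
- move=> z _; have /andP[h0 h1] := ramp_itv c r n.+1%:R^-1 z.
  have n0 : 0 < n.+1%:R^-1 :> R by rewrite invr_gt0.
  rewrite !indicE; case: (boolP (z \in ball c r)) => [zb|].
    case: (boolP (z \in F n)) => [_|]; first by rewrite ger0_norm ?subr_ge0//; lra.
    rewrite notin_setE => h; rewrite ramp1// ?subrr ?normr0//; apply/ltW.
    by apply: contrapT => h'; apply: h; split; [exact/set_mem|].
  rewrite notin_setE /dball/= => h; rewrite ramp0 ?subrr ?normr0//.
  by rewrite leNgt; exact/negP.
Qed.

Let good : set (set Z) := [set A | measurable A /\ approx \1_A].

(** The indicator of a finite union is a maximum of indicators. What finite unions miss of the
    countable one shrinks to the empty set, hence is small in measure inside [D]. *)
Lemma good_bigcup (F : nat -> set Z) : (forall n, good (F n)) -> good (\bigcup_n F n).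
Proof.
move=> gF; have mU : measurable (\bigcup_n F n) by apply: bigcupT_measurable => n; case: (gF n).
have gU n : good (\big[setU/set0]_(i < n) F i).
  elim: n => [|n [mIH IH]].
    by rewrite big_ord0; split => //; rewrite indic0; exact: approximable_cst.
  rewrite big_ord_recr/=; case: (gF n) => mn an; split; first exact: measurableU.
  rewrite (_ : \1_(_ `|` _) = fun z => Num.max (\1_(\big[setU/set0]_(i < n) F i) z) (\1_(F n) z) : R).
    exact: approximable_max.
  apply/funext => z; rewrite !indicE in_setU.
  by do 2!case: (z \in _); rewrite /= ?maxxx// /Num.max ?ltr01 // ltr10.
have mi : measurable_fun D (\1_(\bigcup_n F n) : Z -> R) by exact: measurable_indic.
split=> //; apply: approximable_limit => //.
move=> e e0; pose G n := \bigcup_n F n `\` \big[setU/set0]_(i < n) F i.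
have [|||n hn] := @mu_shrink G e _ _ _ e0.
- by move=> n; apply: measurableD => //; case: (gU n).
- by move=> n z [zU h]; split => // h'; apply: h; rewrite big_ord_recr/=; left.
- rewrite -subset0 => z h; have [[n _ zn] _] := h 0%N I; case: (h n.+1 I) => _; apply.
  by rewrite big_ord_recr/=; right.
exists \1_(\big[setU/set0]_(i < n) F i); first by case: (gU n).
apply: le_trans hn; have [mn _] := gU n; apply: L1dist_le_mu.
- exact: measurableD.
- exact: measurable_indic.
- exact: measurable_indic.
- move=> z _; rewrite !indicE; case: (boolP (z \in \big[setU/set0]_(i < n) F i)) => zn.
    rewrite (_ : z \in \bigcup_n F n) ?subrr ?normr0//.
    rewrite inE; move: zn; rewrite inE -bigcup_mkord => -[k _ zk]; by exists k.
  case: (boolP (z \in \bigcup_n F n)) => zU; last by rewrite subrr normr0.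
  rewrite subr0 normr1 (_ : z \in G n)//; apply/mem_set; split; first exact/set_mem.
  by move: zn; rewrite notin_setE.
Qed.

Lemma good_sigma_algebra : sigma_algebra setT good.
Proof.
split.
- by split=> //; rewrite indic0; exact: approximable_cst.
- move=> A [mA aA]; rewrite setTD; split; first exact: measurableC.
  rewrite (_ : \1_(~` A) = fun z => 1 + -1 * (\1_A z) : R).
    apply: approximableD => //; first exact: approximable_cst.
    exact: approximableZ.
  apply/funext => z; rewrite !indicE in_setC; case: (z \in A) => /=.
    by rewrite mulr1 subrr.
  by rewrite mulr0 addr0.
- exact: good_bigcup.
Qed.

Section Nets.
Variable S : int -> set Z.
Hypothesis netS : forall n, maximal_separated dist n (S n).

(** Reindexing over the naturals, padded with empty sets, for use with the countable unions of a
    sigma-algebra. *)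
Lemma bigcup_countable_seq (I : Type) (A : set I) (F : I -> set Z) : countable A ->
  exists G : nat -> set Z, (forall n, G n = set0 \/ exists2 i, A i & G n = F i) /\
    \bigcup_(i in A) F i = \bigcup_n G n.
Proof.
move=> /countable_injP[f finj]; exists (fun n => \bigcup_(i in A `&` [set i | f i = n]) F i).
split=> [n|].
  have [h|/set0P[i [Ai fi]]] := eqVneq (A `&` [set i | f i = n]) set0.
    by left; rewrite h bigcup_set0.
  right; exists i => //; apply/seteqP; split => [z [k [Ak fk] zk]|z zi]; last by exists i.
  by rewrite (_ : i = k)//; apply: finj; rewrite ?inE// fi fk.
apply/seteqP; split => [z [i Ai zi]|z [n _ [i [Ai _] zi]]]; last by exists i.
by exists (f i) => //; exists i.
Qed.

(** The nets make the space second countable: an open set is the union of the balls about net points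
    of levels n >= 0 that it contains. Open sets are thus countable unions of balls, and they
    generate the measurable sets. *)
Lemma approximable_indic A : measurable A -> approx \1_A.
Proof.
have goodb (I : Type) (B : set I) (F : I -> set Z) : countable B ->
    (forall i, B i -> good (F i)) -> good (\bigcup_(i in B) F i).
  move=> /(@bigcup_countable_seq I B F)[G [hG ->]] gF; apply: good_bigcup => n.
  case: (hG n) => [->|[i Bi ->]]; last exact: gF.
  by case: good_sigma_algebra.
suff : <<s dopen dist>> `<=` good by move=> h; rewrite borelZ => /h[].
apply: smallest_sub; first exact: good_sigma_algebra.
move=> U oU.
rewrite (_ : U = \bigcup_(n : nat) \bigcup_(x in S n%:Z `&` [set x | ball x (rad n%:Z) `<=` U])
    ball x (rad n%:Z)); last first.
  apply/seteqP; split => [z Uz|z [n _ [x [_ h]]]]; last exact: h.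
  have [r r0 rU] := oU z Uz; have [n /(_ n (leqnn n)) hn] := rad_lt_exists (divr_gt0 r0 (ltr0n R 2)).
  have [x Sx zx] := maximal_net_cover z (netS n%:Z).
  have rn := @rad_gt0 R n%:Z; exists n => //; exists x.
    split=> //= w; rewrite /dball/= => xw; apply: rU; rewrite /dball/=.
    by apply: le_lt_trans (dist_tri z x w) _; lra.
  by rewrite /dball/= distC; lra.
refine (goodb nat setT _ _ _); first exact: countableP.
move=> n _; refine (goodb Z _ _ _ _) => [|x _].
  apply: (@sub_countable _ _ _ (S n%:Z)); last exact: (countable_net (netS n%:Z).1).
  by apply: subset_card_le => x [].
split; [exact: measurable_dball|exact: approximable_indic_dball].
Qed.

Lemma approximable_integrable (f : Z -> R) : mu.-integrable D (EFin \o f) -> approx f.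
Proof.
move=> intf; have mf : measurable_fun D f.
  by apply/measurable_EFinP; case/integrableP: intf.
apply: approximable_limit => // e e0.
have [g [ig _ cvg]] := approximation_sfun_integrable mD intf.
have [n hn] : exists n, (L1dist mu D f (fun z => g n z) <= e%:E)%E.
  move: cvg => /fine_cvgP[[m _ fin] /cvgrPdist_lt/(_ _ e0)[n _ hn]].
  exists (maxn n m); have := hn _ (leq_maxl n m); rewrite sub0r normrN /= => h.
  have := fin _ (leq_maxr n m) => /= hf.
  rewrite /L1dist -[leLHS]fineK//= lee_fin; exact: le_trans (ler_norm _) (ltW h).
exists (fun z => g n z) => //.
rewrite (_ : (fun z => g n z) = fun z => \sum_(y \in range (g n)) y * \1_(g n @^-1` [set y]) z).
  apply: approximable_sum => // y _; apply: approximableZ => //.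
  exact: approximable_indic.
by apply/funext => z; rewrite fimfunE.
Qed.

End Nets.

End Density.

(** * Partitions of unity and discrete convolutions *)

Variable S : int -> set Z.
Hypothesis netS : forall n, maximal_separated dist n (S n).
Variable psi : int -> Z -> Z -> R.
Variable C2 : R.
Hypothesis psiP : psi_family dist S psi C2.

Definition locally_integrable (g : Z -> R) : Prop :=
  forall c r, mu.-integrable (ball c r) (EFin \o g).

Lemma measurable_locally_integrable g c r : locally_integrable g ->
  measurable_fun (ball c r) g.
Proof. by move=> lg; apply/measurable_EFinP; case/integrableP: (lg c r). Qed.

Local Notation avg := (avgR dist mu).

Lemma finite_near n z r : finite_set (S n `&` ball z r).
Proof. exact: finite_net_ball (netS n).1 z r. Qed.

Lemma card_near (n : int) z (lam : R) : 1 <= lam ->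
  \sum_(y \in S n `&` ball z (lam * rad n)) (1 : R) <= dbl 4 * dbl (3 * lam).
Proof.
move=> l1; have rn := @rad_gt0 R n; apply: (card_net (netS n).1 (finite_near n z _) (@subset_refl _ _)).
- by rewrite mulr_gt0//; lra.
- lra.
- have : rad n <= lam * rad n by rewrite ler_peMl// ltW.
  lra.
Qed.

Lemma psi_ge0 n x z : 0 <= psi n x z.
Proof. by case: psiP. Qed.

Lemma psi_supp n x z : S n x -> psi n x z != 0 -> ball z (rad n) x.
Proof.
move=> Sx; apply: contra_neqP => h; case: psiP => _ h0 _ _; apply: h0 => //.
by move=> xz; apply: h; move: xz; rewrite /Bx /dball/= distC.
Qed.

Lemma psi_out n x z : S n x -> ~ ball z (rad n) x -> psi n x z = 0.
Proof. by move=> Sx h; apply: contrapT => /eqP /(psi_supp Sx). Qed.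

(** A sum over the possibly infinite net [S n] has its terms supported within [rad n] of [z];
    computations are moved to a finite [B] containing those points. *)
Lemma sum_psi_widen (a : Z -> R) n z B : S n `&` ball z (rad n) `<=` B -> B `<=` S n ->
  \sum_(x \in S n) a x * psi n x z = \sum_(x \in B) a x * psi n x z.
Proof.
move=> hB BS; apply/esym/fsbig_widen => // x [Sx nB] /=.
rewrite psi_out ?mulr0// => h; apply: nB; exact: hB.
Qed.

Lemma sum_psi n z B : S n `&` ball z (rad n) `<=` B -> B `<=` S n ->
  \sum_(x \in B) psi n x z = 1.
Proof.
move=> hB BS; move: (sum_psi_widen (fun=> 1) hB BS); rewrite -!mulr_fsumr !mul1r => <-.
by case: psiP => _ _ h _; exact: h.
Qed.

Lemma psi_le1 n x z : S n x -> psi n x z <= 1.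
Proof.
move=> Sx; have [->//|/(psi_supp Sx) h] := eqVneq (psi n x z) 0.
rewrite -(@sum_psi n z _ (@subset_refl _ _) (@subIsetl _ _ _)).
by apply: (ler_fsum1 (F := psi n ^~ z) (finite_near n z _)) => // y _; exact: psi_ge0.
Qed.

Lemma measurable_psi n x D : S n x -> measurable_fun D (psi n x).
Proof.
move=> Sx; apply: measurable_funTS; apply: (measurable_lipschitz (L := C2 * 2 ^ n)).
by case: psiP => _ _ _ h z w; exact: h.
Qed.

Lemma integrable_bounded_ball (f : Z -> R) M c r :
  measurable_fun (ball c r) f -> (forall z, ball c r z -> `|f z| <= M) ->
  mu.-integrable (ball c r) (EFin \o f).
Proof.
move=> mf fM; have [r0|r0] := leP r 0.
  rewrite (_ : ball c r = set0) ?integrable_set0//; apply/seteqP; split => // z.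
  by rewrite /dball/=; have := dist_ge0 c z; move=> ? ?; lra.
apply: measurable_bounded_integrable => //; first exact: measurable_dball.
  by case: (balls c r0).
exists M; split; first exact: num_real.
by move=> x Mx z /fM h; apply: le_trans h (ltW Mx).
Qed.

Lemma integrable_fsum (I : choiceType) (A : set I) (D : set Z) (f : I -> Z -> R) :
  measurable D -> finite_set A -> (forall i, A i -> mu.-integrable D (EFin \o f i)) ->
  mu.-integrable D (EFin \o (fun z => \sum_(i \in A) f i z)).
Proof.
move=> mD fA af; under eq_fun do rewrite fsbig_finite//.
have : forall i, i \in (fset_set A : seq I) -> mu.-integrable D (EFin \o f i).
  by move=> i; rewrite in_fset_set// inE; exact: af.
elim: (fset_set A : seq I) => [_|i s IH h].
  rewrite (_ : _ \o _ = cst 0%E); first exact: integrable0.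
  by apply/funext => z /=; rewrite big_nil.
rewrite (_ : _ \o _ = (EFin \o f i) \+ (EFin \o (fun z => \sum_(j <- s) f j z)%R))%E; last first.
  by apply/funext => z /=; rewrite big_cons.
apply: integrableD => //; first exact/h/mem_head.
by apply: IH => k ks; apply: h; rewrite inE ks orbT.
Qed.

(** Real counterpart of [Tn], with the family given on the centers of one level. The real and
    imaginary parts of T_n(Pf) are of this form by [Re_Tn] and [Im_Tn]. *)
Definition TR (n : int) (u : Z -> R) (z : Z) : R := \sum_(x \in S n) u x * psi n x z.

Lemma TR_ball n u c r z : ball c r z ->
  TR n u z = \sum_(x \in S n `&` ball c (r + rad n)) u x * psi n x z.
Proof.
move=> cz; apply: sum_psi_widen => [x [Sx zx]|x []//]; split => //.
by apply: subset_dball zx; rewrite distC; move: cz; rewrite /dball/= => ?; lra.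
Qed.

Lemma integrable_TR n u : locally_integrable (TR n u).
Proof.
move=> c r; have mB := measurable_dball c r.
apply: (eq_integrable mB (fun z => (\sum_(x \in S n `&` ball c (r + rad n)) u x * psi n x z)%:E)).
  by move=> z /set_mem cz /=; rewrite -TR_ball.
apply: integrable_fsum => // [|x [Sx _]]; first exact: finite_near.
apply: (@integrable_bounded_ball _ `|u x|).
  by apply: measurable_funM => //; exact: measurable_psi.
move=> z _; rewrite normrM ler_piMr// ger0_norm ?psi_ge0//; exact: psi_le1.
Qed.

Lemma TRB n u v z : TR n (fun x => u x - v x) z = TR n u z - TR n v z.
Proof.
rewrite !(@TR_ball n _ z 1) /dball/= ?distxx// !fsbig_finite; do ?exact: finite_near.
by rewrite -sumrB; apply: eq_bigr => x _; rewrite mulrBl.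
Qed.

Lemma TR_cst n a z : TR n (fun=> a) z = a.
Proof.
rewrite /TR -mulr_fsumr (@sum_psi n z (S n)) ?mulr1//; by move=> x [].
Qed.

(** [TR n u z] is a convex combination of values of [u] at net points within [rad n] of [z]. *)
Lemma TR_near n u z a e : (forall x, S n x -> ball z (rad n) x -> `|u x - a| <= e) ->
  `|TR n u z - a| <= e.
Proof.
move=> h; rewrite -[a in leLHS](TR_cst n a z) -TRB.
rewrite /TR (sum_psi_widen _ (@subset_refl _ _) (@subIsetl _ _ _)).
have fA := finite_near n z (rad n).
apply: (le_trans (ler_norm_fsum _ fA)).
have <- : \sum_(x \in S n `&` ball z (rad n)) e * psi n x z = e.
  by rewrite -mulr_fsumr (sum_psi (@subset_refl _ _) (@subIsetl _ _ _)) mulr1.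
apply: ler_fsum => // x [Sx zx]; rewrite normrM (ger0_norm (psi_ge0 _ _ _)).
by rewrite ler_wpM2r ?psi_ge0// h.
Qed.

(** * Averages over balls *)

Lemma avgE g n x : avg g (n, x) = (vol x (rad n))^-1 * Rintegral mu (ball x (rad n)) g.
Proof. by []. Qed.

Lemma avgB f g n x : locally_integrable f -> locally_integrable g ->
  avg (fun z => f z - g z) (n, x) = avg f (n, x) - avg g (n, x).
Proof.
by move=> lf lg; rewrite !avgE RintegralB ?mulrBr//; exact: measurable_dball.
Qed.

Lemma avg_cst a n x : avg (fun=> a) (n, x) = a.
Proof.
rewrite avgE Rintegral_cst; last exact: measurable_dball.
by rewrite mulrCA mulVf ?mulr1// gt_eqF// vol_gt0// rad_gt0.
Qed.

Lemma locally_integrable_cst a : locally_integrable (fun=> a).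
Proof. by move=> c r; apply: (@integrable_bounded_ball _ `|a|). Qed.

Lemma locally_integrableB f g : locally_integrable f -> locally_integrable g ->
  locally_integrable (fun z => f z - g z).
Proof.
move=> lf lg c r; rewrite (_ : _ \o _ = (EFin \o f) \- (EFin \o g))%E//.
by apply: integrableB => //; exact: measurable_dball.
Qed.

Lemma vol_avg_le g n x : locally_integrable g ->
  ((`|avg g (n, x)| * vol x (rad n))%:E <= \int[mu]_(z in ball x (rad n)) `|g z|%:E)%E.
Proof.
move=> lg; have v0 := @vol_gt0 x _ (@rad_gt0 R n); have mB := measurable_dball x (rad n).
rewrite avgE normrM gtr0_norm ?invr_gt0// mulrAC mulVf ?gt_eqF// mul1r EFin_normr_Rintegral//.
by apply: le_abse_integral => //; case/integrableP: (lg x (rad n)).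
Qed.

Lemma avg_le g n x e : locally_integrable g -> (forall w, ball x (rad n) w -> `|g w| <= e) ->
  `|avg g (n, x)| <= e.
Proof.
move=> lg h; have v0 := @vol_gt0 x _ (@rad_gt0 R n); have mB := measurable_dball x (rad n).
rewrite -(ler_pM2r v0) -lee_fin; apply: (le_trans (vol_avg_le _ _ lg)).
apply: (@le_trans _ _ (\int[mu]_(z in ball x (rad n)) e%:E)%E).
  apply: ge0_le_integral => //.
  by apply/measurable_EFinP/measurableT_comp => //; exact: measurable_locally_integrable.
by rewrite integral_cst// volE// rad_gt0.
Qed.

Lemma avg_near g n x a e : locally_integrable g ->
  (forall w, ball x (rad n) w -> `|g w - a| <= e) -> `|avg g (n, x) - a| <= e.
Proof.
move=> lg h; rewrite -[a in leLHS](avg_cst a n x) -avgB//; last exact: locally_integrable_cst.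
by apply: avg_le => //; apply: locally_integrableB => //; exact: locally_integrable_cst.
Qed.

Lemma locally_integrable_buc f : bounded_unif_cont dist f -> locally_integrable f.
Proof.
move=> [mf [M fM] _] c r; apply: integrable_bounded_ball => [|z _]; last exact: fM.
exact: measurable_funTS.
Qed.

(** * Convergence of discrete convolutions in L^1 of balls *)

(** For n >= 0 the radii are at most 1, so the balls lie in the one of radius [r + 2]; by
    [card_near] a point belongs to at most [dbl 4 * dbl 3] of them. *)
Lemma sum_int_balls (n : int) c r (g : Z -> R) : 0 <= n -> locally_integrable g -> 
  (\sum_(x \in S n `&` ball c (r + rad n)) \int[mu]_(z in ball x (rad n)) `|g z|%:E <=
   (dbl 4 * dbl 3)%:E * \int[mu]_(z in ball c (r + 2)) `|g z|%:E)%E.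
Proof.
move=> n0 lg; set A := S n `&` _; have fA : finite_set A by exact: finite_near.
have mB := measurable_dball c (r + 2).
have mg : measurable_fun (ball c (r + 2)) (fun z => `|g z|%:E).
  by apply/measurable_EFinP/measurableT_comp => //; exact: measurable_locally_integrable.
have mi x : measurable_fun (ball c (r + 2)) (fun z => (\1_(ball x (rad n)) z)%:E : \bar R).
  by apply/measurable_EFinP; exact/measurable_indic/measurable_dball.
have r1 : rad n <= 1 :> R by rewrite -[leRHS]/(rad 0) le_rad.
have -> : (\sum_(x \in A) \int[mu]_(z in ball x (rad n)) `|g z|%:E =
    \sum_(x \in A) \int[mu]_(z in ball c (r + 2)) (`|g z|%:E * (\1_(ball x (rad n)) z)%:E))%E.
  apply: eq_fsbigr => x /set_mem[_ cx].
  have sub : ball x (rad n) `<=` ball c (r + 2).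
    by apply: subset_dball; move: cx; rewrite /dball/= distC => ?; lra.
  rewrite -[in LHS](setIidr sub) integral_mkcondr; apply: eq_integral => z _.
  by rewrite patchE indicE; case: (_ \in _); rewrite ?mule1 ?mule0.
rewrite -ge0_integral_fsum//; last by move=> x; exact: emeasurable_funM.
rewrite -ge0_integralZl//; last by rewrite lee_fin mulr_ge0// ltW// dbl_gt0//; lra.
apply: ge0_le_integral => //.
- by move=> z _; apply: fsume_ge0 => x _; rewrite mule_ge0.
- by apply: emeasurable_fsum => // x; exact: emeasurable_funM.
- by apply: emeasurable_funM.
- move=> z _; under eq_fsbigr do rewrite -EFinM; rewrite fsumEFin// -EFinM lee_fin.
  rewrite -mulr_fsumr mulrC ler_wpM2r//.
  apply: (@le_trans _ _ (\sum_(y \in S n `&` ball z (1 * rad n)) (1 : R))).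
    rewrite mul1r (fsbigID (ball z (rad n)))//= [X in _ + X]fsbig1 ?addr0; last first.
      move=> x [_ h]; rewrite indicE memNset// => xz; apply: h.
      by move: xz; rewrite /dball/= distC.
    apply: (@le_trans _ _ (\sum_(x \in A `&` ball z (rad n)) (1 : R))).
      by apply: ler_fsum => [|x _]; [exact: finite_setIl|rewrite indicE; case: (_ \in _)].
    by apply: ler_fsum_subset => //; [exact: finite_near|move=> x [[]]].
  by have := @card_near n z 1 (lexx _); rewrite mulr1.
Qed.

Lemma int_TR_le (n : int) c r (u : Z -> R) :
  (\int[mu]_(z in ball c r) `|TR n u z|%:E <=
   (\sum_(x \in S n `&` ball c (r + rad n)) `|u x| * vol x (rad n))%:E)%E.
Proof.
set A := S n `&` _; have fA : finite_set A by exact: finite_near.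
have mB := measurable_dball c r.
have mpsi x : S n x -> measurable_fun (ball c r) (fun z => (psi n x z)%:E).
  by move=> Sx; apply/measurable_EFinP; exact: measurable_psi.
(* Extended by 0 off [A], so that measurability and sign hold for every index; the measurability of
   [psi n x] is known at net points only. *)
pose h x z := if x \in A then (`|u x| * psi n x z)%:E else 0%E.
have mh x : measurable_fun (ball c r) (h x).
  have [xA|xA] := boolP (x \in A); last by rewrite /h (negbTE xA).
  have [Sx _] := set_mem xA; rewrite /h xA.
  by apply/measurable_EFinP/measurable_funM => //; exact: measurable_psi.
have h0 x z : (0 <= h x z)%E.
  by rewrite /h; case: ifP => // _; rewrite lee_fin mulr_ge0// psi_ge0.
apply: (@le_trans _ _ (\int[mu]_(z in ball c r) \sum_(x \in A) h x z)%E).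
  apply: ge0_le_integral => //.
  - apply/measurable_EFinP/measurableT_comp => //.
    exact/measurable_locally_integrable/integrable_TR.
  - exact: emeasurable_fsum.
  - move=> z cz; rewrite (TR_ball n _ cz) -/A.
    rewrite (eq_fsbigr (fun x => (`|u x| * psi n x z)%:E)); last first.
      by move=> x xA; rewrite /h xA.
    rewrite fsumEFin// lee_fin; apply: le_trans (ler_norm_fsum _ fA) _.
    by apply: ler_fsum => // x _; rewrite normrM (ger0_norm (psi_ge0 _ _ _)).
rewrite ge0_integral_fsum// -fsumEFin//; apply: lee_fsum => // x xA.
rewrite /h mem_set//.
under eq_integral do rewrite EFinM.
have [Sx _] := xA.
rewrite ge0_integralZl//; last 2 first.
- exact: mpsi.
- by move=> z _; rewrite lee_fin psi_ge0.
rewrite EFinM lee_wpmul2l// -volE ?rad_gt0//.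
have mBx := measurable_dball x (rad n).
apply: (@le_trans _ _ (\int[mu]_(z in ball c r) (\1_(ball x (rad n)) z)%:E)%E).
  apply: ge0_le_integral => //.
  - by move=> z _; rewrite lee_fin psi_ge0.
  - exact: mpsi.
  - by apply/measurable_EFinP; exact: measurable_indic.
  - move=> z _; rewrite lee_fin indicE.
    case: (boolP (z \in _)) => [_|]; first exact: psi_le1.
    rewrite notin_setE => nz; rewrite psi_out// => h'; apply: nz; move: h'.
    by rewrite /dball/= distC.
by rewrite integral_indic//; apply: le_measure; rewrite ?inE//; exact: measurableI.
Qed.

(** L^1 bound for g |-> T_n(Pg), uniform in n >= 0 but with a larger ball on the right; it reduces
    the convergence to a dense class. *)
Lemma TR_avg_contraction (n : int) c r g : 0 <= n -> locally_integrable g ->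
  (\int[mu]_(z in ball c r) `|TR n (fun x => avg g (n, x)) z|%:E <=
   (dbl 4 * dbl 3)%:E * \int[mu]_(z in ball c (r + 2)) `|g z|%:E)%E.
Proof.
move=> n0 lg; apply: (le_trans _ (sum_int_balls c r n0 lg)).
have fA := finite_near n c (r + rad n).
apply: (le_trans (int_TR_le _ _ _ _)); rewrite -fsumEFin//; apply: lee_fsum => // x _.
exact: vol_avg_le.
Qed.

Lemma TR_avg_cvg c r g (e : R) : 0 < r -> locally_integrable g -> 0 < e ->
  exists n0 : nat, forall n : nat, (n0 <= n)%N ->
    (L1dist mu (ball c r) (TR n%:Z (fun x => avg g (n%:Z, x))) g <= e%:E)%E.
Proof.
move=> r0 lg e0; pose K := dbl 4 * dbl 3.
have K0 : 0 < K by rewrite mulr_gt0// dbl_gt0//; lra.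
have mB := measurable_dball c r; have mB2 := measurable_dball c (r + 2).
have fB2 : (mu (ball c (r + 2)) < +oo)%E by case: (balls c (addr_gt0 r0 (ltr0n R 2))).
(* The three errors [K * d], [e / 2] and [d] below add up to [e]. *)
pose d := e / 2 / (K + 1); have d0 : 0 < d by rewrite !divr_gt0// addr_gt0.
have [_ /(_ d d0)[f cf gf]] := approximable_integrable mB2 fB2 netS (lg c (r + 2)).
pose d' := e / 2 / vol c r; have d0' : 0 < d' by rewrite !divr_gt0// vol_gt0.
have [_ _ /(_ _ d0')[dl dl0 mod_f]] := cf.
(* Half of the modulus [dl], since the two points compared are each within [rad n] of the same
   center. *)
have [n0 hn0] := rad_lt_exists (divr_gt0 dl0 (ltr0n R 2)).
exists n0 => n /hn0 rn; have lf := locally_integrable_buc cf.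
set Tg := TR _ _; pose Tf := TR n%:Z (fun x => avg f (n%:Z, x)).
have mloc h : locally_integrable h -> measurable_fun (ball c r) h.
  exact: measurable_locally_integrable.
have mTg : measurable_fun (ball c r) Tg by exact/mloc/integrable_TR.
have mTf : measurable_fun (ball c r) Tf by exact/mloc/integrable_TR.
have mf := mloc _ lf; have mg := mloc _ lg.
have H1 : (L1dist mu (ball c r) Tg Tf <= (K * d)%:E)%E.
  rewrite /L1dist; have E z : Tg z - Tf z = TR n%:Z (fun x => avg (fun w => g w - f w) (n%:Z, x)) z.
    by rewrite -TRB; apply: eq_fsbigr => x _; rewrite avgB.
  under eq_integral do rewrite E.
  apply: le_trans (TR_avg_contraction _ _ _ (locally_integrableB lg lf)) _ => //.
  apply: (@le_trans _ _ (K%:E * d%:E)%E); last by rewrite EFinM.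
  by apply: lee_wpmul2l => //; rewrite lee_fin ltW.
have H2 : (L1dist mu (ball c r) Tf f <= (e / 2)%:E)%E.
  apply: (@le_trans _ _ (\int[mu]_(z in ball c r) d'%:E)%E).
    apply: ge0_le_integral => //; first exact: measurable_dist_fun.
    move=> z _; rewrite lee_fin; apply: TR_near => x _ zx; apply: avg_near => // w xw.
    apply: mod_f; rewrite distC; apply: le_lt_trans (dist_tri z x w) _.
    by move: zx xw; rewrite /dball/=; move: rn => /=; lra.
  rewrite integral_cst// volE//= -EFinM lee_fin /d' divfK// gt_eqF//.
  exact: vol_gt0.
have H3 : (L1dist mu (ball c r) f g <= d%:E)%E.
  apply: le_trans gf; rewrite /L1dist; under eq_integral do rewrite distrC.
  apply: ge0_subset_integral => //.
    by apply: measurable_dist_fun; exact: measurable_locally_integrable.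
  by apply: subset_dball; rewrite distxx; lra.
apply: le_trans (L1dist_triangle mB mTg mTf mg H1 (L1dist_triangle mB mTf mf mg H2 H3)) _.
have dE : d * (K + 1) = e / 2 by rewrite divfK// gt_eqF// addr_gt0.
rewrite -!EFinD lee_fin; move: dE; rewrite mulrDr mulr1 (mulrC d) => ?; lra.
Qed.
(** ** Oscillation of averages of discrete convolutions *)

Section Oscillation.
Variable g : Z -> R.
Hypothesis lg : locally_integrable g.
(** Stands for |d(Pf)|. It is kept abstract because the real and the imaginary part of [f] are both
    handled with the majorant [Wdu] of the complex function. *)
Variable W : int -> Z -> R.
Hypothesis W_ge0 : forall j x, 0 <= W j x.
Hypothesis W_nbr : forall j x l y, nbr dist S (j, x) (l, y) ->
  `|avg g (l, y) - avg g (j, x)| <= W j x.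

Let T n := TR n (fun x => avg g (n, x)).

Lemma nbr_common j x l y z : S j x -> S l y -> (j, x) <> (l, y) -> `|j - l| <= 1 ->
  ball z (rad j) x -> ball z (rad l) y -> nbr dist S (j, x) (l, y).
Proof.
move=> Sx Sy xy jl zx zy; split=> //; exists z; move: zx zy.
by rewrite /Bx /dball/= !(distC z).
Qed.

(** Both partitions of unity sum to 1, so the difference is a double convex combination of
    differences of averages at vertices of levels j + 1 and j whose balls contain [z]; such vertices
    are neighbors. *)
Lemma T_step j z : `|T (j + 1) z - T j z| <= TR j (W j) z.
Proof.
have -> : T (j + 1) z - T j z = TR j (fun x => T (j + 1) z - avg g (j, x)) z.
  by rewrite TRB TR_cst.
have E u := sum_psi_widen u (@subset_refl _ (S j `&` ball z (rad j))) (@subIsetl _ _ _).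
have fA := finite_near j z (rad j).
rewrite /TR !E; apply: le_trans (ler_norm_fsum _ fA) _.
apply: ler_fsum => // x [Sx zx]; rewrite normrM (ger0_norm (psi_ge0 _ _ _)).
rewrite ler_wpM2r ?psi_ge0//; apply: TR_near => y Sy zy.
apply: W_nbr; apply: (@nbr_common _ _ _ _ z) => //.
- by case=> /eqP; rewrite -subr_eq0 opprD addrA subrr sub0r oppr_eq0 oner_eq0.
- by rewrite opprD addrA subrr sub0r normrN1.
Qed.

Lemma int_T_step j c r : (L1dist mu (ball c r) (T j) (T (j + 1)%R) <=
  (\sum_(x \in S j `&` ball c (r + rad j)) W j x * vol x (rad j))%:E)%E.
Proof.
have mB := measurable_dball c r.
have mT h n : measurable_fun (ball c r) (TR n h).
  exact/measurable_locally_integrable/integrable_TR.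
apply: (@le_trans _ _ (\int[mu]_(z in ball c r) `|TR j (W j) z|%:E)%E).
  apply: ge0_le_integral => //.
  - by apply: measurable_dist_fun => //; exact: mT.
  - by apply/measurable_EFinP/measurableT_comp => //; exact: mT.
  - by move=> z _; rewrite lee_fin distrC (le_trans (T_step _ _))// ler_norm.
apply: le_trans (int_TR_le _ _ _ _) _.
by under eq_fsbigr do rewrite (ger0_norm (W_ge0 _ _)).
Qed.

(* Telescoping over the levels [n + m], using that [T j] tends to [g] in L^1 of the ball. *)
Lemma int_T_tail n c r L t : 0 < r -> 0 <= L -> 0 <= t < 1 ->
  (forall m : nat, \sum_(x \in S (n + m%:Z) `&` ball c (r + rad (n + m%:Z)))
      W (n + m%:Z) x * vol x (rad (n + m%:Z)) <= L * t ^+ m) ->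
  (L1dist mu (ball c r) (T n) g <= (L / (1 - t))%:E)%E.
Proof.
move=> r0 L0 /andP[t0 t1] hL.
have mB := measurable_dball c r.
have mT k : measurable_fun (ball c r) (T k).
  exact/measurable_locally_integrable/integrable_TR.
have mg := @measurable_locally_integrable g c r lg.
have t1' : 0 < 1 - t by rewrite subr_gt0.
have step m : (L1dist mu (ball c r) (T n) (T (n + m%:Z)%R) <= (L * (1 - t ^+ m) / (1 - t))%:E)%E.
  elim: m => [|m IH].
    rewrite addr0 /L1dist; under eq_integral do rewrite subrr normr0.
    by rewrite integral0 expr0 subrr mulr0 mul0r.
  have -> : n + m.+1%:Z = n + m%:Z + 1 by rewrite -addn1 PoszD addrA.
  have h := le_trans (int_T_step (n + m%:Z) c r) (_ : _ <= (L * t ^+ m)%:E)%E.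
  apply: le_trans (L1dist_triangle mB (mT n) (mT _) (mT _) IH (h _)) _.
    by rewrite lee_fin; exact: hL.
  rewrite -EFinD lee_fin exprS le_eqVlt; apply/orP; left; apply/eqP.
  by field; rewrite gt_eqF.
apply/lee_addgt0Pr => e e0.
have [n0 hn0] := TR_avg_cvg c r0 lg e0.
(* [n] may be negative, whereas [TR_avg_cvg] speaks of natural levels: [m] is taken so large that
   [n + m] is a natural number at least [n0]. *)
have [m [k [km nk]]] : exists m k : nat, n + m%:Z = k%:Z /\ (n0 <= k)%N.
  exists (n0 + absz n)%N, (absz ((n : int) + (n0 + absz n)%N%:Z)).
  by clear; split; lia.
apply: (L1dist_triangle mB (mT n) (mT (n + m%:Z)) mg); last by rewrite km; exact: hn0.
apply: le_trans (step m) _; rewrite lee_fin ler_pM2r ?invr_gt0//.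
by rewrite ler_piMr// lerBlDr lerDl exprn_ge0.
Qed.

Lemma nbr_level k x l y : nbr dist S (k, x) (l, y) ->
  [/\ S k x, S l y, rad l <= 2 * rad k :> R, rad k <= 2 * rad l :> R & dist x y < rad k + rad l].
Proof.
move=> [Sx Sy _ [z [xz yz]] /= kl]; split => //.
- by have := @le_rad R (k - 1) l ltac:(lia); have := @radS R (k - 1); rewrite subrK => ->; lra.
- by have := @le_rad R (l - 1) k ltac:(lia); have := @radS R (l - 1); rewrite subrK => ->; lra.
- by have := dist_tri x z y; move: xz yz; rewrite /Bx /dball/= (distC z y) /rad; lra.
Qed.

(** The ball of [y] widened by [rad (n + m)] lies in that of radius 16 [rad k] about [x]: its center
    is within 3 [rad k], its radius is at most 2 [rad k], and the widening at most 8 [rad k] because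
    k <= n + 3. Dividing by the volume at [y] instead of [x] costs [dbl 8]. *)
Lemma avg_coarse n k x l y L t : S k x -> (l, y) = (k, x) \/ nbr dist S (k, x) (l, y) ->
  k <= n + 3 -> 0 <= L -> 0 <= t < 1 ->
  (forall m : nat, \sum_(v \in S (n + m%:Z) `&` ball x (16 * rad k))
      W (n + m%:Z) v * vol v (rad (n + m%:Z)) <= L * t ^+ m * vol x (rad k)) ->
  `|avg (fun z => T n z - g z) (l, y)| <= dbl 8 / (1 - t) * L.
Proof.
move=> Sx xy kn L0 t01 hL; have rk := @rad_gt0 R k; have rl := @rad_gt0 R l.
have [h1 h2 h3] : [/\ rad l <= 2 * rad k :> R, rad k <= 2 * rad l :> R & dist x y < rad k + rad l].
  by case: xy => [[-> ->]|/nbr_level[]//]; rewrite distxx; split; lra.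
have vy := vol_gt0 y rl; have vx := vol_gt0 x rk.
have t1 : 0 < 1 - t by case/andP: t01 => *; lra.
have lT : locally_integrable (T n) by exact: integrable_TR.
rewrite -(ler_pM2r vy) -lee_fin.
apply: le_trans (vol_avg_le _ _ (locally_integrableB lT lg)) _.
apply: le_trans (@int_T_tail n y (rad l) (L * vol x (rad k)) t rl _ t01 _) _.
- by rewrite mulr_ge0// ltW.
- move=> m; rewrite mulrAC; apply: le_trans (hL m).
  apply: ler_fsum_subset => [||v _]; first exact: finite_near; last first.
    by rewrite mulr_ge0// vol_ge0.
  apply: setIS; apply: subset_dball; rewrite distC.
  have : rad (n + m%:Z) <= 8 * rad k :> R.
    have -> : 8 * rad k = rad (k - 3%N%:Z) :> R by rewrite radBn -natrX.
    by apply: le_rad; clear -kn; lia.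
  lra.
- rewrite lee_fin (_ : _ * vol y _ = L * (dbl 8 * vol y (rad l)) / (1 - t)); last ring.
  rewrite ler_pM2r ?invr_gt0//; apply: ler_wpM2l => //; apply: vol_compare => //; lra.
Qed.

Lemma T_fine n z w y0 : S n y0 -> ball y0 (rad n) z -> ball y0 (rad n) w ->
  `|T n z - T n w| <= dbl 4 * dbl 6 * (`|C2| * (dist z w / rad n) * W n y0).
Proof.
move=> Sy yz yw; set A := S n `&` ball y0 (2 * rad n).
have fA : finite_set A by exact: finite_near.
have AS : A `<=` S n by exact: subIsetl.
have sub v : ball y0 (rad n) v -> S n `&` ball v (rad n) `<=` A.
  move=> yv; apply: setIS; apply: subset_dball; rewrite distC.
  by move: yv; rewrite /dball/= => ?; lra.
(* The weights [psi n x z - psi n x w] sum to zero, so [avg g (n, y0)] can be subtracted. *)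
have -> : T n z - T n w = \sum_(x \in A) (avg g (n, x) - avg g (n, y0)) * (psi n x z - psi n x w).
  have E v : ball y0 (rad n) v -> T n v - avg g (n, y0) =
      \sum_(x \in A) (avg g (n, x) - avg g (n, y0)) * psi n x v.
    by move=> yv; rewrite -(sum_psi_widen _ (sub v yv) AS) -/(TR _ _ _) TRB TR_cst.
  rewrite (_ : _ - _ = (T n z - avg g (n, y0)) - (T n w - avg g (n, y0))); last ring.
  rewrite !E// !fsbig_finite// -sumrB.
  by apply: eq_bigr => x _; rewrite mulrBr.
apply: le_trans (ler_norm_fsum _ fA) _.
apply: (@le_trans _ _ (\sum_(x \in A) (1 * (`|C2| * (dist z w / rad n) * W n y0)))).
  apply: ler_fsum => // x [Sx _]; rewrite mul1r normrM.
  (* If [psi n x] is nonzero at [z] or at [w], the ball of [x] meets that of [y0], so [x] is [y0] or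
     a neighbor of it; otherwise the term vanishes. *)
  have near v : ball y0 (rad n) v -> psi n x v != 0 -> `|avg g (n, x) - avg g (n, y0)| <= W n y0.
    move=> yv /(psi_supp Sx) vx; have [->|xy] := eqVneq x y0; first by rewrite subrr normr0.
    apply: W_nbr; apply: (@nbr_common _ _ _ _ v) => //.
    - by case=> /esym/eqP; apply/negP.
    - by rewrite subrr normr0.
    - by move: yv; rewrite /dball/= distC.
  have lip : `|psi n x z - psi n x w| <= `|C2| * (dist z w / rad n).
    case: psiP => _ _ _ /(_ n x z w Sx) h; apply: (le_trans h).
    rewrite -!mulrA; apply: (@le_trans _ _ (`|C2| * (2 ^ n * dist z w))).
      by rewrite ler_wpM2r ?ler_norm// mulr_ge0 ?dist_ge0// exprz_ge0.
    by rewrite -radN /rad opprK (mulrC (2 ^ n)).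
  have [hz|/(near _ yz) h] := eqVneq (psi n x z) 0; last by rewrite mulrC ler_pM.
  have [hw|/(near _ yw) h] := eqVneq (psi n x w) 0; last by rewrite mulrC ler_pM.
  rewrite hz hw subrr normr0 mulr0 !mulr_ge0// ?dist_ge0//.
  by rewrite invr_ge0 rad_ge0.
rewrite -mulr_fsuml; apply: ler_wpM2r.
  by rewrite !mulr_ge0// ?dist_ge0// invr_ge0 rad_ge0.
have := @card_near n y0 2 ltac:(lra); rewrite (_ : 3 * 2 = 6 :> R)//; lra.
Qed.

(** As [rad k] is at most a sixteenth of [rad n], the balls of [x] and [y] lie within 1/2 + 5/16 < 1
    times [rad n] of [y0], and two points of them are at most 1 + 3 + 2 = 6 times [rad k] apart. So
    [T_fine] bounds all differences of values, hence those of averages. *)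
Lemma avg_fine n k x l y y0 : nbr dist S (k, x) (l, y) -> n + 4 <= k ->
  S n y0 -> dist x y0 < rad n / 2 ->
  `|avg (T n) (l, y) - avg (T n) (k, x)| <=
    dbl 4 * dbl 6 * (`|C2| * 6) * (rad k / rad n * W n y0).
Proof.
move=> xy nk Sy0 xy0; have [Sx Sy h1 h2 h3] := nbr_level xy.
have rk := @rad_gt0 R k; have rn := @rad_gt0 R n.
have kn : 16 * rad k <= rad n :> R.
  have -> : 16 * rad k = rad (k - 4%N%:Z) :> R by rewrite radBn -natrX.
  by apply: le_rad; clear -nk; lia.
have lT : locally_integrable (T n) by exact: integrable_TR.
have xy0' : dist y0 x < rad n / 2 by rewrite distC.
apply: avg_near => // w yw; rewrite distrC; apply: avg_near => // z xz.
have zy : dist y0 z < rad n.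
  by have := dist_tri y0 x z; move: xz; rewrite /dball/=; lra.
have wy : dist y0 w < rad n.
  have := dist_tri y0 x w; have := dist_tri x y w; move: yw; rewrite /dball/=; lra.
have zw : dist z w <= 6 * rad k.
  have := dist_tri z x w; have := dist_tri x y w; move: yw xz; rewrite /dball/= (distC z x); lra.
apply: le_trans (T_fine Sy0 zy wy) _.
have d0 : 0 < dbl 4 * dbl 6 by rewrite mulr_gt0// dbl_gt0//; lra.
rewrite -[leRHS]mulrA; apply: ler_wpM2l; first exact: ltW.
rewrite (_ : `|C2| * 6 * _ = `|C2| * (6 * rad k / rad n) * W n y0); last by rewrite !mulrA.
apply: ler_wpM2r => //; apply: ler_wpM2l => //; apply: ler_wpM2r => //.
by rewrite invr_ge0 ltW.
Qed.

End Oscillation.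

(** * Complex values, neighbors and the discrete gradient *)

Local Notation normc := ComplexField.Normc.normc.
Local Notation Re := (@real_closed.complex.Re R).
Local Notation Im := (@real_closed.complex.Im R).

Lemma normc_ge0 (a : R[i]) : 0 <= normc a.
Proof. by case: a => a b; exact: sqrtr_ge0. Qed.

Lemma normcD_le (a b : R[i]) : normc (a + b) <= normc a + normc b.
Proof. exact: le_normcD. Qed.

Lemma normr_Re_le (a : R[i]) : `|Re a| <= normc a.
Proof.
case: a => a b /=; rewrite -sqrtr_sqr ler_sqrt ?lerDl ?sqr_ge0//.
by rewrite addr_ge0// sqr_ge0.
Qed.

Lemma normr_Im_le (a : R[i]) : `|Im a| <= normc a.
Proof.
case: a => a b /=; rewrite -sqrtr_sqr ler_sqrt ?lerDr ?sqr_ge0//.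
by rewrite addr_ge0// sqr_ge0.
Qed.

Lemma normc_le (a : R[i]) : normc a <= `|Re a| + `|Im a|.
Proof.
case: a => a b /=; rewrite -[leRHS]ger0_norm ?addr_ge0// -[leRHS]sqrtr_sqr ler_sqrt ?sqr_ge0//.
by rewrite sqrrD !real_normK ?num_real// lerD2r lerDl mulrn_wge0// mulr_ge0.
Qed.

Lemma ReB (a b : R[i]) : Re (a - b) = Re a - Re b.
Proof. by case: a b => [? ?] []. Qed.

Lemma ImB (a b : R[i]) : Im (a - b) = Im a - Im b.
Proof. by case: a b => [? ?] []. Qed.

Lemma Re_sum (I : Type) (s : seq I) (F : I -> R[i]) :
  Re (\sum_(x <- s) F x) = \sum_(x <- s) Re (F x).
Proof. by elim/big_rec2: _ => // x a b _ <-; case: (F x) b => [? ?] []. Qed.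

Lemma Im_sum (I : Type) (s : seq I) (F : I -> R[i]) :
  Im (\sum_(x <- s) F x) = \sum_(x <- s) Im (F x).
Proof. by elim/big_rec2: _ => // x a b _ <-; case: (F x) b => [? ?] []. Qed.

(** Neighbors occupy three levels, and on level [l] they lie within 6 [rad l] of the center; 18 = 3
    * 6 comes from [card_near]. *)
Definition nbr_bound : R := 3 * (dbl 4 * dbl 18).

Lemma nbr_bound_ge1 : 1 <= nbr_bound.
Proof.
have h4 := @dbl_ge1 4 ltac:(lra); have h18 := @dbl_ge1 18 ltac:(lra).
rewrite /nbr_bound; have := ler_pM ler01 ler01 h4 h18; rewrite mulr1; lra.
Qed.

Lemma ler_fsum1_setU (I : choiceType) (A B : set I) : finite_set A -> finite_set B ->
  \sum_(x \in A `|` B) (1 : R) <= \sum_(x \in A) (1 : R) + \sum_(x \in B) (1 : R).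
Proof.
move=> fA fB; rewrite [leLHS](fsbigID A) ?finite_setU//; apply: lerD.
  by apply: ler_fsum_subset => // x [].
by apply: ler_fsum_subset => // x [[]].
Qed.

Lemma nbr_count k x : finite_set (nbr dist S (k, x)) /\
  \sum_(y \in nbr dist S (k, x)) (1 : R) <= nbr_bound.
Proof.
pose A (l : int) : set (int * Z) := [set (l, y) | y in S l `&` ball x (6 * rad l)].
have fA l : finite_set (A l) by apply: finite_image; exact: finite_near.
have cA l : \sum_(y \in A l) (1 : R) <= dbl 4 * dbl 18.
  rewrite fsbig_image; last by move=> y y' _ _ [].
  by have := @card_near l x 6 ltac:(lra); rewrite (_ : 3 * 6 = 18 :> R) -?natrM.
have sub : nbr dist S (k, x) `<=` A (k - 1) `|` (A k `|` A (k + 1)).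
  move=> [l y] xy; have [Sx Sy h1 h2 h3] := nbr_level xy; have rk := @rad_gt0 R k.
  have Al : A l (l, y) by exists y => //; split => //; rewrite /dball/=; lra.
  have [<-|[<-|<-]]// : l = k - 1 \/ (l = k \/ l = k + 1).
    by case: xy => _ _ _ _ /=; clear; lia.
  - by left.
  - by right; left.
  - by right; right.
have fU : finite_set (A (k - 1) `|` (A k `|` A (k + 1))) by rewrite !finite_setU.
split; first exact: sub_finite_set fU.
apply: le_trans (ler_fsum_subset fU sub _) _ => //.
apply: le_trans (ler_fsum1_setU _ _) _; rewrite ?finite_setU//.
have := ler_fsum1_setU (fA k) (fA (k + 1)).
have := cA (k - 1); have := cA k; have := cA (k + 1); rewrite /nbr_bound; lra.
Qed.

Lemma duE (u : int * Z -> R[i]) k x : du dist S u (k, x) =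
  ((\sum_(y \in nbr dist S (k, x)) normc (u y - u (k, x)) ^+ 2) `^ 2^-1)%:E.
Proof.
have [fN _] := nbr_count k x.
rewrite /du esum_fset//; last by move=> y _; rewrite lee_fin sqr_ge0.
by rewrite -poweR_EFin -fsumEFin.
Qed.

Lemma du_fin_num u k x : du dist S u (k, x) \is a fin_num.
Proof. by rewrite duE. Qed.

Lemma fine_du_ge0 u k x : 0 <= fine (du dist S u (k, x)).
Proof. by rewrite duE/= powR_ge0. Qed.

Lemma powR_half_sqr (a : R) : 0 <= a -> (a ^+ 2) `^ 2^-1 = a.
Proof. by move=> a0; rewrite -powR_mulrn// -powRrM mulfV// powRr1. Qed.

Lemma normc_nbr_le_du u k x y : nbr dist S (k, x) y ->
  normc (u y - u (k, x)) <= fine (du dist S u (k, x)).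
Proof.
move=> xy; have [fN _] := nbr_count k x; rewrite duE /=.
rewrite -[leLHS]powR_half_sqr ?normc_ge0//; apply: ge0_ler_powR => //.
- by rewrite nnegrE sqr_ge0.
- by rewrite nnegrE; apply: fsumr_ge0 => z _; exact: sqr_ge0.
- by apply: (ler_fsum1 (F := fun y => normc (u y - u (k, x)) ^+ 2)) => // z _; exact: sqr_ge0.
Qed.

(** At most [nbr_bound] squares are summed, and this number, being at least 1, dominates its square
    root. *)
Lemma du_le u k x (L : R) : 0 <= L ->
  (forall y, nbr dist S (k, x) y -> normc (u y - u (k, x)) <= L) ->
  fine (du dist S u (k, x)) <= nbr_bound * L.
Proof.
move=> L0 uL; have [fN cN] := nbr_count k x; rewrite duE /=.
have N1 := nbr_bound_ge1; have N0 : 0 <= nbr_bound by lra.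
rewrite -(powR_half_sqr (mulr_ge0 N0 L0)); apply: ge0_ler_powR => //.
- by rewrite nnegrE; apply: fsumr_ge0 => z _; exact: sqr_ge0.
- by rewrite nnegrE sqr_ge0.
apply: (@le_trans _ _ (\sum_(y \in nbr dist S (k, x)) 1 * L ^+ 2)).
  by apply: ler_fsum => // y xy; rewrite mul1r ler_pXn2r ?nnegrE ?normc_ge0// uL.
rewrite -mulr_fsuml exprMn; apply: ler_wpM2r; first exact: sqr_ge0.
by apply: le_trans cN _; rewrite expr2 ler_peMl.
Qed.

(** * Pointwise bounds for the gradient of the error *)

Section ComplexFun.
Variable f : Z -> R[i].
Hypothesis L1f : L1loc dist mu f.

Lemma locally_integrable_Re : locally_integrable (fun z => Re (f z)).
Proof. by case: L1f => _ _ h _ c r; exact: h. Qed.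

Lemma locally_integrable_Im : locally_integrable (fun z => Im (f z)).
Proof. by case: L1f => _ _ _ h c r; exact: h. Qed.

Local Notation Pf := (Pav dist mu f).
Local Notation fn n := (Tn S psi n Pf).

Lemma Tn_near n z : fn n z = \sum_(x <- fset_set (S n `&` ball z (rad n))) Pf (n, x) * (psi n x z)%:C%C.
Proof.
rewrite -fsbig_finite; last exact: finite_near.
apply/esym/fsbig_widen => [x []//|x [Sx nB]] /=.
by rewrite psi_out ?mulr0// => h; apply: nB.
Qed.

Lemma Re_Tn n z : Re (fn n z) = TR n (fun x => avg (fun w => Re (f w)) (n, x)) z.
Proof.
rewrite Tn_near /TR (sum_psi_widen _ (@subset_refl _ _) (@subIsetl _ _ _)).
rewrite fsbig_finite; last exact: finite_near.
by rewrite Re_sum; apply: eq_bigr => x _ /=; rewrite mulr0 subr0.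
Qed.

Lemma Im_Tn n z : Im (fn n z) = TR n (fun x => avg (fun w => Im (f w)) (n, x)) z.
Proof.
rewrite Tn_near /TR (sum_psi_widen _ (@subset_refl _ _) (@subIsetl _ _ _)).
rewrite fsbig_finite; last exact: finite_near.
by rewrite Im_sum; apply: eq_bigr => x _ /=; rewrite mulr0 add0r.
Qed.

Definition Wdu (j : int) (x : Z) : R := fine (du dist S Pf (j, x)).

Lemma Wdu_ge0 j x : 0 <= Wdu j x.
Proof. exact: fine_du_ge0. Qed.

Lemma Wdu_Re j x l y : nbr dist S (j, x) (l, y) ->
  `|avg (fun w => Re (f w)) (l, y) - avg (fun w => Re (f w)) (j, x)| <= Wdu j x.
Proof.
move=> xy; apply: le_trans (normc_nbr_le_du Pf xy).
exact: (normr_Re_le (Pf (l, y) - Pf (j, x))).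
Qed.

Lemma Wdu_Im j x l y : nbr dist S (j, x) (l, y) ->
  `|avg (fun w => Im (f w)) (l, y) - avg (fun w => Im (f w)) (j, x)| <= Wdu j x.
Proof.
move=> xy; apply: le_trans (normc_nbr_le_du Pf xy).
exact: (normr_Im_le (Pf (l, y) - Pf (j, x))).
Qed.

Local Notation err n := (Pav dist mu (fun z => fn n z - f z)).

Lemma Re_err n l y : Re (err n (l, y)) =
  avg (fun z => TR n (fun x => avg (fun w => Re (f w)) (n, x)) z - Re (f z)) (l, y).
Proof. by rewrite /= /avgR; congr (_ * _); apply: eq_Rintegral => z _; rewrite ReB Re_Tn. Qed.

Lemma Im_err n l y : Im (err n (l, y)) =
  avg (fun z => TR n (fun x => avg (fun w => Im (f w)) (n, x)) z - Im (f z)) (l, y).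
Proof. by rewrite /= /avgR; congr (_ * _); apply: eq_Rintegral => z _; rewrite ImB Im_Tn. Qed.

Lemma err_eq n y : err n y = Pav dist mu (fn n) y - Pf y.
Proof.
case: y => l y; apply/eqP; rewrite eq_complex ReB ImB Re_err Im_err.
rewrite !avgB; do ?[exact: integrable_TR|exact: locally_integrable_Re|exact: locally_integrable_Im].
apply/andP; split; apply/eqP => /=; congr (_ - _); rewrite /avgR; congr (_ * _);
  apply: eq_Rintegral => z _; by rewrite ?Re_Tn ?Im_Tn.
Qed.

Lemma du_Tn_le n k x :
  fine (du dist S (Pav dist mu (fn n)) (k, x)) <=
    nbr_bound * (fine (du dist S (err n) (k, x)) + Wdu k x).
Proof.
apply: du_le => [|y xy]; first by rewrite addr_ge0// fine_du_ge0.
have E v : Pav dist mu (fn n) v = err n v + Pf v by rewrite err_eq subrK.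
rewrite !E opprD addrACA; apply: le_trans (normcD_le _ _) _.
by apply: lerD; exact: normc_nbr_le_du.
Qed.

(** No cancellation between the two averages is used: each is bounded by [avg_coarse]. The 4 counts
    two vertices, with a real and an imaginary part for each. *)
Lemma du_err_coarse n k x L t : S k x -> k <= n + 3 -> 0 <= L -> 0 <= t < 1 ->
  (forall m : nat, \sum_(v \in S (n + m%:Z) `&` ball x (16 * rad k))
      Wdu (n + m%:Z) v * vol v (rad (n + m%:Z)) <= L * t ^+ m * vol x (rad k)) ->
  fine (du dist S (err n) (k, x)) <= nbr_bound * (4 * (dbl 8 / (1 - t))) * L.
Proof.
move=> Sx kn L0 t01 hL; have t1 : 0 < 1 - t by case/andP: t01 => *; lra.
have d8 := @dbl_gt0 8 ltac:(lra).
have K0 : 0 <= dbl 8 / (1 - t) by rewrite divr_ge0// ltW.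
have B l y : (l, y) = (k, x) \/ nbr dist S (k, x) (l, y) ->
    normc (err n (l, y)) <= 2 * (dbl 8 / (1 - t) * L).
  move=> xy; apply: le_trans (normc_le _) _; rewrite Re_err Im_err.
  have := avg_coarse locally_integrable_Re Wdu_ge0 Wdu_Re Sx xy kn L0 t01 hL.
  have := avg_coarse locally_integrable_Im Wdu_ge0 Wdu_Im Sx xy kn L0 t01 hL.
  lra.
rewrite -mulrA; apply: du_le => [|[l y] xy]; first by do 2!apply: mulr_ge0 => //.
apply: le_trans (normcD_le _ _) _; rewrite normcN.
have := B l y (or_intror xy); have := B k x (or_introl erefl).
by move=> *; lra.
Qed.

(** Here T_n(Pf) and [f] are treated separately: the former gains [rad k / rad n] from its
    smoothness at scale [rad n], the latter contributes its own gradient at a level k > n, which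
    belongs to the tail of the norm. *)
Lemma du_err_fine n k x y0 : n + 4 <= k -> S n y0 -> dist x y0 < rad n / 2 ->
  fine (du dist S (err n) (k, x)) <=
    nbr_bound * (2 * (dbl 4 * dbl 6 * (`|C2| * 6)) * (rad k / rad n * Wdu n y0) + Wdu k x).
Proof.
move=> nk Sy0 xy0.
have d0 : 0 <= dbl 4 * dbl 6 * (`|C2| * 6).
  have d4 := @dbl_gt0 4 ltac:(lra); have d6 := @dbl_gt0 6 ltac:(lra).
  by apply: mulr_ge0; [apply: mulr_ge0; exact: ltW|exact: mulr_ge0].
have q0 : 0 <= rad k / rad n * Wdu n y0.
  by rewrite !mulr_ge0 ?Wdu_ge0 ?invr_ge0// rad_ge0.
apply: du_le => [|[l y] xy]; first by rewrite addr_ge0 ?Wdu_ge0// mulr_ge0// mulr_ge0.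
rewrite !err_eq opprD addrACA opprK; apply: le_trans (normcD_le _ _) _; apply: lerD.
  apply: le_trans (normc_le _) _; rewrite ReB ImB.
  have := avg_fine Wdu_ge0 Wdu_Re xy nk Sy0 xy0.
  have := avg_fine Wdu_ge0 Wdu_Im xy nk Sy0 xy0.
  have RE v : Re (Pav dist mu (fn n) v) = avg (TR n (fun x => avg (fun w => Re (f w)) (n, x))) v.
    by rewrite /= /avgR; congr (_ * _); apply: eq_Rintegral => z _; rewrite Re_Tn.
  have IE v : Im (Pav dist mu (fn n) v) = avg (TR n (fun x => avg (fun w => Im (f w)) (n, x))) v.
    by rewrite /= /avgR; congr (_ * _); apply: eq_Rintegral => z _; rewrite Im_Tn.
  rewrite !RE !IE => hI hR; apply: le_trans (lerD hR hI) _.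
  by rewrite -[leRHS]mulrA mulr_natl mulr2n.
rewrite -normcN opprD opprK; exact: (normc_nbr_le_du Pf xy).
Qed.

End ComplexFun.

(** * Weighted l^p norms over the nets *)

(* The level-[k] part of the norm of [I^s_{p,q}(X)], with the L^p norm over [Z] replaced by the
   l^p norm over the net [S k] weighted by the measures of the balls; [p = -oo] never occurs. *)
Definition lvl (p : \bar R) (k : int) (v : Z -> R) (L : R) : Prop :=
  match p with
  | r%:E => (\esum_(x in S k) (v x `^ r * vol x (rad k))%:E <= (L `^ r)%:E)%E
  | _ => forall x, S k x -> v x <= L
  end.

Lemma lvl_mono p k v w L L' : (0 < p)%E -> 0 <= L -> (forall x, S k x -> 0 <= v x <= w x) ->
  L <= L' -> lvl p k w L -> lvl p k v L'.
Proof.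
case: p => [r| |]//=; rewrite ?lte_fin => p0 L0 vw LL'.
  move=> h; apply: (@le_trans _ _ (\esum_(x in S k) (w x `^ r * vol x (rad k))%:E)%E).
    apply: le_esum => x /vw/andP[v0 vwx]; rewrite lee_fin ler_wpM2r ?vol_ge0//.
    by rewrite ge0_ler_powR// ?nnegrE ?(ltW p0)//; exact: le_trans vwx.
  apply: le_trans h _; rewrite lee_fin ge0_ler_powR// ?nnegrE ?(ltW p0)//.
  exact: le_trans LL'.
by move=> h x Sx; have /andP[_ vwx] := vw _ Sx; rewrite (le_trans vwx)// (le_trans (h _ Sx)).
Qed.

Lemma lvlZ p k c v L : (0 < p)%E -> 0 <= c -> 0 <= L -> (forall x, 0 <= v x) ->
  lvl p k v L -> lvl p k (fun x => c * v x) (c * L).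
Proof.
case: p => [r| |]//=; rewrite ?lte_fin => p0 c0 L0 v0 h; last first.
  by move=> x /h; exact: ler_wpM2l.
rewrite powRM// EFinM; under eq_esum do rewrite powRM// -mulrA EFinM.
apply: le_trans (esumZ_le _ (powR_ge0 _ _) _) _.
  by move=> x; rewrite lee_fin mulr_ge0 ?powR_ge0 ?vol_ge0.
by apply: lee_wpmul2l => //; rewrite lee_fin powR_ge0.
Qed.

Definition lvl_add_const (p : \bar R) : R :=
  match p with r%:E => 2 * 2 `^ r^-1 | _ => 2 end.

Lemma lvl_add_const_ge0 p : 0 <= lvl_add_const p.
Proof. by case: p => //= r; rewrite mulr_ge0 ?powR_ge0. Qed.

(** For every r > 0 one has (v + w)^r <= (2 max(v, w))^r <= 2^r (v^r + w^r); the two sums, each at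
    most L^r, account for the extra factor 2^(1/r). *)
Lemma lvlD p k v w L : (0 < p)%E -> 0 <= L -> (forall x, 0 <= v x) -> (forall x, 0 <= w x) ->
  lvl p k v L -> lvl p k w L -> lvl p k (fun x => v x + w x) (lvl_add_const p * L).
Proof.
case: p => [r| |]//=; rewrite ?lte_fin => p0 L0 v0 w0 hv hw; last first.
  by move=> x Sx; have := hv _ Sx; have := hw _ Sx; lra.
have L2 : (lvl_add_const r%:E * L) `^ r = 2 `^ r * (L `^ r + L `^ r).
  rewrite /= -mulrA powRM//; last by rewrite mulr_ge0 ?powR_ge0.
  rewrite powRM ?powR_ge0// -powRrM mulVf ?gt_eqF// powRr1//; congr (_ * _).
  by rewrite mulrDl mul1r.
rewrite L2 EFinM EFinD.
apply: (@le_trans _ _ (\esum_(x in S k) ((2 `^ r)%:E *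
    ((v x `^ r * vol x (rad k))%:E + (w x `^ r * vol x (rad k))%:E)))%E).
  apply: le_esum => x _; rewrite -EFinD -EFinM lee_fin -mulrDl mulrA.
  rewrite ler_wpM2r ?vol_ge0//.
  have r0' := ltW p0.
  wlog vw : v w v0 w0 hv hw / v x <= w x.
    move=> H; have [|] := leP (v x) (w x); first exact: H.
    by move=> /ltW; rewrite addrC [X in _ * X]addrC; exact: H.
  apply: (@le_trans _ _ ((2 * w x) `^ r)).
    by rewrite ge0_ler_powR ?nnegrE ?addr_ge0 ?mulr_ge0//; lra.
  rewrite powRM//; apply: ler_wpM2l; first exact: powR_ge0.
  by rewrite lerDr powR_ge0.
have e0 (u : Z -> R) x : (0 <= (u x `^ r * vol x (rad k))%:E)%E.
  by rewrite lee_fin mulr_ge0 ?powR_ge0 ?vol_ge0.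
apply: le_trans (esumZ_le _ (powR_ge0 _ _) _) _; first by move=> x; rewrite adde_ge0.
apply: lee_wpmul2l; first by rewrite lee_fin powR_ge0.
by rewrite esumD//; exact: leeD.
Qed.

(** A local averaging operator with kernel [w]: only its column sums over the points near [y],
    bounded by [N], enter the estimate. *)
Lemma lvl_average r k j rho (v : Z -> R) (u : Z -> R) (w : Z -> Z -> R) N L : 0 <= N ->
  (forall x y, 0 <= w x y) ->
  (forall x, S k x -> v x `^ r * vol x (rad k) <=
     \sum_(y \in S j `&` ball x rho) w x y * (u y `^ r * vol y (rad j))) ->
  (forall y, S j y -> \sum_(x \in S k `&` ball y rho) w x y <= N) ->
  lvl r%:E j u L ->
  (\esum_(x in S k) (v x `^ r * vol x (rad k))%:E <= (N * L `^ r)%:E)%E.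
Proof.
move=> N0 w0 hv hN hu.
apply: (@le_trans _ _ (N%:E * \esum_(y in S j) (u y `^ r * vol y (rad j))%:E)%E); last first.
  by rewrite EFinM; apply: lee_wpmul2l.
(* The kernel cut off at distance [rho] turns local finite sums into sums over the whole nets, as
   [lee_double_esum] asks. *)
pose w' x y := if y \in ball x rho then w x y else 0.
have w'0 x y : 0 <= w' x y by rewrite /w'; case: ifP.
have mc (A : set Z) (c : Z) (F : Z -> R) : finite_set (A `&` ball c rho) -> (forall y, 0 <= F y) ->
    (\esum_(y in A) (if y \in ball c rho then F y else 0)%:E = (\sum_(y \in A `&` ball c rho) F y)%:E)%E.
  move=> fA F0; rewrite -fsumEFin// -esum_fset//; last by move=> y _; rewrite lee_fin.
  by rewrite esum_mkcondr; apply: eq_esum => y _; case: ifP.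
apply: (@lee_double_esum _ _ _ _ _ _ _ w') => //.
- by move=> y; rewrite mulr_ge0 ?powR_ge0 ?vol_ge0.
- move=> x Sx; under eq_esum do rewrite /w' (fun_if ( *%R^~ _)) mul0r.
  rewrite mc ?lee_fin ?hv//; first exact: finite_near.
  by move=> y; rewrite !mulr_ge0 ?powR_ge0 ?vol_ge0.
- move=> y Sy; rewrite /w'.
  have E x : (y \in ball x rho) = (x \in ball y rho).
    by apply/idP/idP => /set_mem h; apply/mem_set; move: h; rewrite /dball/= distC.
  under eq_esum do rewrite E.
  by rewrite (mc (S k) y (w ^~ y))// ?lee_fin ?hN//; exact: finite_near.
Qed.

Lemma sum_vol_ball_le j c r (lam s : R) : 0 < r -> 1 <= lam -> 0 < s -> r + rad j <= lam * s ->
  \sum_(x \in S j `&` ball c r) vol x (rad j) <= dbl 4 * dbl lam * vol c s.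
Proof.
move=> r0 l1 s0 h; have rj := @rad_gt0 R j.
apply: le_trans (sum_vol_net (netS j).1 (finite_near j c r) (@subset_refl _ _) r0) _.
rewrite -mulrA ler_pM2l; last by apply: dbl_gt0; lra.
by apply: vol_compare => //; [exact: addr_gt0|rewrite distxx add0r].
Qed.

(** * Passage between levels in l^p *)

Definition root_const (p : \bar R) (N : R) : R :=
  match p with r%:E => N `^ r^-1 | _ => 1 end.

Lemma root_const_ge0 p N : 0 <= root_const p N.
Proof. by case: p => //= r; exact: powR_ge0. Qed.

Lemma powR_root (r N L : R) : 0 < r -> 0 <= N -> 0 <= L -> (N `^ r^-1 * L) `^ r = N * L `^ r.
Proof.
by move=> r0 N0 L0; rewrite powRM ?powR_ge0// -powRrM mulVf ?gt_eqF// powRr1.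
Qed.

(** A point [y] of level [n] is selected only by points [x] of level [k] within [rad n] of it, and
    their balls have total measure at most [dbl 4 * dbl 2] times that of the ball of [y]. *)
Lemma lvl_near p n k (W : Z -> R) (y0 : Z -> Z) L : (0 < p)%E -> n <= k -> 0 <= L ->
  (forall y, 0 <= W y) ->
  (forall x, S k x -> S n (y0 x) /\ dist x (y0 x) < rad n) ->
  lvl p n W L -> lvl p k (fun x => W (y0 x)) (root_const p (dbl 4 * dbl 2) * L).
Proof.
move=> + nk L0 W0 hy0; have rn := @rad_gt0 R n; have rk := @rad_gt0 R k.
have rkn : rad k <= rad n :> R by exact: le_rad.
have N0 : 0 <= dbl 4 * dbl 2 by rewrite mulr_ge0// ltW// dbl_gt0//; lra.
case: p => [r| |]//= p0 hW; last first.
  by move=> x /hy0[Sy _]; rewrite mul1r; exact: hW.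
rewrite lte_fin in p0; rewrite powR_root//.
apply: (@lvl_average r k n (rad n) _ W (fun x y => vol x (rad k) / vol y (rad n)) _ _ N0 _ _ _ hW).
- by move=> x y; rewrite divr_ge0 ?vol_ge0.
- move=> x /hy0[Sy xy].
  have Vn y : vol y (rad n) != 0 by rewrite gt_eqF// vol_gt0.
  apply: le_trans (ler_fsum1 (F := fun y => vol x (rad k) / vol y (rad n) * (W y `^ r * vol y (rad n)))
    (finite_near n x (rad n)) (conj Sy xy : (S n `&` ball x (rad n)) (y0 x)) _).
    by rewrite [X in _ <= _ * X]mulrC mulrA divfK// mulrC.
  by move=> y _; rewrite !mulr_ge0 ?invr_ge0 ?powR_ge0 ?vol_ge0.
- move=> y Sy; rewrite -mulr_fsuml ler_pdivrMr ?vol_gt0//.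
  by apply: sum_vol_ball_le => //; lra.
Qed.

(** Up to a bounded factor, the mean of the level-[j] values [W] over the ball of radius 16 [rad k]
    about [x]. Its numerator is the sum required by [du_err_coarse]. *)
Definition avg_ball (W : Z -> R) (j k : int) (x : Z) : R :=
  (\sum_(y \in S j `&` ball x (16 * rad k)) W y * vol y (rad j)) / vol x (rad k).

Lemma avg_ball_ge0 W j k x : (forall y, 0 <= W y) -> 0 <= avg_ball W j k x.
Proof.
move=> W0; rewrite /avg_ball divr_ge0 ?vol_ge0//; apply: fsumr_ge0 => y _.
by rewrite mulr_ge0 ?vol_ge0.
Qed.

Section AvgBall.
Variables (j k : int) (W : Z -> R).
Hypothesis kj : k <= j + 3.
Hypothesis W0 : forall y, 0 <= W y.

Let rj8 : rad j <= 8 * rad k :> R.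
Proof.
have -> : 8 * rad k = rad (k - 3%N%:Z) :> R by rewrite radBn -natrX.
by apply: le_rad; move: kj; clear; lia.
Qed.

Let c1 := dbl 4 * dbl 24.

Lemma avg_ball_weights x :
  \sum_(y \in S j `&` ball x (16 * rad k)) vol y (rad j) / vol x (rad k) <= c1.
Proof.
have rk := @rad_gt0 R k.
rewrite -mulr_fsuml ler_pdivrMr ?vol_gt0//; have h := rj8.
by apply: sum_vol_ball_le => //; [exact: mulr_gt0|lra|lra].
Qed.

Lemma avg_ballE x :
  avg_ball W j k x = \sum_(y \in S j `&` ball x (16 * rad k)) vol y (rad j) / vol x (rad k) * W y.
Proof.
by rewrite /avg_ball mulr_fsuml; apply: eq_fsbigr => y _; rewrite [RHS]mulrC mulrA.
Qed.

Lemma avg_ball_le x L : 0 <= L -> (forall y, S j y -> W y <= L) -> avg_ball W j k x <= c1 * L.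
Proof.
move=> L0 WL; rewrite avg_ballE.
apply: le_trans (ler_wpM2r L0 (avg_ball_weights x)); rewrite mulr_fsuml.
apply: ler_fsum => [|y [Sy _]]; first exact: finite_near.
by apply: ler_wpM2l; [rewrite divr_ge0 ?vol_ge0|exact: WL].
Qed.

Lemma avg_ball_powR_ge1 r x : 1 <= r ->
  avg_ball W j k x `^ r * vol x (rad k) <=
    \sum_(y \in S j `&` ball x (16 * rad k)) (c1 + 1) `^ r * (W y `^ r * vol y (rad j)).
Proof.
move=> r1; have vx := vol_gt0 x (@rad_gt0 R k); rewrite avg_ballE.
have fA := finite_near j x (16 * rad k).
have := powR_fsum_ge1_le fA _ _ r1 (avg_ball_weights x) (a := W).
move=> /(_ _ _)/(ler_wpM2r (ltW vx)) h; apply: le_trans (h _ _) _ => //.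
  by move=> y _; rewrite divr_ge0 ?vol_ge0.
rewrite -[leRHS]mulr_fsumr -[leLHS]mulrA; apply: ler_wpM2l; first exact: powR_ge0.
rewrite mulr_fsuml; apply: ler_fsum => // y _.
by rewrite mulrAC divfK ?gt_eqF// mulrC.
Qed.

(** Subadditivity of the r-th power leaves (vol y / vol x)^r vol x = vol y^r vol x^(1 - r), and
    doubling replaces vol x^(1 - r) by vol y^(1 - r). This is where [Q] enters. The 136 is generous:
    the ball of [x] is within 17 [rad k] of [y]. *)
Lemma avg_ball_powR_le1 r x : 0 < r -> r <= 1 ->
  avg_ball W j k x `^ r * vol x (rad k) <=
    \sum_(y \in S j `&` ball x (16 * rad k))
      (dbl (136 * (rad k / rad j))) `^ (1 - r) * (W y `^ r * vol y (rad j)).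
Proof.
move=> r0' r1; have vx := vol_gt0 x (@rad_gt0 R k); rewrite avg_ballE.
have rk' := @rad_gt0 R k; have rj := @rad_gt0 R j.
have fA := finite_near j x (16 * rad k).
have w0 y : 0 <= vol y (rad j) / vol x (rad k) by rewrite divr_ge0 ?vol_ge0.
apply: le_trans (ler_wpM2r (ltW vx) (powR_fsum_le fA _ r0' r1)) _.
  by move=> y _; rewrite mulr_ge0.
rewrite mulr_fsuml; apply: ler_fsum => // y [Sy xy].
have vy := vol_gt0 y rj.
rewrite powRM// mulrAC mulrC [leRHS]mulrCA; apply: ler_wpM2l; first exact: powR_ge0.
have l1 : 1 <= 136 * (rad k / rad j) :> R.
  by rewrite mulrA ler_pdivlMr// mul1r; move: rj8; lra.
have vxy : vol x (rad k) <= dbl (136 * (rad k / rad j)) * vol y (rad j).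
  apply: vol_compare => //; rewrite -mulrA divfK ?gt_eqF//.
  by move: xy; rewrite /dball/=; lra.
have E : (vol y (rad j) / vol x (rad k)) `^ r * vol x (rad k) =
    vol y (rad j) `^ r * vol x (rad k) `^ (1 - r).
  rewrite powRM ?invr_ge0 ?(ltW vx) ?(ltW vy)// -mulrA; congr (_ * _).
  rewrite -powR_inv1 ?(ltW vx)// -powRrM mulN1r -[X in _ * X]powRr1 ?(ltW vx)//.
  by rewrite -powRD 1?addrC//; apply/implyP => _; rewrite gt_eqF.
have d0 : 0 <= dbl (136 * (rad k / rad j)) by rewrite ltW// dbl_gt0.
have vy1 : vol y (rad j) = vol y (rad j) `^ r * vol y (rad j) `^ (1 - r).
  rewrite -powRD; first by rewrite addrC subrK powRr1// ltW.
  by apply/implyP => _; rewrite gt_eqF.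
rewrite E [in leRHS]vy1 [in leRHS]mulrCA; apply: ler_wpM2l; first by rewrite powR_ge0.
rewrite -powRM ?(ltW vy)//; apply: ge0_ler_powR; rewrite ?nnegrE ?subr_ge0 ?(ltW vx)//.
by rewrite mulr_ge0 ?(ltW vy).
Qed.

End AvgBall.

(** * The cost of averaging in l^p as a power of 2 *)

Lemma rad_powR k s : rad k `^ s = 2 `^ (- (k%:~R * s)) :> R.
Proof. by rewrite /rad -powR_intmul// -powRrM intrN mulNr. Qed.

Lemma radE k : rad k = 2 `^ (- k%:~R) :> R.
Proof. by rewrite -[LHS]powRr1 ?rad_ge0// rad_powR mulr1. Qed.

Lemma pow2D (a b : R) : 2 `^ (a + b) = 2 `^ a * 2 `^ b :> R.
Proof. by rewrite powRD//; apply/implyP. Qed.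

Lemma ler_pow2 (a b : R) : a <= b -> 2 `^ a <= 2 `^ b :> R.
Proof. by move=> ab; rewrite ler_powR// ler1n. Qed.

Lemma rad_div k j : rad k / rad j = 2 `^ ((j - k)%:~R) :> R.
Proof. by rewrite -radB radE -intrN opprB. Qed.

(** For r <= 1 it is the exponent of 2^(j - k) in the r-th root of the doubling factor
    [dbl (136 * (rad k / rad j))] raised to the power 1 - r. *)
Definition avg_exponent (p : \bar R) : R :=
  match p with r%:E => if r <= 1 then Q * (r^-1 - 1) else 0 | _ => 0 end.

Definition avg_const (p : \bar R) : R :=
  match p with
  | r%:E => (dbl 4 * dbl 48) `^ r^-1 *
            (if r <= 1 then dbl 136 `^ (r^-1 - 1) else dbl 4 * dbl 24 + 1)
  | _ => dbl 4 * dbl 24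
  end.

Lemma dbl_ge0 lam : 0 <= dbl lam.
Proof. by rewrite /dbl mulr_ge0 ?powR_ge0// (le_trans ler01). Qed.

Lemma avg_const_ge0 p : 0 <= avg_const p.
Proof.
have d := dbl_ge0; case: p => [r| |]/=; try by rewrite mulr_ge0.
apply: mulr_ge0; first exact: powR_ge0.
by case: ifP => _; [exact: powR_ge0|rewrite addr_ge0// mulr_ge0].
Qed.

(** The kernel is a constant in both cases, so its column sums only count the points of level [k]
    within 16 [rad k] of a given one; 48 = 3 * 16. *)
Lemma lvl_avg_ball p j k W L : (0 < p)%E -> k <= j + 3 -> (forall y, 0 <= W y) -> 0 <= L ->
  lvl p j W L ->
  lvl p k (avg_ball W j k) (avg_const p * 2 `^ (avg_exponent p * (j - k)%:~R) * L).
Proof.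
move=> + kj W0 L0; case: p => [r| |]//= p0 hW; last first.
  by move=> x Sx; rewrite mul0r powRr0 mulr1; exact: avg_ball_le.
rewrite lte_fin in p0.
have N0 : 0 <= dbl 4 * dbl 48 by rewrite mulr_ge0 ?dbl_ge0.
have key D : 0 <= D -> (forall x, avg_ball W j k x `^ r * vol x (rad k) <=
    \sum_(y \in S j `&` ball x (16 * rad k)) D * (W y `^ r * vol y (rad j))) ->
    (\esum_(x in S k) (avg_ball W j k x `^ r * vol x (rad k))%:E <=
     (dbl 4 * dbl 48 * D * L `^ r)%:E)%E.
  move=> D0 h; apply: (@lvl_average r k j (16 * rad k) _ W (fun _ _ => D)) hW => //.
  - by rewrite mulr_ge0.
  - move=> y Sy; rewrite (eq_fsbigr (fun=> 1 * D)); last by move=> x _; rewrite mul1r.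
    rewrite -mulr_fsuml; apply: ler_wpM2r => //.
    have := @card_near k y 16 ltac:(lra); by rewrite (_ : 3 * 16 = 48 :> R)// -natrM.
case: (leP r 1) => r1.
- apply: le_trans (key _ (powR_ge0 _ _) (fun x => avg_ball_powR_le1 kj W0 x p0 r1)) _.
  move: N0 {key}; move: (dbl 4 * dbl 48) => N N0.
  set A := dbl 136 `^ _; set B := 2 `^ _.
  have A0 : 0 <= A by exact: powR_ge0.
  have B0 : 0 <= B by exact: powR_ge0.
  have BL0 : 0 <= B * L by exact: mulr_ge0.
  have d136 := dbl_ge0 136.
  have -> : N `^ r^-1 * A * B * L = N `^ r^-1 * (A * (B * L)) by rewrite mulrA mulrA.
  rewrite lee_fin powR_root//; last exact: mulr_ge0.
  rewrite -mulrA; apply: ler_wpM2l => //; rewrite powRM// (powRM _ B0 L0) [leRHS]mulrA.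
  apply: ler_wpM2r; first exact: powR_ge0.
  have -> : dbl (136 * (rad k / rad j)) = dbl 136 * 2 `^ (Q * (j - k)%:~R).
    rewrite rad_div /dbl powRM ?powR_ge0// mulrA; congr (_ * _).
    by rewrite -powRrM mulrC.
  rewrite (powRM _ d136 (powR_ge0 _ _)) /A /B -!powRrM le_eqVlt; apply/orP; left; apply/eqP.
  have E : (r^-1 - 1) * r = 1 - r by rewrite mulrBl mulVf ?gt_eqF// mul1r.
  by congr (_ `^ _ * _ `^ _) => //; rewrite -E; ring.
- have c0 : 0 <= dbl 4 * dbl 24 + 1 by rewrite addr_ge0// mulr_ge0 ?dbl_ge0.
  apply: le_trans (key _ (powR_ge0 _ _) (fun x => avg_ball_powR_ge1 kj W0 x (ltW r1))) _.
  move: N0 c0 {key}; move: (dbl 4 * dbl 48) (dbl 4 * dbl 24 + 1) => N X N0 X0.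
  rewrite lee_fin mul0r powRr0 mulr1 -[leLHS]mulrA.
  have -> : N `^ r^-1 * X * L = N `^ r^-1 * (X * L) by rewrite mulrA.
  by rewrite (powR_root p0 N0 (mulr_ge0 X0 L0)) powRM.
Qed.

Lemma esum_geometric (t : R) : 0 <= t < 1 ->
  (\esum_(m in [set: nat]) (t ^+ m)%:E <= ((1 - t)^-1)%:E)%E.
Proof.
move=> /andP[t0 t1]; have t1' : 0 < 1 - t by rewrite subr_gt0.
apply: esum_le_ub => X fX _.
have [n Xn] : exists n, X `<=` `I_n.
  have [X' ->] := finite_fsetP.1 fX; exists (\max_(i <- X') i).+1 => i /= iX.
  by rewrite ltnS; apply: leq_bigmax_seq.
rewrite fsumEFin// lee_fin; apply: (@le_trans _ _ (\sum_(m \in `I_n) t ^+ m)).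
  by apply: ler_fsum_subset => // m _; exact: exprn_ge0.
rewrite -fsbig_ord -[leRHS]mul1r ler_pdivlMr// mulrC.
have -> : (1 - t) * \sum_(i < n) t ^+ i = 1 - t ^+ n.
  by rewrite -[RHS]opprB subrX1 -mulNr opprB.
by rewrite gerBl exprn_ge0.
Qed.

Definition geom_const (p : \bar R) (t : R) : R :=
  match p with r%:E => ((1 - t `^ r)^-1) `^ r^-1 | _ => 1 end.

(* [v] is dominated by the supremum over [m] of [h m / t ^+ m]; in l^r this supremum is at most
   the corresponding sum, which costs only a geometric series. *)
Lemma lvl_geometric_sup p k t K L (h : nat -> Z -> R) (v : Z -> R) :
  (0 < p)%E -> 0 < t < 1 -> 0 < K -> 0 <= L ->
  (forall m x, 0 <= h m x) -> (forall x, 0 <= v x) ->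
  (forall x c, S k x -> 0 <= c -> (forall m, h m x <= c * t ^+ m) -> v x <= K * c) ->
  (forall m, lvl p k (h m) (L * (t ^+ 2) ^+ m)) ->
  lvl p k v (geom_const p t * (K * L)).
Proof.
move=> + /andP[t0 t1] K0 L0 h0 v0; case: p => [r| |]//= p0 hv hh; last first.
  move=> x Sx; rewrite mul1r; apply: hv => // m; apply: le_trans (hh m x Sx) _.
  rewrite ler_wpM2l// -exprM mulnC exprM expr2 ler_piMl ?exprn_ge0 ?(ltW t0)//.
  by rewrite exprn_ile1 ?(ltW t0) ?(ltW t1).
rewrite lte_fin in p0; have rn0 : r != 0 by rewrite gt_eqF.
have tr0 : 0 < t `^ r by exact: powR_gt0.
have tr1 : t `^ r < 1.
  have := @gt0_ltr_powR R r p0 t 1; rewrite !nnegrE ltW// ler01 powR1; exact.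
have q0 : 0 <= (1 - t `^ r)^-1 by rewrite invr_ge0 subr_ge0 ltW.
have tX m : (t ^+ m) `^ r = (t `^ r) ^+ m.
  elim: m => [|m IH]; first by rewrite !expr0 powR1.
  by rewrite !exprS powRM ?exprn_ge0 ?(ltW t0)// IH.
have tm m : 0 < t ^+ m by exact: exprn_gt0.
rewrite powR_root ?mulr_ge0 ?(ltW K0)//.
(* The r-th power of K h_m / t^m, weighted by the volume. *)
pose b x m := K `^ r / (t `^ r) ^+ m * (h m x `^ r * vol x (rad k)).
have b0 x m : 0 <= b x m.
  by rewrite mulr_ge0 ?divr_ge0 ?mulr_ge0 ?powR_ge0 ?vol_ge0 ?exprn_ge0 ?powR_ge0.
apply: (@le_trans _ _ (\esum_(x in S k) \esum_(m in [set: nat]) (b x m)%:E)%E).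
  apply: le_esum => x Sx; have vx := vol_gt0 x (@rad_gt0 R k).
  have : (0 <= \esum_(m in [set: nat]) (b x m)%:E)%E by apply: esum_ge0 => m _; rewrite lee_fin.
  have lb m := @le_esum1 R _ [set: nat] (fun m => (b x m)%:E) m I.
  case: (\esum_(m in _) _)%E lb => [B lb B0|_ _|//]; last by rewrite leey.
  rewrite lee_fin in B0.
  have D0 : 0 < K `^ r * vol x (rad k) by rewrite mulr_gt0// powR_gt0.
  have BD : 0 <= B / (K `^ r * vol x (rad k)) by rewrite divr_ge0// ltW.
  (* With [B] the sum of all [b x m], this [c] is the least one that a bound b x m <= B allows in h
     m x <= c t^m. *)
  have := hv x ((B / (K `^ r * vol x (rad k))) `^ r^-1) Sx (powR_ge0 _ _).
  have hm m : h m x <= (B / (K `^ r * vol x (rad k))) `^ r^-1 * t ^+ m.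
    rewrite -[leLHS](@powRr1 R _ (h0 m x)) -(mulfV rn0) powRrM.
    rewrite -[X in _ * X](@powRr1 R _ (ltW (tm m))) -[X in _ * _ `^ X](mulfV rn0) powRrM.
    rewrite -powRM ?powR_ge0// tX; apply: ge0_ler_powR.
    - by rewrite invr_ge0 ltW.
    - by rewrite nnegrE powR_ge0.
    - by rewrite nnegrE mulr_ge0// exprn_ge0// ltW.
    - rewrite mulrAC ler_pdivlMr// -ler_pdivrMr ?exprn_gt0//.
      have := lb m; rewrite lee_fin /b; apply: le_trans; rewrite le_eqVlt; apply/orP; left; apply/eqP.
      by field; rewrite gt_eqF// exprn_gt0.
  move=> /(_ hm) vK; rewrite lee_fin.
  apply: (@le_trans _ _ ((K * (B / (K `^ r * vol x (rad k))) `^ r^-1) `^ r * vol x (rad k))).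
    apply: ler_wpM2r; first exact: ltW.
    by apply: ge0_ler_powR; rewrite ?nnegrE ?(ltW p0) ?mulr_ge0 ?powR_ge0 ?(ltW K0)//.
  rewrite mulrC (mulrC K) powR_root ?(ltW K0)//= le_eqVlt; apply/orP; left; apply/eqP.
  by field; rewrite !gt_eqF// powR_gt0.
rewrite exchange_esum; last by move=> x m; rewrite lee_fin.
(* Of the two factors t^m in the hypothesis, one is spent in the division by t^m and the other
   leaves a convergent series. *)
apply: (@le_trans _ _ (\esum_(m in [set: nat]) (((K * L) `^ r)%:E * ((t `^ r) ^+ m)%:E))%E).
  apply: le_esum => m _; rewrite /b; under eq_esum do rewrite EFinM.
  apply: le_trans (esumZ_le _ _ _) _.
  - by rewrite divr_ge0 ?powR_ge0// exprn_ge0// ltW.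
  - by move=> x; rewrite lee_fin mulr_ge0 ?powR_ge0 ?vol_ge0.
  apply: (@le_trans _ _ ((K `^ r / (t `^ r) ^+ m)%:E * ((L * (t ^+ 2) ^+ m) `^ r)%:E)%E).
    by apply: lee_wpmul2l; [rewrite lee_fin divr_ge0 ?powR_ge0// exprn_ge0// ltW|exact: hh].
  rewrite -!EFinM lee_fin -exprM mulnC exprM powRM ?exprn_ge0 ?(ltW t0)// ?(ltW (tm m))//.
  rewrite expr2 powRM ?(ltW (tm m))// tX powRM ?(ltW K0)// le_eqVlt; apply/orP; left; apply/eqP.
  by field; rewrite gt_eqF// exprn_gt0.
apply: le_trans (esumZ_le _ (powR_ge0 _ _) _) _; first by move=> m; rewrite lee_fin exprn_ge0// ltW.
rewrite [in leRHS]mulrC [in leRHS]EFinM; apply: lee_wpmul2l; first by rewrite lee_fin powR_ge0.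
by apply: esum_geometric; rewrite ltW.
Qed.

(** * Level-by-level estimate of the error *)

Definition decay (d : R) (m : int) : R := 2 `^ (- (d * (`|m|)%:~R)).

Lemma decay_gt0 d m : 0 < decay d m.
Proof. exact: powR_gt0. Qed.

Lemma decay0 d : decay d 0 = 1.
Proof. by rewrite /decay normr0 mulr0 oppr0 powRr0. Qed.

Lemma le_decay d m (a M : R) : decay d m * a <= M -> a <= 2 `^ (d * (`|m|)%:~R) * M.
Proof.
move=> h; rewrite -(ler_pM2l (decay_gt0 d m)); apply: le_trans h _.
by rewrite mulrA /decay -pow2D addNr powRr0 mul1r.
Qed.

(** Exponent count for [coarse_level], where [X], [Y], [U], [V] are |j - k|, n - k, m = j - n and
    k. *)
Lemma coarse_exponent_le (e s d b X Y U V : R) : e = s - b - d ->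
  d * X <= d * (Y + U + 6) -> b * -3 <= b * Y ->
  e * (Y + U) - (Y + U + V) * s + d * X <= 3 * b + 6 * d - V * s - b * U.
Proof. by move=> -> h1 h2; lra. Qed.

Section ErrorLevels.
Variables (s : R) (p : \bar R).
Hypothesis s01 : 0 < s < 1.
Hypothesis ps : ((Q / (Q + s))%:E < p)%E.

Lemma p_gt0 : (0 < p)%E.
Proof.
have /andP[s0 _] := s01; apply: lt_trans ps; rewrite lte_fin divr_gt0// addr_gt0//.
Qed.

(** For r <= 1, Q (1/r - 1) < s amounts to Q < r (Q + s), the lower bound imposed on p. *)
Lemma avg_exponent_lt : 0 <= avg_exponent p < s.
Proof.
have /andP[s0 s1] := s01; move: ps; case: p => [r| |]//= h; rewrite ?lexx ?s0//.
case: ifP => r1; last by rewrite lexx s0.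
have Qs : 0 < Q + s by rewrite addr_gt0.
rewrite lte_fin in h; have r0' : 0 < r by apply: lt_trans h; rewrite divr_gt0.
rewrite mulr_ge0 ?(ltW Q_gt0) ?subr_ge0 ?invf_ge1//=.
rewrite ltr_pdivrMr// in h.
rewrite mulrBr mulr1 ltrBlDr ltr_pdivrMr// mulrC addrC; exact: h.
Qed.

(** At least half of the gap [s - avg_exponent p] is kept (as [b] below) for the geometric sum over
    levels; [1 - s] is the margin that the Lipschitz gain leaves at the fine levels. *)
Definition decay_rate : R := Num.min ((s - avg_exponent p) / 2) (1 - s).

Lemma decay_rate_gt0 : 0 < decay_rate.
Proof.
have /andP[s0 s1] := s01; have /andP[e0 es] := avg_exponent_lt.
by rewrite /decay_rate lt_min divr_gt0 ?subr_gt0.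
Qed.

Lemma decay_rate_le1 : decay_rate <= 1 - s.
Proof. by rewrite /decay_rate ge_min lexx orbT. Qed.

Let d := decay_rate.
Let b := s - avg_exponent p - d.

Let b_gt0 : 0 < b.
Proof.
have h : d <= (s - avg_exponent p) / 2 by rewrite /d /decay_rate ge_min lexx.
by have /andP[e0 es] := avg_exponent_lt; rewrite /b; lra.
Qed.

(** The square root of 2^(-b), because [lvl_geometric_sup] asks for decay like the powers of t^2. *)
Let t : R := 2 `^ (- (b / 2)).

Let t01 : 0 < t < 1.
Proof.
rewrite powR_gt0//= -(powRr0 2) /t.
have [h|] := ltP (2 `^ (- (b / 2))) (2 `^ 0 : R); first by [].
rewrite powRr0 powRN -[leLHS]invr1 lef_pV2 ?posrE ?powR_gt0// => h.
have : 2 `^ 0 < 2 `^ (b / 2) :> R.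
  by rewrite /powR gt_eqF// ltr_expR mul0r mulr_gt0 ?divr_gt0// ln_gt0// ltr1n.
by rewrite powRr0 ltNge h.
Qed.

Let t2X m : (t ^+ 2) ^+ m = 2 `^ (- (b * m%:R)) :> R.
Proof.
rewrite -exprM -powR_mulrn ?powR_ge0// /t -powRrM; congr (_ `^ _).
by rewrite natrM; field.
Qed.

Definition coarse_const : R :=
  geom_const p t * (nbr_bound * (4 * (dbl 8 / (1 - t)))) * (avg_const p * 2 `^ (3 * b + 6 * d)).

Definition fine_const : R := nbr_bound *
  (lvl_add_const p * Num.max 1 (2 * (dbl 4 * dbl 6 * (`|C2| * 6)) * root_const p (dbl 4 * dbl 2))).

Definition err_const : R := Num.max coarse_const fine_const.

(** [A j] bounds the level-[j] norm of |d(Pf)| normalised by 2^(j s), and [M] bounds the supremum of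
    the decayed [A j]. Averaging from level j = n + m costs 2^(e (j - k)) and the decay at most 2^(d
    |j - k|), against the gain 2^(- s (j - k)); 2^(- b m) remains for the supremum over [m]. *)
Lemma coarse_level (f : Z -> R[i]) (n k : int) (A : int -> R) (M : R) : L1loc dist mu f ->
  k <= n + 3 -> (forall j, 0 <= A j) -> 0 <= M ->
  (forall j, n <= j -> lvl p j (Wdu f j) (rad j `^ s * A j)) ->
  (forall j, n <= j -> decay d (j - k) * A j <= M) ->
  lvl p k (fun x => fine (du dist S (Pav dist mu (fun z => Tn S psi n (Pav dist mu f) z - f z)) (k, x)))
    (coarse_const * (rad k `^ s * M)).
Proof.
move=> L1f kn A0 M0 hA hM; have /andP[t0 t1] := t01.
have d8 : 0 < dbl 8 by apply: dbl_gt0; lra.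
have nb : 0 < nbr_bound by apply: lt_le_trans nbr_bound_ge1.
have K0 : 0 < nbr_bound * (4 * (dbl 8 / (1 - t))).
  by rewrite mulr_gt0// mulr_gt0// divr_gt0// subr_gt0.
have -> : coarse_const * (rad k `^ s * M) =
  geom_const p t * ((nbr_bound * (4 * (dbl 8 / (1 - t)))) *
     ((avg_const p * 2 `^ (3 * b + 6 * d)) * (rad k `^ s * M))).
  by rewrite /coarse_const !mulrA.
apply: (@lvl_geometric_sup p k t _ _ (fun m => avg_ball (Wdu f (n + m%:Z)) (n + m%:Z) k)) => //.
- exact: p_gt0.
- by apply: mulr_ge0; apply: mulr_ge0; rewrite ?powR_ge0 ?avg_const_ge0.
- by move=> m x; apply: avg_ball_ge0 => y; exact: Wdu_ge0.
- by move=> x; exact: fine_du_ge0.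
- move=> x c Sx c0 h; have := @du_err_coarse f L1f n k x c t Sx kn c0.
  apply; first by rewrite ltW.
  by move=> m; rewrite -ler_pdivrMr; [exact: h|exact/vol_gt0/rad_gt0].
move=> m; set j := n + m%:Z.
have nj : n <= j by rewrite /j lerDl.
have kj : k <= j + 3 by apply: le_trans kn _; rewrite lerD2r.
have L0 : 0 <= rad j `^ s * A j by rewrite mulr_ge0 ?powR_ge0.
apply: lvl_mono (lvl_avg_ball p_gt0 kj (Wdu_ge0 f j) L0 (hA j nj)); first exact: p_gt0.
- by rewrite mulr_ge0// mulr_ge0 ?powR_ge0 ?avg_const_ge0.
- by move=> x _; rewrite lexx andbT; apply: avg_ball_ge0; exact: Wdu_ge0.
rewrite t2X -!mulrA; apply: ler_wpM2l; first exact: avg_const_ge0.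
have AM := le_decay (hM j nj).
apply: (@le_trans _ _ (2 `^ (avg_exponent p * (j - k)%:~R) * (rad j `^ s *
    (2 `^ (d * `|j - k|%:~R) * M)))).
  by do 2!(apply: ler_wpM2l; first exact: powR_ge0).
rewrite !rad_powR !mulrA [leRHS](_ : _ = 2 `^ (3 * b + 6 * d) * 2 `^ (- (k%:~R * s)) * 2 `^ (- (b * m%:R)) * M); last by ring.
apply: ler_wpM2r => //; rewrite -!pow2D; apply: ler_pow2.
have jk : (j - k)%:~R = (n - k)%:~R + m%:R :> R.
  by rewrite /j addrAC rmorphD.
(* The coarse range k <= n + 3 gives n - k >= -3, hence j - k >= -3, so dropping the absolute value
   costs at most 6: these are the 3 b and 6 d of [coarse_const]. *)
have nk3 : -3 <= (n - k)%:~R :> R.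
  have h : -3 <= n - k by move: kn; clear; lia.
  by have : (-3)%:~R <= (n - k)%:~R :> R by rewrite ler_int.
have abs : `|j - k|%:~R <= (j - k)%:~R + 6 :> R.
  have h : `|j - k| <= (j - k) + 6 by move: kj; clear; lia.
  by move: h; rewrite -(ler_int R) [in X in _ <= X -> _]rmorphD/=.
have d0 : 0 <= d by rewrite ltW// decay_rate_gt0.
have jE : j%:~R = (j - k)%:~R + k%:~R :> R by rewrite -rmorphD subrK.
have h1 := ler_wpM2l d0 abs.
have h2 := ler_wpM2l (ltW b_gt0) nk3.
rewrite jE jk in h1 *.
by apply: coarse_exponent_le h1 h2; rewrite /b; ring.
Qed.

(** The Lipschitz gain 2^(n - k) outweighs both the change of weight 2^(s (k - n)) and the decay
    2^(d (k - n)), as d <= 1 - s. The gradient of [f] itself is the case j = k, with decay factor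
    1. *)
Lemma fine_level (f : Z -> R[i]) (n k : int) (A : int -> R) (M : R) : L1loc dist mu f ->
  n + 4 <= k -> (forall j, 0 <= A j) -> 0 <= M ->
  (forall j, n <= j -> lvl p j (Wdu f j) (rad j `^ s * A j)) ->
  (forall j, n <= j -> decay d (j - k) * A j <= M) ->
  lvl p k (fun x => fine (du dist S (Pav dist mu (fun z => Tn S psi n (Pav dist mu f) z - f z)) (k, x)))
    (fine_const * (rad k `^ s * M)).
Proof.
move=> L1f nk A0 M0 hA hM.
have nk' : n <= k by move: nk; clear; lia.
(* A chosen net point of level [n] close to [x]; the default [x] is never taken, by
   [maximal_net_cover]. *)
pose y0 x := xget x [set y | S n y /\ dist x y < rad n / 2].
have hy0 x : S n (y0 x) /\ dist x (y0 x) < rad n / 2.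
  by rewrite /y0; case: xgetP => // /(_ _) h; have [y Sy xy] := maximal_net_cover x (netS n); case: (h y).
have c0 : 0 <= 2 * (dbl 4 * dbl 6 * (`|C2| * 6)).
  by apply: mulr_ge0 => //; apply: mulr_ge0; apply: mulr_ge0; rewrite ?dbl_ge0.
set c := 2 * _ in c0; set Rc := root_const p (dbl 4 * dbl 2).
have Rc0 : 0 <= Rc by exact: root_const_ge0.
set L := rad k `^ s * M; have L0 : 0 <= L by rewrite mulr_ge0 ?powR_ge0.
have rho0 : 0 <= rad k / rad n :> R by rewrite divr_ge0 ?rad_ge0.
have m1 : 0 <= Num.max 1 (c * Rc) by rewrite le_max ler01.
have W1 : lvl p k (fun x => c * (rad k / rad n * Wdu f n (y0 x))) (Num.max 1 (c * Rc) * L).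
  apply: (@lvl_mono _ _ _ (fun x => c * (rad k / rad n * Wdu f n (y0 x))) (c * (rad k / rad n * (Rc * (rad n `^ s * A n)))) _).
  - exact: p_gt0.
  - by rewrite mulr_ge0// mulr_ge0// mulr_ge0// mulr_ge0 ?powR_ge0.
  - by move=> x _; rewrite lexx andbT mulr_ge0// mulr_ge0// Wdu_ge0.
  - have -> : c * (rad k / rad n * (Rc * (rad n `^ s * A n))) =
        c * Rc * (rad k / rad n * (rad n `^ s * A n)) by ring.
    apply: (@le_trans _ _ (c * Rc * L)); last by apply: ler_wpM2r => //; rewrite le_max lexx orbT.
    apply: ler_wpM2l; first exact: mulr_ge0.
    have AM := le_decay (hM n (lexx n)).
    apply: (@le_trans _ _ (rad k / rad n * (rad n `^ s * (2 `^ (d * `|n - k|%:~R) * M)))).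
      by apply: ler_wpM2l => //; apply: ler_wpM2l => //; exact: powR_ge0.
    rewrite rad_div !rad_powR /L rad_powR !mulrA; apply: ler_wpM2r => //.
    rewrite -!pow2D; apply: ler_pow2.
    rewrite distrC ger0_norm ?subr_ge0// !rmorphB/=.
    have kn : 0 <= k%:~R - n%:~R :> R by rewrite -rmorphB/= ler0z subr_ge0.
    have := ler_wpM2r kn decay_rate_le1; rewrite -/d; move: (k%:~R) (n%:~R) => X Y.
    by nra.
  - apply: lvlZ => //; [exact: p_gt0|by rewrite mulr_ge0// mulr_ge0// mulr_ge0 ?powR_ge0| |].
      by move=> x; rewrite mulr_ge0// Wdu_ge0.
    apply: lvlZ => //; [exact: p_gt0|by rewrite mulr_ge0// mulr_ge0 ?powR_ge0| |].
      by move=> x; exact: Wdu_ge0.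
    apply: (@lvl_near p n k) => //; [exact: p_gt0|by rewrite mulr_ge0 ?powR_ge0|exact: Wdu_ge0| |exact: hA].
    move=> x _; have [? xy] := hy0 x; split => //; have := @rad_gt0 R n; lra.
have W2 : lvl p k (Wdu f k) (Num.max 1 (c * Rc) * L).
  apply: lvl_mono (hA k nk').
  - exact: p_gt0.
  - by rewrite mulr_ge0 ?powR_ge0.
  - by move=> x _; rewrite lexx Wdu_ge0.
  - have := hM k nk'; rewrite subrr decay0 mul1r => AM.
    apply: (@le_trans _ _ (1 * L)); last by apply: ler_wpM2r => //; rewrite le_max lexx.
    by rewrite mul1r; apply: ler_wpM2l => //; exact: powR_ge0.
have nb : 0 <= nbr_bound by apply: le_trans nbr_bound_ge1.
have W3 := lvlD p_gt0 (mulr_ge0 m1 L0) (fun x => mulr_ge0 c0 (mulr_ge0 rho0 (Wdu_ge0 f n (y0 x))))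
  (Wdu_ge0 f k) W1 W2.
have a0 := lvl_add_const_ge0 p.
have := lvlZ p_gt0 nb (mulr_ge0 a0 (mulr_ge0 m1 L0)) _ W3.
have pos x : 0 <= c * (rad k / rad n * Wdu f n (y0 x)) + Wdu f k x.
  by rewrite addr_ge0 ?Wdu_ge0// mulr_ge0// mulr_ge0// Wdu_ge0.
move=> /(_ pos) W4; apply: lvl_mono W4.
- exact: p_gt0.
- by rewrite mulr_ge0// mulr_ge0// mulr_ge0.
- move=> x Sx; rewrite fine_du_ge0/=; have [Sy xy] := hy0 x; exact: du_err_fine.
- by rewrite /fine_const -/c -/Rc !mulrA.
Qed.

Lemma err_const_ge0 : 0 <= err_const.
Proof.
rewrite le_max; apply/orP; right; apply: mulr_ge0; first exact: le_trans nbr_bound_ge1.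
by apply: mulr_ge0; [exact: lvl_add_const_ge0|rewrite le_max ler01].
Qed.

Lemma err_level (f : Z -> R[i]) (n k : int) (A : int -> R) (M : R) : L1loc dist mu f ->
  (forall j, 0 <= A j) -> 0 <= M ->
  (forall j, n <= j -> lvl p j (Wdu f j) (rad j `^ s * A j)) ->
  (forall j, n <= j -> decay d (j - k) * A j <= M) ->
  lvl p k (fun x => fine (du dist S (Pav dist mu (fun z => Tn S psi n (Pav dist mu f) z - f z)) (k, x)))
    (err_const * (rad k `^ s * M)).
Proof.
move=> L1f A0 M0 hA hM; have L0 : 0 <= rad k `^ s * M by rewrite mulr_ge0 ?powR_ge0.
have pos x (u : int * Z -> R[i]) : S k x ->
    0 <= fine (du dist S u (k, x)) <= fine (du dist S u (k, x)).
  by move=> _; rewrite lexx fine_du_ge0.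
have [kn|nk] := leP k (n + 3).
  have h := coarse_level L1f kn A0 M0 hA hM.
  have c0 : 0 <= coarse_const.
    have /andP[t0 t1] := t01; rewrite /coarse_const; apply: mulr_ge0; apply: mulr_ge0.
    - by case: (p) => //= r; exact: powR_ge0.
    - apply: mulr_ge0; first exact: le_trans nbr_bound_ge1.
      by rewrite mulr_ge0// divr_ge0 ?dbl_ge0// subr_ge0 ltW.
    - exact: avg_const_ge0.
    - exact: powR_ge0.
  apply: lvl_mono h; [exact: p_gt0|exact: mulr_ge0|by move=> x Sx; exact: pos|].
  by apply: ler_wpM2r => //; rewrite le_max lexx.
have nk4 : n + 4 <= k by move: nk; clear; lia.
have h := fine_level L1f nk4 A0 M0 hA hM.
have c0 : 0 <= fine_const.
  apply: mulr_ge0; first exact: le_trans nbr_bound_ge1.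
  by apply: mulr_ge0; [exact: lvl_add_const_ge0|rewrite le_max ler01].
apply: lvl_mono h; [exact: p_gt0|exact: mulr_ge0|by move=> x Sx; exact: pos|].
by apply: ler_wpM2r => //; rewrite le_max lexx orbT.
Qed.

End ErrorLevels.

(** * Comparison of L^p norms with norms over the nets *)

Section LevelNorm.
Variables (k : int) (u : int * Z -> \bar R) (v : Z -> R).
Hypothesis uv : forall x, S k x -> u (k, x) = (v x)%:E.
Hypothesis v0 : forall x, 0 <= v x.

Let near z := S k `&` ball z (rad k).

Let esum_near (F : Z -> R) z : (forall x, 0 <= F x) ->
  (\esum_(x in S k) (F x * \1_(ball x (rad k)) z)%:E = (\sum_(x \in near z) F x)%:E)%E.
Proof.
move=> F0; have fA := finite_near k z (rad k).
rewrite -fsumEFin// -esum_fset//; last by move=> x _; rewrite lee_fin.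
rewrite esum_mkcondr; apply: eq_esum => x _; rewrite indicE.
have -> : (z \in ball x (rad k)) = (x \in ball z (rad k)).
  by apply/idP/idP => /set_mem h; apply/mem_set; move: h; rewrite /dball/= distC.
by case: ifP => _; rewrite ?mulr1 ?mulr0.
Qed.

Definition near_sum (w : Z -> R) z : R := \sum_(x \in S k `&` ball z (rad k)) w x.

Lemma levelfunE z : levelfun dist S u k z = (near_sum v z)%:E.
Proof.
rewrite -esum_near//; apply: eq_esum => x Sx.
by rewrite uv// gee0_abs ?lee_fin// EFinM.
Qed.

Lemma near_sum_ge0 w z : (forall x, 0 <= w x) -> 0 <= near_sum w z.
Proof. by move=> w0; apply: fsumr_ge0. Qed.

Let mterm (F : Z -> R) x : measurable_fun setT (fun z => (F x * \1_(ball x (rad k)) z)%:E).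
Proof.
apply/measurable_EFinP/measurable_funM => //.
exact/measurable_indic/measurable_dball.
Qed.

Lemma measurable_near_sum w : (forall x, 0 <= w x) ->
  measurable_fun setT (fun z => (near_sum w z)%:E).
Proof.
move=> w0; rewrite (_ : (fun _ => _) = fun z => (\esum_(x in S k) (w x * \1_(ball x (rad k)) z)%:E)%E).
  apply: emeasurable_esum => //; first exact: countable_net (netS k).1.
  by move=> x z; rewrite lee_fin mulr_ge0.
by apply/funext => z; rewrite esum_near.
Qed.

Lemma integral_near_sum w : (forall x, 0 <= w x) ->
  (\int[mu]_z (near_sum w z)%:E = \esum_(x in S k) (w x * vol x (rad k))%:E)%E.
Proof.
move=> w0; under eq_integral do rewrite /near_sum -esum_near//.
rewrite integral_esum//.
- apply: eq_esum => x _; under eq_integral do rewrite EFinM.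
  have mi : measurable_fun setT (fun z => (\1_(ball x (rad k)) z)%:E : \bar R).
    by apply/measurable_EFinP; exact/measurable_indic/measurable_dball.
  rewrite ge0_integralZl ?lee_fin//.
  rewrite integral_indic//; last exact: measurable_dball.
  by rewrite setIT volE ?rad_gt0// EFinM.
- exact: countable_net (netS k).1.
- by move=> x z; rewrite lee_fin mulr_ge0.
Qed.

Definition overlap : R := dbl 4 * dbl 3.

Lemma overlap_ge0 : 0 <= overlap.
Proof. by rewrite mulr_ge0 ?dbl_ge0. Qed.

Lemma card_overlap z : \sum_(x \in S k `&` ball z (rad k)) (1 : R) <= overlap.
Proof. by have := @card_near k z 1 (lexx _); rewrite mulr1 mul1r. Qed.

Definition upper_const (r : R) : R := if r <= 1 then 1 else (overlap + 1) `^ r.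

Lemma upper_const_ge0 r : 0 <= upper_const r.
Proof. by rewrite /upper_const; case: ifP => // _; exact: powR_ge0. Qed.

(** At most [overlap] terms are present, so a power of the sum and the sum of powers are comparable;
    this and [near_sum_powR_ge] transfer the norms in the two directions. *)
Lemma near_sum_powR_le r z : 0 < r ->
  near_sum v z `^ r <= upper_const r * near_sum (fun x => v x `^ r) z.
Proof.
move=> r0; have fA := finite_near k z (rad k); rewrite /upper_const; case: (leP r 1) => r1.
  by rewrite mul1r; exact: powR_fsum_le.
have := powR_fsum_ge1_le fA (w := fun=> 1) (a := v) _ _ (ltW r1) (card_overlap z).
rewrite /near_sum; under [X in X `^ r]eq_fsbigr do rewrite mul1r.
by under [X in _ -> _ -> _ <= _ * X]eq_fsbigr do rewrite mul1r; apply.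
Qed.

Lemma near_sum_powR_ge r z : 0 < r ->
  near_sum (fun x => v x `^ r) z <= overlap * near_sum v z `^ r.
Proof.
move=> r0; have fA := finite_near k z (rad k).
apply: le_trans (ler_wpM2r (powR_ge0 _ _) (card_overlap z)).
rewrite mulr_fsuml; apply: ler_fsum => // x Ax; rewrite mul1r.
apply: ge0_ler_powR; rewrite ?nnegrE ?(ltW r0) ?near_sum_ge0//.
exact: ler_fsum1.
Qed.

Definition norm_upper (p : \bar R) : R :=
  match p with r%:E => upper_const r `^ r^-1 | _ => overlap end.

Definition norm_lower (p : \bar R) : R :=
  match p with r%:E => overlap `^ r^-1 | _ => 1 end.

Lemma norm_upper_ge0 p : 0 <= norm_upper p.
Proof. by case: p => [r| |]/=; rewrite ?powR_ge0 ?overlap_ge0. Qed.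

Lemma norm_lower_ge0 p : 0 <= norm_lower p.
Proof. by case: p => [r| |]/=; rewrite ?powR_ge0. Qed.

Let abs_levelfun z : `|levelfun dist S u k z|%E = (near_sum v z)%:E.
Proof. by rewrite levelfunE gee0_abs// lee_fin near_sum_ge0. Qed.

Let measurable_near_sum_powR r : measurable_fun setT (fun z => ((near_sum v z) `^ r)%:E).
Proof.
under eq_fun do rewrite -poweR_EFin.
by apply: (measurableT_comp (measurable_poweR r)); exact: measurable_near_sum.
Qed.

Lemma Lnorm_levelfun_le p L : (0 < p)%E -> 0 <= L -> lvl p k v L ->
  (Lnorm mu p (levelfun dist S u k) <= (norm_upper p * L)%:E)%E.
Proof.
case: p => [r| |]//; rewrite ?lte_fin => p0 L0 hv; rewrite unlock.
  under eq_integral do rewrite abs_levelfun poweR_EFin.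
  have h : (\int[mu]_z (near_sum v z `^ r)%:E <= (upper_const r * L `^ r)%:E)%E.
    apply: (@le_trans _ _ (\int[mu]_z ((upper_const r)%:E * (near_sum (fun x => v x `^ r) z)%:E))%E).
      apply: ge0_le_integral => //.
      - by move=> z _; rewrite lee_fin powR_ge0.
      - by apply: measurable_funeM; apply: measurable_near_sum => x; exact: powR_ge0.
      - by move=> z _; rewrite -EFinM lee_fin near_sum_powR_le.
    rewrite ge0_integralZl//; last 3 first.
    - by apply: measurable_near_sum => x; exact: powR_ge0.
    - by move=> z _; rewrite lee_fin near_sum_ge0// => x; exact: powR_ge0.
    - by rewrite lee_fin upper_const_ge0.
    rewrite integral_near_sum; last by move=> x; exact: powR_ge0.
    by rewrite EFinM; apply: lee_wpmul2l; rewrite ?lee_fin ?upper_const_ge0.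
  apply: (@le_trans _ _ ((upper_const r * L `^ r)%:E `^ r^-1)%E).
    apply: gt0_ler_poweR => //; rewrite ?invr_ge0 ?(ltW p0)//.
    - by rewrite in_itv/= leey andbT; apply: integral_ge0 => z _; rewrite lee_fin powR_ge0.
    - by rewrite in_itv/= leey andbT lee_fin mulr_ge0 ?powR_ge0 ?upper_const_ge0.
  rewrite poweR_EFin lee_fin powRM ?powR_ge0 ?upper_const_ge0// -powRrM divff ?gt_eqF// powRr1//.
(* At p = +oo the norm is an essential supremum if the whole space has positive measure, and 0 by
   default. *)
case: ifP => _; last by rewrite lee_fin mulr_ge0 ?overlap_ge0.
apply/ess_supP; apply: aeW => z /=; rewrite abs_levelfun lee_fin.
apply: le_trans (ler_wpM2r L0 (card_overlap z)); rewrite mulr_fsuml.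
by apply: ler_fsum => [|x [Sx _]]; [exact: finite_near|rewrite mul1r; exact: hv].
Qed.

(** For finite p, integration turns [near_sum] into the weighted sum over the net. For p = +oo an
    almost everywhere bound holds at every vertex, since [v x] is a lower bound on all of the ball
    of [x], which has positive measure. *)
Lemma lvl_Lnorm p a : (0 < p)%E -> 0 <= a ->
  (Lnorm mu p (levelfun dist S u k) <= a%:E)%E -> lvl p k v (norm_lower p * a).
Proof.
case: p => [r| |]//; rewrite ?lte_fin => p0 a0; rewrite unlock.
  under eq_integral do rewrite abs_levelfun poweR_EFin.
  set J := (\int[mu]_z _)%E => h.
  have J0 : (0 <= J)%E by apply: integral_ge0 => z _; rewrite lee_fin powR_ge0.
  have {}h : (J <= (a `^ r)%:E)%E.
    have : ((J `^ r^-1) `^ r <= a%:E `^ r)%E.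
      by apply: gt0_ler_poweR; rewrite ?(ltW p0)// in_itv/= leey andbT ?poweR_ge0.
    by rewrite -poweRrM mulVf ?gt_eqF// poweRe1// poweR_EFin.
  rewrite /lvl/= powR_root ?overlap_ge0// -integral_near_sum; last by move=> x; exact: powR_ge0.
  rewrite EFinM; apply: le_trans (lee_wpmul2l _ h); last by rewrite lee_fin overlap_ge0.
  rewrite -ge0_integralZl//; last 2 first.
  - by move=> z _; rewrite lee_fin powR_ge0.
  - by rewrite lee_fin overlap_ge0.
  apply: ge0_le_integral => //.
  - by move=> z _; rewrite lee_fin near_sum_ge0// => x; exact: powR_ge0.
  - by apply: measurable_near_sum => x; exact: powR_ge0.
  - by apply: measurable_funeM; exact: measurable_near_sum_powR.
  - by move=> z _; rewrite -EFinM lee_fin near_sum_powR_ge.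
have mB x := measurable_dball x (rad k).
have Bpos x : (0 < mu (ball x (rad k)))%E by rewrite volE ?rad_gt0// lte_fin vol_gt0// rad_gt0.
case: ifPn => [_ /ess_supP h x Sx|/negP nT _ x Sx]; last first.
  exfalso; apply: nT; apply: lt_le_trans (Bpos x) _; apply: le_measure; rewrite ?inE//.
rewrite mul1r leNgt; apply/negP => ax.
have : mu.-negligible (ball x (rad k)).
  apply: negligibleS h => z xz /=; rewrite abs_levelfun lee_fin; apply/negP; rewrite -ltNge.
  apply: lt_le_trans ax _; apply: ler_fsum1 => //; first exact: finite_near.
  by split => //; move: xz; rewrite /dball/= distC.
move=> /(negligibleP _ (mB x)) B0; have := Bpos x; by rewrite B0 ltxx.
Qed.

End LevelNorm.

(** * Schur test over the levels *)

Lemma decay_powR d q m : decay d m `^ q = (2 `^ (- (d * q))) ^+ absz m.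
Proof.
rewrite -[RHS]powR_mulrn; last exact: powR_ge0.
rewrite /decay -[LHS]powRrM -[RHS]powRrM; congr (_ `^ _).
have -> : (`|m|)%:~R = (absz m)%:R :> R by rewrite -abszE.
ring.
Qed.

(** Two geometric series, one for each sign of the level difference. *)
Definition schur_const (d q : R) : R := 2 / (1 - 2 `^ (- (d * q))).

Lemma pow2N_lt1 (x : R) : 0 < x -> 0 <= (2 : R) `^ (- x) < 1.
Proof.
move=> x0; rewrite powR_ge0/= powRN invf_lt1 ?powR_gt0//.
by rewrite /powR gt_eqF// -[ltLHS]expR0 ltr_expR mulr_gt0// ln_gt0// ltr1n.
Qed.

Lemma esum_decay_le d q j : 0 < d -> 0 < q ->
  (\esum_(k in [set: int]) (decay d (j - k) `^ q)%:E <= (schur_const d q)%:E)%E.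
Proof.
move=> d0 q0; have t01 := pow2N_lt1 (mulr_gt0 d0 q0); have /andP[t0 t1] := t01.
under eq_esum do rewrite decay_powR; set t := 2 `^ _ in t0 t1 t01 *.
have tX m : (0 <= (t ^+ m)%:E)%E by rewrite lee_fin exprn_ge0.
rewrite -(@reindex_esum R _ _ [set: int] [set: int] (fun k => j - k) (fun m => (t ^+ absz m)%:E)); last first.
  split=> // [k k' _ _ /addrI/oppr_inj//|m _].
  by exists (j - m) => //; rewrite opprB addrC subrK.
(* [Negz n] is -(n + 1), so the negative half is dominated term by term by the same series. *)
rewrite (esumID [set Posz n | n in [set: nat]])//.
rewrite [schur_const _ _](_ : _ = (1 - t)^-1 + (1 - t)^-1); last by rewrite /schur_const mulrDl mul1r.
rewrite EFinD; apply: leeD.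
  rewrite setTI (@esum_image R _ _ [set: nat] Posz (fun m => (t ^+ absz m)%:E)); last by move=> m n _ _ [].
  exact: esum_geometric.
rewrite (_ : _ `&` _ = [set Negz n | n in [set: nat]]); last first.
  apply/seteqP; split => [[n [_ h]|n _]|_ [n _ <-]].
  - by exfalso; apply: h; exists n.
  - by exists n.
  - by split => // -[].
rewrite (@esum_image R _ _ [set: nat] Negz (fun m => (t ^+ absz m)%:E)); last by move=> m n _ _ [].
apply: le_trans (esum_geometric t01); apply: le_esum => n _.
by rewrite lee_fin /= exprS ler_piMl ?exprn_ge0// ltW.
Qed.

Lemma schur_const_ge0 d q : 0 < d -> 0 < q -> 0 <= schur_const d q.
Proof.
move=> d0 q0; have /andP[t0 t1] := pow2N_lt1 (mulr_gt0 d0 q0).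
by rewrite divr_ge0// subr_ge0 ltW.
Qed.

(** For fixed [k], the best [M] is the supremum of the decayed [A j]. It is replaced by their l^q
    sum, which dominates it for every q > 0; exchanging the sums then leaves the summable kernel
    [decay]. *)
Lemma schur_lq d q K (J : set int) (A : int -> R) (a : int -> \bar R) :
  0 < d -> 0 < q -> 0 < K -> (forall j, 0 <= A j) -> (forall k, 0 <= a k)%E ->
  (forall k M, 0 <= M -> (forall j, J j -> decay d (j - k) * A j <= M) -> (a k <= (K * M)%:E)%E) ->
  (\esum_(k in [set: int]) (a k `^ q) <=
    (K `^ q * schur_const d q)%:E * \esum_(j in J) (A j `^ q)%:E)%E.
Proof.
move=> d0 q0 K0 A0 a0 ha; have qn0 : q != 0 by rewrite gt_eqF.
have Kq : 0 < K `^ q by exact: powR_gt0.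
apply: (@lee_double_esum R _ _ _ _ _ _ (fun k j => K `^ q * decay d (j - k) `^ q)).
- by rewrite mulr_ge0 ?powR_ge0 ?schur_const_ge0.
- by move=> k j; rewrite mulr_ge0 ?powR_ge0.
- by move=> j; exact: powR_ge0.
- move=> k _.
  have b0 j : 0 <= K `^ q * decay d (j - k) `^ q * A j `^ q by rewrite !mulr_ge0 ?powR_ge0.
  have : (0 <= \esum_(j in J) (K `^ q * decay d (j - k) `^ q * A j `^ q)%:E)%E.
    by apply: esum_ge0 => j _; rewrite lee_fin.
  have lb j := @le_esum1 R _ J (fun j => (K `^ q * decay d (j - k) `^ q * A j `^ q)%:E) j.
  case: (\esum_(j in _) _)%E lb => [B lb B0|_ _|//]; last by rewrite leey.
  rewrite lee_fin in B0; have BK : 0 <= B / K `^ q by rewrite divr_ge0// ltW.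
  have hM j : J j -> decay d (j - k) * A j <= (B / K `^ q) `^ q^-1.
    move=> Jj; have dA : 0 <= decay d (j - k) * A j by rewrite mulr_ge0// ltW// decay_gt0.
    rewrite -[leLHS]powRr1// -(mulfV qn0) powRrM; apply: ge0_ler_powR.
    - by rewrite invr_ge0 ltW.
    - by rewrite nnegrE powR_ge0.
    - by rewrite nnegrE.
    - rewrite ler_pdivlMr// powRM// ?(ltW (decay_gt0 _ _))// mulrC mulrA -lee_fin; exact: lb.
  have h := ha k _ (powR_ge0 _ _) hM.
  apply: (@le_trans _ _ ((K * (B / K `^ q) `^ q^-1)%:E `^ q)%E).
    apply: gt0_ler_poweR => //; rewrite ?(ltW q0)// in_itv/= leey andbT//.
    by rewrite lee_fin mulr_ge0 ?powR_ge0// ltW.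
  by rewrite poweR_EFin lee_fin (mulrC K) powR_root ?(ltW K0)// divfK// gt_eqF.
- move=> j _; under eq_esum do rewrite EFinM.
  apply: le_trans (esumZ_le _ (powR_ge0 _ _) _) _; first by move=> k; rewrite lee_fin powR_ge0.
  rewrite EFinM; apply: lee_wpmul2l; first by rewrite lee_fin powR_ge0.
  exact: esum_decay_le.
Qed.

(** Up to [e] the sum is carried by a finite set [X]. A tail beyond [X] is disjoint from it, so a
    tail larger than [e] would make the total exceed itself. *)
Lemma esum_tail_cvg0 (c : int -> R) (e : R) : (forall j, 0 <= c j) -> 0 < e ->
  (\esum_(j in [set: int]) (c j)%:E < +oo)%E ->
  exists n0 : nat, forall n : nat, (n0 <= n)%N ->
    (\esum_(j in [set j : int | (n%:Z <= j)%R]) (c j)%:E <= e%:E)%E.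
Proof.
move=> c0 e0 fin; set T := \esum_(j in _) _ in fin.
have c0' j : (0 <= (c j)%:E)%E by rewrite lee_fin.
have T0 : (0 <= T)%E by apply: esum_ge0 => j _.
have Tf : T \is a fin_num by rewrite ge0_fin_numE.
have [_ [X [fX _] <-] hX] := ub_ereal_sup_adherent e0 Tf.
have [n0 Xn0] : exists n0 : nat, forall j, X j -> j < n0%:Z.
  have [X' XE] := finite_fsetP.1 fX.
  exists (\max_(j <- X') absz j).+1 => j; rewrite XE /= => jX.
  have aux (i : int) (N : nat) : (absz i <= N)%N -> i < N.+1%:Z by clear; lia.
  by apply: aux; exact: leq_bigmax_seq.
exists n0 => n n0n; rewrite leNgt; apply/negP => lt.
have : (T - e%:E + e%:E < T)%E.
  apply: (@lt_le_trans _ _ (\sum_(x \in X) (c x)%:E + \esum_(j in [set j : int | (n%:Z <= j)%R]) (c j)%:E)%E).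
    by apply: lteD.
  rewrite -esum_fset//; rewrite /T (esumID X [set: int])//; apply: leeD.
    by apply: le_esum_subset.
  apply: le_esum_subset => j /= nj; split => // Xj; have := Xn0 j Xj.
  by move: nj n0n; clear; lia.
by rewrite subeK// ltxx.
Qed.

(** * Levels of the Besov norm *)

Section BesovLevels.
Variables (s : R) (p : \bar R).
Hypothesis s01 : 0 < s < 1.
Hypothesis ps : ((Q / (Q + s))%:E < p)%E.

Definition besov_level (f : Z -> R[i]) (k : int) : \bar R :=
  ((2 `^ (k%:~R * s))%:E * Lnorm mu p (levelfun dist S (du dist S (Pav dist mu f)) k))%E.

Let p0 : (0 < p)%E := p_gt0 s01 ps.

Lemma besov_level_ge0 f k : (0 <= besov_level f k)%E.
Proof. by rewrite mule_ge0 ?lee_fin ?powR_ge0// Lnorm_ge0. Qed.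

Lemma duW f k x : S k x -> du dist S (Pav dist mu f) (k, x) = (Wdu f k x)%:E.
Proof. by move=> _; rewrite /Wdu fineK// du_fin_num. Qed.

Lemma rad_pow2 k : rad k `^ s * 2 `^ (k%:~R * s) = 1 :> R.
Proof. by rewrite rad_powR -pow2D addNr powRr0. Qed.

Lemma lvl_besov_level f k : (besov_level f k < +oo)%E ->
  lvl p k (Wdu f k) (rad k `^ s * (norm_lower p * fine (besov_level f k))).
Proof.
move=> h; have g0 : 0 < 2 `^ (k%:~R * s) :> R by exact: powR_gt0.
rewrite mulrCA; apply: (lvl_Lnorm (@duW f k) (Wdu_ge0 f k)) => //.
  by rewrite mulr_ge0 ?powR_ge0// fine_ge0// besov_level_ge0.
move: h; rewrite /besov_level; have := Lnorm_ge0 mu p (levelfun dist S (du dist S (Pav dist mu f)) k).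
case: (Lnorm _ _ _) => [l l0 _| _|//]; last by rewrite gt0_muley.
by rewrite /= mulrA rad_pow2 mul1r.
Qed.

Lemma besov_level_le f k c M : 0 <= c -> 0 <= M -> lvl p k (Wdu f k) (c * (rad k `^ s * M)) ->
  (besov_level f k <= (norm_upper p * c * M)%:E)%E.
Proof.
move=> c0 M0 h; have L0 : 0 <= c * (rad k `^ s * M) by rewrite !mulr_ge0 ?powR_ge0.
have := Lnorm_levelfun_le (@duW f k) (Wdu_ge0 f k) p0 L0 h.
have g0 : (0 <= (2 `^ (k%:~R * s))%:E :> \bar R)%E by rewrite lee_fin powR_ge0.
move=> /(lee_wpmul2l g0)/le_trans; apply; rewrite -EFinM lee_fin.
rewrite [leLHS](_ : _ = norm_upper p * c * M * (rad k `^ s * 2 `^ (k%:~R * s))); last by ring.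
by rewrite rad_pow2 mulr1.
Qed.

Lemma BnormE (q : R) f : Bnorm dist mu S s p q%:E f =
  ((\esum_(k in [set: int]) (besov_level f k `^ q)) `^ q^-1)%E.
Proof. by []. Qed.

Lemma BnormyE f : Bnorm dist mu S s p +oo f = ereal_sup (range (besov_level f)).
Proof. by []. Qed.

(** Ensures that the real numbers [fine (besov_level f k)] used as coefficients are the true level
    norms. *)
Lemma besov_level_lty q f : (0 < q)%E -> (Bnorm dist mu S s p q f < +oo)%E ->
  forall k, (besov_level f k < +oo)%E.
Proof.
case: q => [q| |]//; rewrite ?lte_fin => q0 h k; last first.
  apply: le_lt_trans h; apply: ereal_sup_ubound; by exists k.
move: h; rewrite BnormE => /(lty_poweRy (invr_neq0 (lt0r_neq0 q0))) h.
apply: (lty_poweRy (lt0r_neq0 q0)); apply: le_lt_trans h.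
by apply: (@le_esum1 R _ [set: int] (fun k => besov_level f k `^ q)%E).
Qed.

Let d := decay_rate s p.
Let d0 : 0 < d := decay_rate_gt0 s01 ps.

Section Fun.
Variable f : Z -> R[i].
Hypothesis L1f : L1loc dist mu f.
Hypothesis ff : forall k, (besov_level f k < +oo)%E.

Let A k := norm_lower p * fine (besov_level f k).

Lemma besov_coef_ge0 k : 0 <= A k.
Proof. by rewrite /A mulr_ge0 ?norm_lower_ge0// fine_ge0// besov_level_ge0. Qed.

Let A0 := besov_coef_ge0.

(** The added 1 makes the constant positive, since [schur_lq] divides by it. *)
Definition err_level_const : R := norm_upper p * err_const s p + 1.

Lemma err_level_const_gt0 : 0 < err_level_const.
Proof. by rewrite ltr_wpDl// mulr_ge0 ?norm_upper_ge0 ?err_const_ge0. Qed.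

Lemma besov_level_err_le n k M : 0 <= M -> (forall j, n <= j -> decay d (j - k) * A j <= M) ->
  (besov_level (fun z => (Tn S psi n (Pav dist mu f) z - f z)%R) k <= (err_level_const * M)%:E)%E.
Proof.
move=> M0 hM.
have h := err_level s01 ps L1f A0 M0 (fun j _ => lvl_besov_level (ff j)) hM.
apply: le_trans (besov_level_le _ M0 h) _; first exact: err_const_ge0.
by rewrite lee_fin ler_wpM2r// lerDl.
Qed.

Definition Tn_const : R := nbr_bound * (lvl_add_const p * (err_const s p + 1)).

Lemma Tn_const_ge0 : 0 <= Tn_const.
Proof.
apply: mulr_ge0; first exact: le_trans nbr_bound_ge1.
by rewrite mulr_ge0 ?lvl_add_const_ge0// addr_ge0// err_const_ge0.
Qed.

Definition Tn_level_const : R := norm_upper p * Tn_const + 1.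

Lemma Tn_level_const_gt0 : 0 < Tn_level_const.
Proof. by rewrite ltr_wpDl// mulr_ge0 ?norm_upper_ge0 ?Tn_const_ge0. Qed.

(** Adding [f] back to the error contributes its own level [k], covered by the hypothesis at j = k.
    This level may be below [n], so the hypothesis ranges over all [j]. *)
Lemma besov_level_Tn_le n k M : 0 <= M -> (forall j, decay d (j - k) * A j <= M) ->
  (besov_level (Tn S psi n (Pav dist mu f)) k <= (Tn_level_const * M)%:E)%E.
Proof.
move=> M0 hM.
have h := err_level s01 ps L1f A0 M0 (fun j (_ : n <= j) => lvl_besov_level (ff j)) (fun j _ => hM j).
set e := fun x => fine _ in h.
have e0 x : 0 <= e x by exact: fine_du_ge0.
have L0 : 0 <= rad k `^ s * M by rewrite mulr_ge0 ?powR_ge0.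
have E0 : 0 <= err_const s p + 1 by rewrite addr_ge0// err_const_ge0.
have hL : lvl p k e ((err_const s p + 1) * (rad k `^ s * M)).
  apply: lvl_mono h => //; first by rewrite mulr_ge0// err_const_ge0.
    by move=> x _; rewrite lexx e0.
  by rewrite ler_wpM2r// lerDl.
have hW : lvl p k (Wdu f k) ((err_const s p + 1) * (rad k `^ s * M)).
  apply: lvl_mono (lvl_besov_level (ff k)) => //.
  - by rewrite mulr_ge0 ?powR_ge0// A0.
  - by move=> x _; rewrite lexx Wdu_ge0.
  - apply: (@le_trans _ _ (1 * (rad k `^ s * M))); last by rewrite ler_wpM2r// lerDr err_const_ge0.
    rewrite mul1r; apply: ler_wpM2l; first exact: powR_ge0.
    by have := hM k; rewrite subrr decay0 mul1r.
have EL0 := mulr_ge0 E0 L0.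
have nb : 0 <= nbr_bound by apply: le_trans nbr_bound_ge1.
have aEL0 := mulr_ge0 (lvl_add_const_ge0 p) EL0.
have eW x : 0 <= e x + Wdu f k x by rewrite addr_ge0 ?Wdu_ge0.
have h2 := lvlZ p0 nb aEL0 eW (lvlD p0 EL0 e0 (Wdu_ge0 f k) hL hW).
have h3 : lvl p k (Wdu (Tn S psi n (Pav dist mu f)) k) (Tn_const * (rad k `^ s * M)).
  apply: lvl_mono h2 => //; first exact: mulr_ge0.
    by move=> x _; rewrite Wdu_ge0/=; exact: du_Tn_le.
  by rewrite /Tn_const !mulrA.
apply: le_trans (besov_level_le Tn_const_ge0 M0 h3) _.
by rewrite lee_fin ler_wpM2r// lerDl.
Qed.

End Fun.

End BesovLevels.

(** * Uniform boundedness and convergence *)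

Lemma besov_coef_powR s p f k q : (besov_level s p f k < +oo)%E ->
  ((norm_lower p * fine (besov_level s p f k)) `^ q)%:E =
  ((norm_lower p `^ q)%:E * besov_level s p f k `^ q)%E.
Proof.
move=> h; have b0 := besov_level_ge0 s p f k.
have bf : besov_level s p f k \is a fin_num by rewrite ge0_fin_numE.
by rewrite powRM ?norm_lower_ge0 ?fine_ge0// EFinM -[in RHS](fineK bf) poweR_EFin.
Qed.

(** The test runs over all levels [j], not only j >= n, which makes the constant independent of [n].
    For q = +oo the decay factors are simply bounded by 1. *)
Lemma Tn_bounded (s : R) (p q : \bar R) : 0 < s < 1 -> ((Q / (Q + s))%:E < p)%E -> (0 < q)%E ->
  exists C' : R, forall f : Z -> R[i], inBesov dist mu S s p q f -> forall n : int,
    (Bnorm dist mu S s p q (Tn S psi n (Pav dist mu f)) <= C'%:E * Bnorm dist mu S s p q f)%E.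
Proof.
move=> s01 ps q0; pose K := Tn_level_const s p; pose l := norm_lower p.
have K0 : 0 < K by exact: Tn_level_const_gt0.
have l0 : 0 <= l by exact: norm_lower_ge0.
pose d := decay_rate s p; have d0 : 0 < d by exact: decay_rate_gt0 s01 ps.
case: q q0 => [q| |]// q0.
  have q0' := q0; rewrite lte_fin in q0; have D0 := schur_const_ge0 d0 q0.
  have KD0 : 0 <= K `^ q * schur_const d q by apply: mulr_ge0 => //; exact: powR_ge0.
  have E0 : 0 <= K `^ q * schur_const d q * l `^ q by apply: mulr_ge0 => //; exact: powR_ge0.
  exists ((K `^ q * schur_const d q * l `^ q) `^ q^-1) => f [L1f fin] n.
  have ff := besov_level_lty q0' fin.
  have B0 := besov_level_ge0 s p f.
  have A0 := besov_coef_ge0 s p f.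
  rewrite !BnormE -poweR_EFin -poweRM; last 2 first.
  - by rewrite lee_fin.
  - by apply: esum_ge0 => k _; exact: poweR_ge0.
  apply: gt0_ler_poweR; rewrite ?invr_ge0 ?(ltW q0)//.
  - by rewrite in_itv/= leey andbT; apply: esum_ge0 => k _; exact: poweR_ge0.
  - rewrite in_itv/= leey andbT mule_ge0 ?lee_fin//.
    by apply: esum_ge0 => k _; exact: poweR_ge0.
  apply: le_trans (@schur_lq d q K [set: int] _ _ d0 q0 K0 A0 (besov_level_ge0 s p _) _) _.
    move=> k M M0 hM; apply: (besov_level_Tn_le s01 ps L1f ff n M0) => j; exact: hM.
  rewrite [in leRHS]EFinM -muleA; apply: lee_wpmul2l; first by rewrite lee_fin.
  under eq_esum do rewrite besov_coef_powR//.
  by apply: esumZ_le => [|k]; [exact: powR_ge0|exact: poweR_ge0].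
exists (K * l) => f [L1f fin] n; have ff := besov_level_lty q0 fin.
have B0 := besov_level_ge0 s p f.
have A0 := besov_coef_ge0 s p f.
have N0 : (0 <= Bnorm dist mu S s p +oo f)%E.
  by apply: le_trans (B0 0) _; apply: ereal_sup_ubound; exists 0.
have bf : Bnorm dist mu S s p +oo f \is a fin_num by rewrite ge0_fin_numE.
rewrite [leLHS]BnormyE; apply: ge_ereal_sup => _ [k _ <-].
have M0 : 0 <= l * fine (Bnorm dist mu S s p +oo f) by rewrite mulr_ge0// fine_ge0.
apply: le_trans (besov_level_Tn_le s01 ps L1f ff n M0 _) _.
  move=> j; apply: (@le_trans _ _ (1 * (l * fine (besov_level s p f j)))).
    apply: ler_wpM2r; first exact: A0.
    by rewrite /decay -[leRHS](powRr0 2) ler_pow2// oppr_le0 mulr_ge0 ?(ltW d0)// ler0z.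
  rewrite mul1r; apply: ler_wpM2l => //; apply: fine_le => //; first by rewrite ge0_fin_numE.
  by apply: ereal_sup_ubound; exists j.
by rewrite -/K mulrA [in leLHS]EFinM fineK.
Qed.

Lemma cvge0_le (u : nat -> \bar R) : (forall n, 0 <= u n)%E ->
  (forall e : R, 0 < e -> exists n0 : nat, forall n, (n0 <= n)%N -> (u n <= e%:E)%E) ->
  u @ \oo --> (0 : \bar R).
Proof.
move=> u0 h; apply/fine_cvgP; split.
  have [n0 hn0] := h 1 ltr01; exists n0 => // n /= /hn0 un.
  by rewrite ge0_fin_numE// (le_lt_trans un)// ltry.
apply/cvgrPdist_le => e e0; have [n0 hn0] := h e e0; exists n0 => // n /= /hn0 un.
rewrite sub0r normrN ger0_norm ?fine_ge0//= -lee_fin fineK//.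
by rewrite ge0_fin_numE// (le_lt_trans un)// ltry.
Qed.

Lemma Tn_cvg (s : R) (p q : \bar R) (f : Z -> R[i]) :
  0 < s < 1 -> ((Q / (Q + s))%:E < p)%E -> (0 < q)%E -> (q < +oo)%E ->
  inBesov dist mu S s p q f ->
  (fun n : nat => Bnorm dist mu S s p q
     (fun z => Tn S psi n%:Z (Pav dist mu f) z - f z)) @ \oo --> (0 : \bar R).
Proof.
move=> s01 ps; case: q => [q| |]// q0 _ [L1f fin].
have ff := besov_level_lty q0 fin.
rewrite lte_fin in q0.
pose K := err_level_const s p; have K0 : 0 < K by exact: err_level_const_gt0.
pose d := decay_rate s p; have d0 : 0 < d by exact: decay_rate_gt0 s01 ps.
have D0 := schur_const_ge0 d0 q0.
have B0 := besov_level_ge0 s p f.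
have A0 := besov_coef_ge0 s p f.
pose c j := (norm_lower p * fine (besov_level s p f j)) `^ q.
have c0 j : 0 <= c j by exact: powR_ge0.
have cfin : (\esum_(j in [set: int]) (c j)%:E < +oo)%E.
  under eq_esum do rewrite /c besov_coef_powR//.
  apply: le_lt_trans (esumZ_le _ (powR_ge0 _ _) _) _; first by move=> j; exact: poweR_ge0.
  move: fin; rewrite BnormE => /(lty_poweRy (invr_neq0 (lt0r_neq0 q0))) fin.
  rewrite lte_mul_pinfty// ?lee_fin ?powR_ge0//.
pose E := K `^ q * schur_const d q.
have E0 : 0 <= E by rewrite mulr_ge0 ?powR_ge0.
apply: cvge0_le => [n|e e0]; first by rewrite BnormE; exact: poweR_ge0.
have E1 : 0 < E + 1 by rewrite ltr_wpDl.
(* This is where q < +oo enters: the q-th powers of the level norms form a convergent sum, whose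
   tails vanish. The threshold e^q / (E + 1) absorbs the constant [E] of the Schur test. *)
have [n0 hn0] := esum_tail_cvg0 c0 (divr_gt0 (powR_gt0 q e0) E1) cfin.
exists n0 => n /hn0 hn; rewrite BnormE.
apply: (@le_trans _ _ ((e `^ q)%:E `^ q^-1)%E); last first.
  by rewrite poweR_EFin -powRrM divff ?gt_eqF// powRr1// ltW.
apply: gt0_ler_poweR; rewrite ?invr_ge0 ?(ltW q0)//.
- by rewrite in_itv/= leey andbT; apply: esum_ge0 => k _; exact: poweR_ge0.
- by rewrite in_itv/= leey andbT lee_fin powR_ge0.
apply: le_trans (@schur_lq d q K [set j : int | n%:Z <= j] _ _ d0 q0 K0 A0 (besov_level_ge0 s p _) _) _.
  move=> k M M0 hM; exact: (besov_level_err_le s01 ps L1f ff M0 hM).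
rewrite -/E; apply: le_trans (lee_wpmul2l _ hn) _; first by rewrite lee_fin.
rewrite -EFinM lee_fin mulrCA ler_piMr ?powR_ge0// ler_pdivrMr// mul1r.
by rewrite lerDl.
Qed.
End Geometry.

Unset Implicit Arguments.
Set Strict Implicit.

Theorem theorem3p2 (R : realType) (dsp : measure_display) (Z : measurableType dsp)
  (dist : Z -> Z -> R) (mu : {measure set Z -> \bar R}) (C Q : R)
  (S : int -> set Z) (psi : int -> Z -> Z -> R) (C2 : R) :
  is_metric dist ->
  borel_measurable_structure dist ->
  balls_pos_finite dist mu ->
  1 <= C -> 0 < Q -> doubling_with dist mu C Q ->
  (forall n : int, maximal_separated dist n (S n)) ->
  psi_family dist S psi C2 ->
  (* (i) *)
  (forall (s : R) (p q : \bar R),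
      0 < s < 1 -> ((Q / (Q + s))%:E < p)%E -> (0 < q)%E ->
      exists C' : R, forall f : Z -> R[i], inBesov dist mu S s p q f ->
        forall n : int,
          (Bnorm dist mu S s p q (Tn S psi n (Pav dist mu f))
             <= C'%:E * Bnorm dist mu S s p q f)%E)
  /\
  (* (ii) *)
  (forall (s : R) (p q : \bar R),
      0 < s < 1 -> ((Q / (Q + s))%:E < p)%E -> (0 < q)%E -> (q < +oo)%E ->
      forall f : Z -> R[i], inBesov dist mu S s p q f ->
        (fun n : nat =>
           Bnorm dist mu S s p q
             (fun z => Tn S psi n%:Z (Pav dist mu f) z - f z)) @ \oo
        --> (0 : \bar R)).
Proof.
move=> metric borel pos C1 Q0 dbl net hpsi; split=> [s p q s01 ps q0|s p q s01 ps q0 qy f Bf].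
  exact: (Tn_bounded metric borel pos C1 Q0 dbl net hpsi).
exact: (Tn_cvg metric borel pos C1 Q0 dbl net hpsi).
Qed.
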